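(* Assume $p>1$ and let $f:[0,+\infty)\to\mathbb{R}$ be a continuous function which is locally Lipschitz continuous in $[0,+\infty)\setminus Z_f$, where $Z_f:=\{z\in[0,+\infty)\mid f(z)=0\}$, such that $$\liminf_{t\to z^+} \frac{f(t)}{(t-z)^{p-1}} > -\infty,\qquad \limsup_{t\to z^-} \frac{f(t)}{(z-t)^{p-1}} < +\infty \qquad\text{ for all } z\in Z_f.$$ Let $F(t)=\int_0^t f(s)\,ds$ and consider the problem $$(\ast)\quad \begin{cases} -\Delta_p u = f(u) & \text{ in } \mathbb{R}_+,\\ u \ge 0 & \text{ in } \mathbb{R}_+,\\ u(0)=0, ~ \|u\|_{L^\infty(\mathbb{R}_+)}<+\infty. \end{cases}$$ Then the following hold. (i) For each $\rho\in Z_f^*:=\{z\in Z_f,\ z>0 \mid F(t) < F(z) \text{ for all } t\in [0,z)\} \cup Z_f^0$, where $$Z_f^0= \begin{cases} \{z\in Z_f \mid F(t) < 0 = F(z) \text{ for all } t\in (0,z)\} &\text{ if } f(0) < 0,\\ \emptyset &\text{ otherwise}, \end{cases}$$ there exists a unique solution $u_\rho$ to $(\ast)$ such that $u_\rho'>0$ in $\mathbb{R}_+$, $\lim_{t\to+\infty} u_\rho(t)=\rho$ and $u_\rho'(0)=\left(\frac{p}{p-1}F(\rho)\right)^{1/p}$. (ii) If $f(0)<0$, then for each $$\rho\in P_f := \{z>0 \mid F(t) < 0 = F(z) \text{ for all } t\in (0,z) \text{ and } f(z)>0\},$$ there exists a unique solution $\tilde u_\rho$ to $(\ast)$ such that $\tilde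 u_\rho'>0$ in $(0,t^* )$, $\tilde u_\rho'(0)=\tilde u_\rho'(t^* )=0$, $\tilde u_\rho(t^* )=\rho$ and $$\tilde u_\rho(t+2kt^* )=\tilde u_\rho(t), \quad \tilde u_\rho(t+(2k+1)t^* )=\tilde u_\rho(t^*-t)$$ for all $t\in[0,t^*]$ and all $k\in\mathbb{N}$, where $$t^* = \left(\frac{p-1}{p}\right)^{1/p}\int_{0}^{\rho} \frac{ds}{\left[F(\rho)-F(s)\right]^{1/p}}.$$ Moreover, for every solution $u \not\equiv 0$ to $(\ast)$, either $u=u_\rho$ for some $\rho\in Z_f^*$, or $f(0)<0$ and $u=\tilde u_\rho$ for some $\rho\in P_f$.
   Context: $\mathbb{R}_+=(0,+\infty)$. In one dimension $\Delta_p u = (|u'|^{p-2}u')'$. Solutions are understood as functions $u\in C^1([0,+\infty))$ satisfying the equation in the weak (distributional) sense. $\mathbb{N}$ includes $0$. Since $f$ is defined on $[0,+\infty)$, at $z=0$ (if $0\in Z_f$) only the first ($t\to z^+$) of the two one-sided conditions on $f$ is meaningful and required. *)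

(* Defs.v *)
From HB Require Import structures.
From mathcomp Require Import all_boot all_order all_algebra.
From mathcomp Require Import all_classical all_reals all_analysis.

Set Implicit Arguments.
Unset Strict Implicit.
Unset Printing Implicit Defensive.

Import Order.TTheory GRing.Theory Num.Theory.
Import numFieldNormedType.Exports.

Local Open Scope classical_set_scope.
Local Open Scope ring_scope.

(* A function on [0, +oo[ is represented by a function R -> R whose values on
   the negative half-line are irrelevant: no definition below depends on them. *)

Definition zeros (R : realType) (f : R -> R) : set R :=
  [set z | 0 <= z /\ f z = 0].

Definition primitive (R : realType) (f : R -> R) (t : R) : R :=
  \int[lebesgue_measure]_(s in `[0, t]) f s.

(* The derivative of a function on [0, +oo[, one-sided at 0. *)
Definition hderive (R : realType) (u : R -> R) (t : R) : R :=
  if 0 < t then derive1 u t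
  else lim ((h^-1 * (u h - u 0)) @[h --> (0 : R)^'+]).

Definition C1_halfline (R : realType) (u : R -> R) : Prop :=
  [/\ {in `]0, +oo[, forall t : R, derivable u t 1},
      cvg ((h^-1 * (u h - u 0)) @[h --> (0 : R)^'+]) &
      {within `[0, +oo[, continuous (hderive u)}].

Definition test_function (R : realType) (phi : R -> R) : Prop :=
  [/\ forall n (x : R), derivable (derive1n n phi) x 1,
      compact (closure [set x | phi x != 0]) &
      closure [set x | phi x != 0] `<=` `]0, +oo[].

(* The weak form of - (|u'|^(p-2) u')' = f(u) in ]0, +oo[. Since 0 `^ a is 0 or
   1, the flux |u'|^(p-2) u' takes its usual value 0 where u' = 0, even when
   p < 2. *)
Definition weak_p_laplace (R : realType) (p : R) (f u : R -> R) : Prop :=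
  forall phi, test_function phi ->
    \int[lebesgue_measure]_(t in `]0, +oo[)
      (`|hderive u t| `^ (p - 2) * hderive u t * derive1 phi t) =
    \int[lebesgue_measure]_(t in `]0, +oo[) (f (u t) * phi t).

Definition solution (R : realType) (p : R) (f u : R -> R) : Prop :=
  [/\ C1_halfline u,
      weak_p_laplace p f u,
      forall t : R, 0 < t -> 0 <= u t,
      u 0 = 0 &
      ('N[lebesgue_measure]_(+oo) [EFin \o (u \_ `]0, +oo[)%R] < +oo)%E].

Definition zeros0 (R : realType) (f : R -> R) : set R :=
  if f 0 < 0 then
    [set z | [/\ zeros f z, forall t : R, 0 < t < z -> primitive f t < 0 &
                 primitive f z = 0]]
  else set0.

Definition zeros_star (R : realType) (f : R -> R) : set R :=
  [set z | [/\ zeros f z, 0 < z &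
               forall t : R, 0 <= t < z -> primitive f t < primitive f z]]
  `|` zeros0 f.

Definition periodic_heights (R : realType) (f : R -> R) : set R :=
  [set z | [/\ 0 < z, forall t : R, 0 < t < z -> primitive f t < 0,
               primitive f z = 0 & 0 < f z]].

Definition increasing_solution (R : realType) (p : R) (f : R -> R) (rho : R)
    (u : R -> R) : Prop :=
  [/\ solution p f u,
      forall t : R, 0 < t -> 0 < hderive u t,
      u t @[t --> +oo] --> rho &
      hderive u 0 = (p / (p - 1) * primitive f rho) `^ p^-1].

(* A divergent integral would yield 0 here. Existence of a periodic_solution for
   rho > 0 rules this out, since then u 0 = 0 and u (half_period p f rho) = rho.
   The integrand is singular at rho, where it takes the irrelevant value 0. *)
Definition half_period (R : realType) (p : R) (f : R -> R) (rho : R) : R :=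
  ((p - 1) / p) `^ p^-1 *
  \int[lebesgue_measure]_(s in `[0, rho])
    ((primitive f rho - primitive f s) `^ p^-1)^-1.

Definition periodic_solution (R : realType) (p : R) (f : R -> R) (rho : R)
    (u : R -> R) : Prop :=
  let T := half_period p f rho in
  [/\ solution p f u,
      forall t : R, 0 < t < T -> 0 < hderive u t,
      hderive u 0 = 0 /\ hderive u T = 0,
      u T = rho &
      forall (t : R) (k : nat), 0 <= t <= T ->
        u (t + (2 * k)%:R * T) = u t /\
        u (t + (2 * k + 1)%:R * T) = u (T - t)].

Definition unique_on_halfline (R : realType) (P : (R -> R) -> Prop)
    (u : R -> R) : Prop :=
  P u /\ forall v, P v -> {in `[0, +oo[, v =1 u}.

(* Main.v *)
(** The flux [w = |u'|^(p-2) u'] of a solution satisfies [w' = - f(u)] (du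
    Bois-Reymond), so the energy [|u'|^p + p/(p-1) F(u)] is constant. The
    one-sided bounds on [f] at its zeros [z] turn conservation of energy into
    [|u'| <= K |u - z|] near a rest point, and Gronwall's inequality then keeps
    a nontrivial solution from ever resting at a zero of [f]. Hence either
    [u' > 0] forever and [u] converges to a point of [Z_f^*], or [u'] has a
    first zero [t^*], where [u = rho] and [f(rho) > 0].

    While [u' > 0] the energy makes [u] a solution of the first-order equation
    [u' = H(u)] with [H > 0]; it is unique because its inverse is the time map
    [y |-> \int_0^y ds / H(s)]. Applied on both sides of a critical point, this
    gives the reflection symmetry and therefore the periodicity. Conversely,
    inverting the time map produces [u_rho] and [tilde u_rho]; comparison of
    the time map with multiples of the flux [(F(rho) - F(y))^(1 - 1/p)], when
    [f(rho) > 0], and of [- ln (rho - y)], when [f(rho) = 0], decides whether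
    [rho] is reached in finite time. *)

Require Import Defs.
From HB Require Import structures.
From mathcomp Require Import all_boot all_order all_algebra.
From mathcomp Require Import all_classical all_reals all_analysis.
From mathcomp Require Import measurable_realfun ess_sup_inf ring lra.

Set Implicit Arguments.
Unset Strict Implicit.
Unset Printing Implicit Defensive.

Import Order.TTheory GRing.Theory Num.Theory.
Import numFieldNormedType.Exports.

Local Open Scope classical_set_scope.
Local Open Scope ring_scope.

(* [lra] tries to reify the whole context, which is slow when it is large. *)
Ltac linarith :=
  repeat match goal with
  | H : ?P |- _ =>
    lazymatch type of P with Prop => idtac end;
    lazymatch P with
    | is_true (Order.le _ _) => fail
    | is_true (Order.lt _ _) => fail
    | is_true (andb _ _) => fail
    | _ = _ => fail
    | _ => clear H
    end
  end; lra.

(** * Real functions of one variable *)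

(** The speed [H] dictated by the energy need not be Lipschitz, and it vanishes at a turning height,
    where [u' = H(u)] also admits a constant solution. Uniqueness for the first-order equation is
    therefore claimed only on open time intervals of positive speed. Each use needs the sign of [u']
    next to a critical point, and that sign comes from the second-order equation, through the sign
    of [f] at the critical height. For a nontrivial solution starting from rest it gives [f(0) < 0],
    since [u] may not become negative.

    [u'] need not be differentiable where it vanishes: only the flux is differentiated, and [|u'|^p]
    is treated as a power of the flux. Functions on the half-line are composed with [max(x, 0)], so
    that continuity is global and derivatives are two-sided.

    The periodic solution is not glued from pieces. It is an increasing arc composed with a triangle
    wave, and its regularity at the turning times follows because these times are isolated. *)

Lemma continuous_atP (R : realType) (f : R -> R) (x : R) :
  {for x, continuous f} <->
  forall e, 0 < e -> exists2 d, 0 < d &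
    forall y, x - d < y < x + d -> f x - e < f y < f x + e.
Proof.
split=> [fx e e0|H].
  move/cvgrPdist_lt : fx => /(_ _ e0) /nbhs_ballP[d /= d0 fd].
  exists d => // y xy; have : `|f x - f y| < e.
    by apply: fd; rewrite /ball/= ltr_norml; linarith.
  by rewrite ltr_norml; linarith.
apply/cvgrPdist_lt => e /H [d d0 fd].
apply/nbhs_ballP; exists d => //= y; rewrite /ball/= ltr_norml => xy.
have := fd y; rewrite ltr_norml => /(_ ltac:(linarith)); linarith.
Qed.

Lemma is_derive_continuous (R : realType) (f : R -> R) (x l : R) :
  is_derive x 1 f l -> {for x, continuous f}.
Proof.
by move=> fx; apply/differentiable_continuous/derivable1_diffP; exact: ex_derive.
Qed.

Lemma continuous_within_segment (R : realType) (f : R -> R) (a b : R) :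
  (forall x, a <= x <= b -> {for x, continuous f}) ->
  {within `[a, b], continuous f}.
Proof.
move=> cf; apply: continuous_in_subspaceT => x; rewrite inE/= in_itv/=; exact: cf.
Qed.

Lemma mean_value (R : realType) (f df : R -> R) (a b : R) : a < b ->
  (forall x, a <= x <= b -> {for x, continuous f}) ->
  (forall x, a < x < b -> is_derive x 1 f (df x)) ->
  exists2 c, a < c < b & f b - f a = df c * (b - a).
Proof.
move=> ab cf dfE.
have dfI x : x \in `]a, b[ -> is_derive x 1 f (df x).
  by rewrite in_itv/=; exact: dfE.
have [c + ->] := MVT ab dfI (continuous_within_segment cf).
by rewrite in_itv/= => cab; exists c.
Qed.

Lemma derive_gt0_lt (R : realType) (f df : R -> R) (a b : R) : a < b ->
  (forall x, a <= x <= b -> {for x, continuous f}) ->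
  (forall x, a < x < b -> is_derive x 1 f (df x)) ->
  (forall x, a < x < b -> 0 < df x) -> f a < f b.
Proof.
move=> ab cf dfE df0; have [c cab E] := mean_value ab cf dfE.
by rewrite -subr_gt0 E mulr_gt0 ?df0// subr_gt0.
Qed.

Lemma derive_ge0_le (R : realType) (f df : R -> R) (a b : R) : a <= b ->
  (forall x, a <= x <= b -> {for x, continuous f}) ->
  (forall x, a < x < b -> is_derive x 1 f (df x)) ->
  (forall x, a < x < b -> 0 <= df x) -> f a <= f b.
Proof.
rewrite le_eqVlt => /predU1P[->//|ab] cf dfE df0.
have [c cab E] := mean_value ab cf dfE.
by rewrite -subr_ge0 E mulr_ge0 ?df0// subr_ge0 ltW.
Qed.

Lemma derive_eq0_cst (R : realType) (f : R -> R) (a b : R) : a <= b ->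
  (forall x, a <= x <= b -> {for x, continuous f}) ->
  (forall x, a < x < b -> is_derive x 1 f 0) -> f a = f b.
Proof.
rewrite le_eqVlt => /predU1P[->//|ab] cf dfE.
have [c cab] := @mean_value _ f (fun=> 0) _ _ ab cf dfE.
by rewrite mul0r => /eqP; rewrite subr_eq0 => /eqP.
Qed.

Lemma intermediate_value (R : realType) (f : R -> R) (a b v : R) : a <= b ->
  (forall x, a <= x <= b -> {for x, continuous f}) ->
  f a <= v <= f b \/ f b <= v <= f a -> exists2 c, a <= c <= b & f c = v.
Proof.
move=> ab cf fv; have [||c + <-] := @IVT _ f a b v ab.
- exact: continuous_within_segment.
- by rewrite ge_min le_max; case: fv => /andP[-> ->]; rewrite ?orbT.
- by rewrite in_itv/= => cab; exists c.
Qed.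

Lemma first_zero (R : realType) (g : R -> R) (a b : R) : a <= b ->
  (forall x, a <= x <= b -> {for x, continuous g}) -> g a != 0 -> g b = 0 ->
  exists2 c, a < c <= b & g c = 0 /\ forall x, a <= x < c -> g x != 0.
Proof.
move=> ab cg ga gb.
pose A := [set x | a <= x <= b /\ g x = 0].
have hA : has_inf A.
  split; first by exists b; split=> //; rewrite ab lexx.
  by exists a => x [/andP[]].
have Ac x : A x -> inf A <= x by move=> Ax; apply: ge_inf => //; case: hA.
have ac : a <= inf A by apply: lb_le_inf; [case: hA|move=> x [/andP[]]].
have cb : inf A <= b by apply: Ac; split=> //; rewrite ab lexx.
have gc : g (inf A) = 0.
  apply/eqP/negPn/negP => gc.
  have e0 : 0 < `|g (inf A)| by rewrite normr_gt0.
  have cgc : {for inf A, continuous g} by apply: cg; rewrite ac.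
  have [d d0 gd] := (continuous_atP _ _).1 cgc _ e0.
  have [x [xab gx] xd] := @inf_adherent _ A _ d0 hA.
  have cx : inf A <= x by exact: Ac.
  have /= := gd x ltac:(linarith).
  rewrite gx; have [h|h] := ltrP 0 (g (inf A)).
    by rewrite gtr0_norm//; linarith.
  by rewrite ler0_norm//; linarith.
exists (inf A).
  rewrite cb andbT lt_neqAle ac andbT; apply: contra ga => /eqP ->.
  by rewrite gc.
split=> // x /andP[ax xc]; apply/eqP => gx.
by have := Ac x; rewrite leNgt xc => /(_ _)/negP; apply=> //; split => //; linarith.
Qed.

(** [Phi] may have finite or infinite limits at the ends of []a, b[], so the inverse is extended to
    all times: it stays at [a] before the range of [Phi] and at [b] after it. The last clause
    replaces [Phi (g t) = t] at times outside that range; it tells whether a height has been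
    passed. *)
Lemma generalized_inverse (R : realType) (Phi phi : R -> R) (a b : R) : a < b ->
  (forall y, a < y < b -> is_derive y 1 Phi (phi y)) ->
  (forall y, a < y < b -> 0 < phi y) ->
  exists g : R -> R, [/\ continuous g, forall t, a <= g t <= b,
    forall y, a < y < b -> g (Phi y) = y,
    forall y, a < y < b -> is_derive (Phi y) 1 g (phi y)^-1 &
    forall t y, a < y < b -> (y < g t -> Phi y < t) /\ (g t < y -> t < Phi y)].
Proof.
move=> ab dPhi phi0.
have Phi_lt x y : a < x -> x < y -> y < b -> Phi x < Phi y.
  move=> ax xy yb; apply: (@derive_gt0_lt _ Phi phi) => // z zxy.
  - by apply: is_derive_continuous; apply: dPhi; linarith.
  - by apply: dPhi; linarith.
  - by apply: phi0; linarith.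
(* Adjoining [a] keeps the set nonempty when [t] lies below all values of [Phi]. *)
pose A t := [set x | x = a \/ (a < x < b /\ Phi x < t)].
have hA t : has_sup (A t).
  split; first by exists a; left.
  by exists b => x [->|[/andP[_ /ltW]]]; first exact: ltW.
have Ag t x : A t x -> x <= sup (A t).
  by move=> Ax; apply: ub_le_sup => //; case: (hA t).
pose g t := sup (A t).
have gab t : a <= g t <= b.
  apply/andP; split; first by apply: Ag; left.
  apply: ge_sup; first by exists a; left.
  by move=> x [->|[/andP[_ /ltW]]]; first exact: ltW.
have g1 t y : a < y < b -> y < g t -> Phi y < t.
  move=> yab yg; have e0 : 0 < g t - y by rewrite subr_gt0.
  have [x Ax xg] := sup_adherent e0 (hA t).
  have {xg} yx : y < x by rewrite -/(g t) in xg; linarith.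
  case: Ax => [xa|[xab xt]]; first by linarith.
  by apply: lt_trans xt; apply: Phi_lt => //; linarith.
have g2w t y : a < y < b -> g t < y -> t <= Phi y.
  move=> yab gy; rewrite leNgt; apply/negP => h.
  by have : y <= g t; [by apply: Ag; right|linarith].
have g2 t y : a < y < b -> g t < y -> t < Phi y.
  move=> yab gy; have gt := gab t.
  apply: (@le_lt_trans _ _ (Phi ((g t + y) / 2))).
    by apply: g2w; linarith.
  by apply: Phi_lt; linarith.
have gK y : a < y < b -> g (Phi y) = y.
  move=> yab; apply/eqP; rewrite eq_le !leNgt; apply/andP; split; apply/negP.
    by move=> /(g1 _ _ yab); rewrite ltxx.
  by move=> /(g2 _ _ yab); rewrite ltxx.
have cg : continuous g.
  move=> t; apply/continuous_atP => e e0.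
  have [d1 d10 H1] : exists2 d, 0 < d & forall s, s < t + d -> g s < g t + e.
    have [gtb|gtb] := ltP (g t) b; last first.
      by exists 1 => // s _; have := gab s; linarith.
    have [y /andP[gy yb] ye] : exists2 y, g t < y < b & y < g t + e.
      by have [h|h] := ltP (g t + e) b;
        [exists (g t + e / 2)|exists ((g t + b) / 2)]; linarith.
    have ty : t < Phi y by apply: g2 => //; have := gab t; linarith.
    exists (Phi y - t); first by rewrite subr_gt0.
    move=> s st; rewrite ltNge; apply/negP => h.
    have := @g1 s y; have := gab t; linarith.
  have [d2 d20 H2] : exists2 d, 0 < d & forall s, t - d < s -> g t - e < g s.
    have [gtb|gtb] := ltP a (g t); last first.
      by exists 1 => // s _; have := gab s; linarith.
    have [y /andP[gy yb] ye] : exists2 y, a < y < g t & g t - e < y.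
      by have [h|h] := ltP a (g t - e);
        [exists (g t - e / 2)|exists ((g t + a) / 2)]; linarith.
    have ty : Phi y < t by apply: g1 => //; have := gab t; linarith.
    exists (t - Phi y); first by rewrite subr_gt0.
    move=> s st; rewrite ltNge; apply/negP => h.
    have := @g2 s y; have := gab t; linarith.
  exists (Num.min d1 d2); first by rewrite lt_min d10.
  move=> s; have h1 : Num.min d1 d2 <= d1 by rewrite ge_min lexx.
  have h2 : Num.min d1 d2 <= d2 by rewrite ge_min lexx orbT.
  by move=> st; rewrite H1 ?H2//; linarith.
exists g; split=> // [y yab|t y yab]; last by split; [exact: g1|exact: g2].
apply: is_derive_inverse.
- have : \forall z \near y, z \in `]a, b[ by apply: near_in_itvoo; rewrite in_itv.
  by apply: filterS => z; rewrite in_itv/=; exact: gK.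
- have : \forall z \near y, z \in `]a, b[ by apply: near_in_itvoo; rewrite in_itv.
  apply: filterS => z; rewrite in_itv/= => zab.
  by apply: is_derive_continuous; exact: dPhi.
- exact: dPhi.
- by rewrite gt_eqF// phi0.
Qed.

(** If [g] took an interior value at the image of an endpoint, the midpoint between that value and
    the endpoint would contradict strict monotonicity. *)
Lemma generalized_inverse_closed (R : realType) (Phi phi : R -> R) (a b : R) : a < b ->
  (forall y, a <= y <= b -> {for y, continuous Phi}) ->
  (forall y, a < y < b -> is_derive y 1 Phi (phi y)) ->
  (forall y, a < y < b -> 0 < phi y) ->
  exists g : R -> R, [/\ continuous g, forall t, a <= g t <= b,
    forall y, a <= y <= b -> g (Phi y) = y &
    forall y, a < y < b -> is_derive (Phi y) 1 g (phi y)^-1].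
Proof.
move=> ab cPhi dPhi phi0.
have [g [cg gab gK dg gP]] := generalized_inverse ab dPhi phi0.
have mono x y : a <= x -> x < y -> y <= b -> Phi x < Phi y.
  move=> x0 xy yL; apply: (@derive_gt0_lt _ Phi phi) => // z zxy.
  - by apply: cPhi; linarith.
  - by apply: dPhi; linarith.
  - by apply: phi0; linarith.
exists g; split=> // s.
have [->|sa] := eqVneq s a.
  move=> _; have := gab (Phi a); have [h|h] := ltP a (g (Phi a)); last by linarith.
  move=> gab0; have := (gP (Phi a) ((a + g (Phi a)) / 2) ltac:(linarith)).1 ltac:(linarith).
  by have := mono a ((a + g (Phi a)) / 2); linarith.
have [->|sb] := eqVneq s b.
  move=> _; have := gab (Phi b); have [h|h] := ltP (g (Phi b)) b; last by linarith.
  move=> gab0; have := (gP (Phi b) ((g (Phi b) + b) / 2) ltac:(linarith)).2 ltac:(linarith).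
  by have := mono ((g (Phi b) + b) / 2) b; linarith.
by move=> sab; apply: gK; rewrite !lt_neqAle eq_sym sa sb; linarith.
Qed.

(** The inverse [g] of [u1] is the time map, with derivative [1 / H]. Hence [g \o u2] has derivative
    [1] and is the identity, whatever the regularity of [H]. Assuming [u2 L <= u1 L] keeps the
    values of [u2] inside the range of [u1]. *)
Lemma autonomous_uniqueness (R : realType) (H u1 u2 : R -> R) (L : R) :
  (forall t, 0 <= t <= L -> {for t, continuous u1}) ->
  (forall t, 0 <= t <= L -> {for t, continuous u2}) ->
  (forall t, 0 < t < L -> is_derive t 1 u1 (H (u1 t))) ->
  (forall t, 0 < t < L -> is_derive t 1 u2 (H (u2 t))) ->
  (forall t, 0 < t < L -> 0 < H (u1 t)) ->
  (forall t, 0 < t < L -> 0 < H (u2 t)) ->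
  u1 0 = u2 0 -> forall t, 0 <= t <= L -> u1 t = u2 t.
Proof.
wlog uL : u1 u2 / u2 L <= u1 L => [hw|].
  have [h|/ltW h] := leP (u2 L) (u1 L); first exact: hw.
  move=> c1 c2 d1 d2 p1 p2 u0 t t0L; apply/esym/hw => //.
move=> c1 c2 d1 d2 p1 p2 u0 t t0L.
have [L0|L0] := leP L 0; first by have -> : t = 0 by linarith.
have [g [cg _ gK dg]] := generalized_inverse_closed L0 c1 d1 p1.
have mono (u : R -> R) (cu : forall t, 0 <= t <= L -> {for t, continuous u})
    (du : forall t, 0 < t < L -> is_derive t 1 u (H (u t)))
    (pu : forall t, 0 < t < L -> 0 < H (u t)) :
    forall x y, 0 <= x -> x < y -> y <= L -> u x < u y.
  move=> x y x0 xy yL; apply: (@derive_gt0_lt _ u (H \o u)) => // z zxy /=.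
  - by apply: cu; linarith.
  - by apply: du; linarith.
  - by apply: pu; linarith.
have m2 := mono _ c2 d2 p2.
have ivt r : 0 <= r <= L -> exists2 s, 0 <= s <= L & u1 s = u2 r.
  move=> r0L; apply: intermediate_value => //; first by linarith.
  left; apply/andP; split.
    by rewrite u0; have [->//|r0] := eqVneq r 0; apply/ltW/m2; rewrite ?lt_neqAle 1?eq_sym ?r0; linarith.
  apply: le_trans uL; have [->//|rL] := eqVneq r L.
  by apply/ltW/m2; rewrite ?lt_neqAle ?rL; linarith.
have gu2 r : 0 <= r <= L -> g (u2 r) = r.
  move=> r0L; suff : g (u2 0) - 0 = g (u2 r) - r.
    by rewrite -u0 gK ?lexx ?ltW//; linarith.
  apply: (@derive_eq0_cst _ (fun r => g (u2 r) - r) 0 r) => [|x xr|x xr]; first by linarith.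
    apply: continuousB; last exact: cvg_id.
    by apply: continuous_comp; [apply: c2; linarith|exact: cg].
  have [s s0L us] := ivt x ltac:(linarith).
  have s0 : s != 0.
    by apply/eqP => s0; move: us; rewrite s0 u0; have := m2 0 x; linarith.
  have sL : s != L.
    by apply/eqP => sL; move: us; rewrite sL; have := m2 x L; linarith.
  have s0L' : 0 < s < L by rewrite !lt_neqAle eq_sym s0 sL; linarith.
  have dgs := dg s s0L'; rewrite us in dgs.
  have dus := d2 x ltac:(linarith).
  apply: is_derive_eq.
  rewrite mulVf ?subrr// gt_eqF// p2//; linarith.
have [s s0L us] := ivt t t0L.
by rewrite -us -[in RHS](gK _ s0L) us gu2.
Qed.

Lemma fundamental_theorem (R : realType) (G g : R -> R) (a b : R) : a <= b ->
  (forall x, a <= x <= b -> {for x, continuous G}) ->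
  (forall x, a <= x <= b -> {for x, continuous g}) ->
  (forall x, a < x < b -> is_derive x 1 G (g x)) ->
  (\int[lebesgue_measure]_(x in `[a, b]) (g x)%:E = (G b - G a)%:E)%E.
Proof.
rewrite le_eqVlt => /predU1P[<- _ _ _|ab cG cg dG].
  by rewrite set_itv1 integral_set1 subrr.
apply: continuous_FTC2 => //.
- exact: continuous_within_segment.
- split.
  + by move=> x; rewrite in_itv/= => xab; have ? := dG _ xab; exact: ex_derive.
  + by apply: cvg_at_right_filter; apply: cG; rewrite lexx ltW.
  + by apply: cvg_at_left_filter; apply: cG; rewrite lexx ltW.
- by move=> x; rewrite in_itv/= => xab; have := dG _ xab => dGx; rewrite derive1E derive_val.
Qed.

Lemma Rfundamental_theorem (R : realType) (G g : R -> R) (a b : R) : a <= b ->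
  (forall x, a <= x <= b -> {for x, continuous G}) ->
  (forall x, a <= x <= b -> {for x, continuous g}) ->
  (forall x, a < x < b -> is_derive x 1 G (g x)) ->
  \int[lebesgue_measure]_(x in `[a, b]) g x = G b - G a.
Proof.
by move=> ab cG cg dG; rewrite /Rintegral (fundamental_theorem ab cG cg dG).
Qed.

Lemma continuous_segment_integrable (R : realType) (g : R -> R) (a b : R) :
  (forall x, a <= x <= b -> {for x, continuous g}) ->
  (@lebesgue_measure R).-integrable `[a, b] (EFin \o g).
Proof.
move=> cg; apply: continuous_compact_integrable; first exact: segment_compact.
exact: continuous_within_segment.
Qed.

(** The integral from [c] is differentiated only strictly to the right of [c], so [c] is to be
    chosen to the left of all points of interest. *)
Lemma primitive_exists (R : realType) (g : R -> R) (c : R) :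
  (forall x, c <= x -> {for x, continuous g}) ->
  exists G : R -> R, forall x, c < x -> is_derive x 1 G (g x).
Proof.
move=> cg; exists (fun x => \int[lebesgue_measure]_(t in `[c, x]) g t) => x cx.
have [||||dG GE] := @continuous_FTC1_closed R g c x (x + 1).
- by rewrite ltrDl.
- by apply: continuous_segment_integrable => z /andP[cz _]; exact: cg.
- exact: cx.
- by apply: cg; exact: ltW.
by apply: DeriveDef; [exact: dG|rewrite -derive1E; exact: GE].
Qed.

(** [k] may blow up at both ends. Being nonnegative, it is integrated by monotone convergence over
    compact intervals exhausting []a, b[], and the right-hand sides converge by continuity of
    [g]. *)
Lemma improper_fundamental_theorem (R : realType) (g k : R -> R) (a b : R) :
  a < b -> continuous g ->
  (forall x, a < x < b -> {for x, continuous k}) ->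
  (forall x, a < x < b -> is_derive x 1 g (k x)) ->
  (forall x, a < x < b -> 0 <= k x) ->
  \int[lebesgue_measure]_(x in `[a, b]) k x = g b - g a.
Proof.
move=> ab cg ck dg k0.
(* The denominator [n + 2] gives [e n <= (b - a) / 2], so that no interval [F n] is reversed. *)
pose e (n : nat) : R := (b - a) / n.+2%:R.
have e_ge0 n : 0 < e n by rewrite divr_gt0// subr_gt0.
have e_half n : e n <= (b - a) / 2.
  by rewrite ler_pM2l ?subr_gt0// lef_pV2 ?posrE// ler_nat.
have e_le m n : (m <= n)%N -> e n <= e m.
  by move=> mn; rewrite ler_pM2l ?subr_gt0// lef_pV2 ?posrE// ler_nat !ltnS.
have e_cvg : e n @[n --> \oo] --> (0 : R).
  rewrite -[X in _ --> X](mulr0 (b - a)).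
  apply: cvgM; first exact: cvg_cst.
  have := @cvg_harmonic R; rewrite -(cvg_shiftS (@harmonic R)).
  by apply: cvg_trans; apply: near_eq_cvg; near=> n.
pose F (n : nat) := `[a + e n, b - e n]%classic.
have Fab n x : F n x -> a < x < b.
  by rewrite /F/= in_itv/=; have := e_ge0 n; have := e_half n; linarith.
have bF : \bigcup_n F n = `]a, b[%classic.
  apply/seteqP; split=> [x [n _]|x]; first by move=> /Fab; rewrite /= in_itv.
  rewrite /= in_itv/= => xab.
  pose d := Num.min (x - a) (b - x).
  have d0 : 0 < d by rewrite lt_min; apply/andP; split; linarith.
  have [N _ /(_ N (leqnn _))/=] := (cvgrPdist_lt _ _).1 e_cvg _ d0.
  rewrite sub0r normrN gtr0_norm// lt_min => /andP[h1 h2].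
  by exists N => //; rewrite /F/= in_itv/=; linarith.
have mk : measurable_fun `]a, b[ k.
  apply: open_continuous_measurable_fun; first exact: interval_open.
  by move=> x; rewrite inE/= in_itv/=; exact: ck.
have FE n : (\int[lebesgue_measure]_(x in F n) (k x)%:E = (g (b - e n) - g (a + e n))%:E)%E.
  have := e_half n; have := e_ge0 n => e1 e2.
  apply: fundamental_theorem => [|x xab|x xab|x xab].
  - by linarith.
  - exact: cg.
  - by apply: ck; linarith.
  - by apply: dg; linarith.
have Fint : (\int[lebesgue_measure]_(x in F n) (k x)%:E @[n --> \oo] -->
    \int[lebesgue_measure]_(x in `]a, b[) (k x)%:E)%E.
  rewrite -bF; apply: ge0_nondecreasing_set_cvg_integral => [m n mn|n|n|n x].
  - apply/subsetPset => x; rewrite /F/= !in_itv/=.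
    by have := e_le _ _ mn; linarith.
  - exact: measurable_itv.
  - apply/measurable_EFinP.
    by apply: measurable_funS mk => // x /Fab; rewrite /= in_itv.
  - by move=> /Fab xab; rewrite lee_fin k0.
have Fg : (\int[lebesgue_measure]_(x in F n) (k x)%:E @[n --> \oo] --> (g b - g a)%:E)%E.
  under eq_fun do rewrite FE.
  apply: cvg_EFin; first by near=> n.
  have bn : b - e n @[n --> \oo] --> b.
    by rewrite -[X in _ --> X]subr0; apply: cvgB => //; exact: cvg_cst.
  have an : a + e n @[n --> \oo] --> a.
    by rewrite -[X in _ --> X]addr0; apply: cvgD => //; exact: cvg_cst.
  apply: cvgB; [exact: cvg_comp bn (cg b)|exact: cvg_comp an (cg a)].
rewrite /Rintegral integral_itv_bndoo; last exact/measurable_EFinP.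
by rewrite -(cvg_lim _ Fint)// (cvg_lim _ Fg).
Unshelve. all: by end_near. Qed.

Lemma Rintegral_halfline_support (R : realType) (h : R -> R) (a b : R) : 0 < a ->
  (forall x, ~~ (a <= x <= b) -> h x = 0) ->
  \int[lebesgue_measure]_(x in `]0, +oo[) h x =
  \int[lebesgue_measure]_(x in `[a, b]) h x.
Proof.
move=> a0 h0; rewrite Rintegral_mkcond [RHS]Rintegral_mkcond.
congr Rintegral; apply/funext => x; rewrite !patchE !mem_setE !in_itv/= andbT.
case: ifPn => [x0|x0]; case: ifPn => // xab; first exact: h0.
by exfalso; move/negP: x0; apply; linarith.
Qed.

(** Turns continuity relative to the half-line into continuity on the whole line, so that later
    arguments never deal with one-sided filters at [0]. *)
Lemma continuous_clamp (R : realType) (T : topologicalType) (u : R -> T) :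
  {within `[0, +oo[, continuous u} -> continuous (fun t : R => u (Num.max t 0)).
Proof.
move=> cu; have cm : continuous (fun t : R => Num.max t 0).
  by move=> t; apply: continuous_max; [exact: cvg_id|exact: cvg_cst].
have mt (t : R) : `[0, +oo[%classic (Num.max t 0).
  by rewrite /= in_itv/= andbT le_max lexx orbT.
move=> t; have /subspace_continuousP/(_ _ (mt t)) := cu.
apply: cvg_comp => P /= Pt.
have : nbhs t ((fun s : R => Num.max s 0) @^-1`
    [set y | `[0, +oo[%classic y -> P y]) by exact: cm t _ Pt.
by apply: filterS => s /(_ (mt s)).
Qed.

(** * The flux and its inverse *)

Definition flux (R : realType) (p y : R) : R := `|y| `^ (p - 2) * y.

Lemma fluxN (R : realType) (p y : R) : flux p (- y) = - flux p y.
Proof. by rewrite /flux normrN mulrN. Qed.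

Lemma flux0 (R : realType) (p : R) : flux p 0 = 0.
Proof. by rewrite /flux mulr0. Qed.

Lemma flux_ge0E (R : realType) (p y : R) : 1 < p -> 0 <= y ->
  flux p y = y `^ (p - 1).
Proof.
move=> p1; rewrite /flux le_eqVlt => /predU1P[<-|y0].
  by rewrite mulr0 powR0// subr_eq0 gt_eqF.
rewrite gtr0_norm// -[X in _ * X]powRr1 ?ltW// -powRD; last by rewrite (gt_eqF y0) implybT.
by congr (_ `^ _); linarith.
Qed.

Lemma norm_flux (R : realType) (p y : R) : 1 < p -> `|flux p y| = `|y| `^ (p - 1).
Proof.
move=> p1; have [y0|y0] := leP 0 y.
  by rewrite flux_ge0E// (ger0_norm y0) ger0_norm// powR_ge0.
rewrite -[y]opprK fluxN !normrN flux_ge0E ?oppr_ge0 ?ltW//.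
by rewrite ger0_norm ?powR_ge0// ltr0_norm.
Qed.

Lemma flux_gt0 (R : realType) (p y : R) : (0 < flux p y) = (0 < y).
Proof.
have [y0|y0|->] := ltgtP y 0; last by rewrite flux0 ltxx.
  rewrite -[y]opprK fluxN oppr_gt0; apply/negbTE; rewrite -leNgt.
  by rewrite mulr_ge0 ?powR_ge0// oppr_ge0 ltW.
by rewrite /flux mulr_gt0// powR_gt0// normr_gt0 gt_eqF.
Qed.

Lemma flux_lt0 (R : realType) (p y : R) : (flux p y < 0) = (y < 0).
Proof. by rewrite -oppr_gt0 -fluxN flux_gt0 oppr_gt0. Qed.

Lemma conjugate_exponent_gt1 (R : realType) (p : R) : 1 < p -> 1 < p / (p - 1).
Proof. by move=> p1; rewrite ltr_pdivlMr; linarith. Qed.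

(** With [q = p / (p - 1)] one has [(p - 1) * (q - 1) = 1], so the fluxes of conjugate exponents are
    inverse to each other. *)
Lemma fluxK (R : realType) (p y : R) : 1 < p -> flux (p / (p - 1)) (flux p y) = y.
Proof.
move=> p1; wlog y0 : y / 0 <= y => [hw|].
  have [|/ltW y0] := leP 0 y; first exact: hw.
  by apply: oppr_inj; rewrite -!fluxN hw// oppr_ge0.
rewrite (flux_ge0E p1 y0) flux_ge0E ?powR_ge0// ?conjugate_exponent_gt1//.
rewrite -powRrM; have -> : (p - 1) * (p / (p - 1) - 1) = 1.
  by field; rewrite subr_eq0 gt_eqF.
by rewrite powRr1.
Qed.

Lemma continuous_norm_powR (R : realType) (a : R) : 0 < a ->
  continuous (fun x : R => `|x| `^ a).
Proof.
move=> a0 x; have [->|x0] := eqVneq x 0.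
  apply/continuous_atP => e e0.
  exists (e `^ a^-1); first exact: powR_gt0.
  move=> y yd; rewrite normr0 powR0 ?gt_eqF//.
  have ye : `|y| < e `^ a^-1 by rewrite ltr_norml; linarith.
  have : `|y| `^ a < (e `^ a^-1) `^ a.
    by rewrite gt0_ltr_powR// ?nnegrE ?powR_ge0.
  rewrite -powRrM mulVf ?gt_eqF// powRr1 ?ltW// => h.
  by have := powR_ge0 `|y| a; linarith.
apply: (@continuous_comp _ _ _ (fun x : R => `|x|) (fun y => y `^ a)).
  exact: norm_continuous.
apply/differentiable_continuous/derivable1_diffP; apply: derivable_powR.
by rewrite in_itv/= andbT normr_gt0.
Qed.

(** At [0] the factor [|y|^(p - 2)] may be singular; continuity there comes from
    [|flux p y| = |y|^(p - 1)]. *)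
Lemma continuous_flux (R : realType) (p : R) : 1 < p -> continuous (flux p).
Proof.
move=> p1 y; have [->|y0] := eqVneq y 0.
  have := @continuous_norm_powR R (p - 1) ltac:(linarith) 0.
  move=> /continuous_atP h; apply/continuous_atP => e /h [d d0 hd].
  exists d => // z /hd; rewrite flux0 normr0 powR0 ?subr_eq0 ?gt_eqF//.
  rewrite -norm_flux// => yd; have : `|flux p z| < e by linarith.
  by rewrite ltr_norml; linarith.
apply: (@continuousM _ _ (fun x : R => `|x| `^ (p - 2)) id y); last exact: cvg_id.
apply: (@continuous_comp _ _ _ (fun x : R => `|x|) (fun y => y `^ (p - 2))).
  exact: norm_continuous.
apply/differentiable_continuous/derivable1_diffP; apply: derivable_powR.
by rewrite in_itv/= andbT normr_gt0.
Qed.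

Lemma is_derive_norm_powR (R : realType) (p y : R) : 1 < p ->
  is_derive y 1 (fun x : R => `|x| `^ p) (p * flux p y).
Proof.
move=> p1.
have pos (x : R) : 0 < x -> is_derive x 1 (fun x : R => `|x| `^ p) (p * flux p x).
  move=> x0; apply: (@near_eq_is_derive _ _ _ (fun x => x `^ p)).
    near=> z; rewrite gtr0_norm//; near: z; exact: lt_nbhsr.
  by apply: is_derive_eq; [exact: is_derive1_powR|rewrite flux_ge0E ?ltW].
have [y0|y0|->] := ltgtP y 0.
- have -> : (fun x : R => `|x| `^ p) = (fun x : R => `|x| `^ p) \o -%R.
    by apply/funext => x /=; rewrite normrN.
  have yN : 0 < - y by rewrite oppr_gt0.
  have := pos _ yN => ?; apply: is_derive_eq.
  by rewrite mulrN1 fluxN mulrN opprK.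
- exact: pos.
(* Since [|z|^p = flux p z * z], the flux itself is the slope function at [0]. *)
- apply/is_derive1_caratheodory; exists (flux p); split.
  + have p0 : p != 0 by rewrite gt_eqF//; linarith.
    move=> z; rewrite normr0 powR0// !subr0.
    rewrite /flux -mulrA -expr2 -real_normK ?num_real// -powR_mulrn//.
    have [->|z0] := eqVneq z 0.
      by rewrite normr0 powR0// (@powR0 _ 2%:R) ?mulr0// pnatr_eq0.
    by rewrite -powRD ?normr_eq0 ?z0 ?implybT//; congr (_ `^ _); linarith.
  + exact: continuous_flux.
  + by rewrite flux0 mulr0.
Unshelve. all: by end_near. Qed.

Lemma powR_inv_le (R : realType) (p x y : R) : 0 < p -> 0 <= x -> 0 <= y ->
  x `^ p <= y -> x <= y `^ p^-1.
Proof.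
move=> p0 x0 y0 xy.
have -> : x = (x `^ p) `^ p^-1 by rewrite -powRrM mulfV ?gt_eqF// powRr1.
by rewrite ge0_ler_powR// ?nnegrE ?invr_ge0 ?powR_ge0// ltW.
Qed.

Lemma powR_invK (R : realType) (p x : R) : 0 < p -> 0 <= x ->
  (x `^ p) `^ p^-1 = x.
Proof. by move=> p0 x0; rewrite -powRrM mulfV ?gt_eqF// powRr1. Qed.

Lemma powR_Kinv (R : realType) (p x : R) : 0 < p -> 0 <= x ->
  (x `^ p^-1) `^ p = x.
Proof. by move=> p0 x0; rewrite -powRrM mulVf ?gt_eqF// powRr1. Qed.

(** A Gronwall argument without exponentials. If [y b] is nonzero, let [s] be the last zero of [y]
    before [b], found as a first zero after time reversal. On a short interval of length at most [h]
    after [s], the maximum [m] of [|y|] satisfies [m <= K * m * h < m]. *)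
Lemma sublinear_derivative_eq0 (R : realType) (y dy : R -> R) (a b K d : R) :
  a <= b -> 0 <= K -> 0 < d ->
  (forall t, a <= t <= b -> {for t, continuous y}) ->
  (forall t, a < t < b -> is_derive t 1 y (dy t)) ->
  (forall t, a < t < b -> `|y t| < d -> `|dy t| <= K * `|y t|) ->
  y a = 0 -> y b = 0.
Proof.
move=> ab K0 d0 cy yE ydK ya; apply/eqP/negPn/negP => yb.
pose z t := y (a + b - t).
have cz t : a <= t <= b -> {for t, continuous z}.
  move=> tab; apply: (@continuous_comp _ _ _ (fun t => a + b - t) y).
    by apply: continuousB; [exact: cvg_cst|exact: cvg_id].
  by apply: cy; linarith.
have [||s0 s0ab [zs0 zN0]] := first_zero ab cz.
- by rewrite /z [a + b]addrC addrK.
- by rewrite /z addrK.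
pose s := a + b - s0.
have sab : a <= s < b by rewrite /s; linarith.
have ys : y s = 0 by [].
have yN0 t : s < t <= b -> y t != 0.
  move=> st; have := zN0 (a + b - t); rewrite /z.
  have -> : a + b - (a + b - t) = t by ring.
  by apply; rewrite /s in st; linarith.
have [d1 d10 yd1] := (continuous_atP _ _).1 (cy s ltac:(linarith)) d d0.
(* This choice gives [K * h < 1], also when [K = 0]. *)
pose h := (2 * K + 1)^-1.
have h0 : 0 < h by rewrite invr_gt0; linarith.
have Kh : K * h < 1.
  by rewrite ltr_pdivrMr ?mul1r; linarith.
pose t2 := Num.min b (Num.min (s + d1 / 2) (s + h)).
have st2 : s < t2 by rewrite !lt_min; apply/and3P; split; linarith.
have t2b : t2 <= b by rewrite ge_min lexx.
have t2d : t2 <= s + d1 / 2 by rewrite !ge_min lexx orbT.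
have t2h : t2 <= s + h by rewrite !ge_min lexx !orbT.
have [||xi + ximax] := @EVT_max R (fun t => `|y t|) s t2.
- exact: ltW.
- apply: continuous_within_segment => x xst.
  apply: (@continuous_comp _ _ _ y (fun x : R => `|x|)); last exact: norm_continuous.
  by apply: cy; linarith.
rewrite in_itv/= => xist.
have [xis|xis] := eqVneq xi s.
  have := ximax t2; rewrite in_itv/= lexx ltW// xis ys normr0 normr_le0.
  by move=> /(_ isT); apply/negP/yN0; rewrite st2.
have sxi : s < xi by rewrite lt_neqAle eq_sym xis; linarith.
have [||c cs] := @mean_value _ y dy s xi sxi.
- by move=> x xsx; apply: cy; linarith.
- by move=> x xsx; apply: yE; linarith.
rewrite ys subr0 => yxi.
have m0 : 0 < `|y xi| by rewrite normr_gt0; apply: yN0; linarith.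
have yc : `|y c| <= `|y xi| by apply: ximax; rewrite in_itv/=; linarith.
have dyc : `|dy c| <= K * `|y c|.
  apply: ydK; first by linarith.
  have := yd1 c ltac:(linarith); rewrite ys ltr_norml; linarith.
have : `|y xi| <= K * `|y xi| * h.
  rewrite {1}yxi normrM (@gtr0_norm _ (xi - s)) ?subr_gt0//.
  apply: ler_pM => //; [by linarith| |by linarith].
  by apply: (le_trans dyc); rewrite ler_wpM2l.
rewrite mulrAC; apply/negP; rewrite -ltNge gtr_pMl//.
Qed.

(** * Classical solutions *)

(** The derivative at [0] is two-sided, so the chain rule for [F (u t)] applies at times where
    [u t = 0]. *)
Definition potential (R : realType) (g F : R -> R) : Prop :=
  [/\ continuous g, forall x : R, 0 <= x -> is_derive x 1 F (g x) & F 0 = 0].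

(** The integrated form of the two one-sided bounds on the nonlinearity. Only an upper bound on
    [F z - F s] is asked for, because this difference is what equals [|u'|^p], up to a factor, for
    an orbit of the energy level of [z]. *)
Definition subpower_at_zeros (R : realType) (p : R) (g F : R -> R) : Prop :=
  forall z : R, 0 <= z -> g z = 0 -> exists C d : R, [/\ 0 <= C, 0 < d &
    forall s : R, 0 <= s -> `|s - z| < d -> F z - F s <= C * `|s - z| `^ p].

(** [v] stands for [u'] and is carried along separately: at times [t <= 0] it is only a continuous
    extension. The second-order equation is stated for the flux, since [v] may fail to be
    differentiable where it vanishes. *)
Definition classical_solution (R : realType) (p : R) (g u v : R -> R) : Prop :=
  [/\ continuous u /\ continuous v,
      forall t : R, 0 < t -> is_derive t 1 u (v t),
      forall t : R, 0 < t -> is_derive t 1 (fun s => flux p (v s)) (- g (u t)),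
      (forall t : R, 0 <= t -> 0 <= u t) /\ u 0 = 0 &
      exists M, forall t : R, 0 <= t -> u t <= M].

Lemma constant_sign (R : realType) (v : R -> R) (a b : R) :
  (forall t, a < t < b -> {for t, continuous v}) ->
  (forall t, a < t < b -> v t != 0) ->
  (forall t, a < t < b -> 0 < v t) \/ (forall t, a < t < b -> v t < 0).
Proof.
move=> cv v0; have [[s sab vs]|H] := pselect (exists2 s, a < s < b & v s < 0).
  right => t tab; rewrite ltNge; apply/negP => vt.
  have [st|/ltW ts] := leP s t.
    have [||c cst vc] := @intermediate_value R v s t 0 st.
    - by move=> x xst; apply: cv; linarith.
    - by left; rewrite ltW.
    by have := v0 c; rewrite vc eqxx => /(_ _)/negP; apply => //; linarith.
  have [||c cst vc] := @intermediate_value R v t s 0 ts.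
  - by move=> x xst; apply: cv; linarith.
  - by right; rewrite (ltW vs).
  by have := v0 c; rewrite vc eqxx => /(_ _)/negP; apply => //; linarith.
left => t tab; rewrite lt_neqAle eq_sym v0//= leNgt; apply/negP => vt.
by apply: H; exists t.
Qed.

Lemma norm_flux_conjugate (R : realType) (p y : R) : 1 < p ->
  `|flux p y| `^ (p / (p - 1)) = `|y| `^ p.
Proof.
move=> p1; rewrite norm_flux// -powRrM; congr (_ `^ _).
by field; rewrite subr_eq0 gt_eqF.
Qed.

(** Put [q = p / (p - 1)]. Then [|v|^p] is the [q]-th power of the norm of the flux, so its
    derivative is [q * flux q (flux p v) * (- g u) = - q * v * g u], which cancels the derivative of
    [q * F u]. *)
Lemma energy (R : realType) (p : R) (g F u v : R -> R) (t : R) : 1 < p ->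
  potential g F -> classical_solution p g u v -> 0 <= t ->
  `|v t| `^ p = `|v 0| `^ p - p / (p - 1) * F (u t).
Proof.
move=> p1 [cg dF F0] [[cu cv] du dw [u0 u00] _] t0.
set k := p / (p - 1).
suff : `|v 0| `^ p + k * F (u 0) = `|v t| `^ p + k * F (u t).
  by rewrite u00 F0 mulr0; linarith.
apply: (@derive_eq0_cst R (fun s => `|v s| `^ p + k * F (u s)) 0 t) => //.
  move=> x /andP[x0 _]; apply: continuousD.
    apply: (@continuous_comp _ _ _ v (fun y : R => `|y| `^ p)); first exact: cv.
    by apply: continuous_norm_powR; linarith.
  apply: continuousM; first exact: cvg_cst.
  apply: (@continuous_comp _ _ _ u F); first exact: cu.
  by apply: is_derive_continuous; apply: dF; exact: u0.
move=> x /andP[x0 xt].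
have -> : (fun s => `|v s| `^ p + k * F (u s)) =
    ((fun y : R => `|y| `^ k) \o (fun s => flux p (v s))) + (fun=> k) * (F \o u).
  by apply/funext => s /=; rewrite /k -(norm_flux_conjugate (v s) p1).
have h1 := is_derive_norm_powR (flux p (v x)) (conjugate_exponent_gt1 p1).
have h2 := @is_derive1_comp R _ (fun s => flux p (v s)) x _ _ h1 (dw _ x0).
have h3 := @is_derive1_comp R F u x _ _ (dF _ (u0 _ (ltW x0))) (du _ x0).
have h4 := is_deriveD h2 (is_deriveM (is_derive_cst k x (1 : R)) h3).
apply: (@is_derive_eq _ _ _ _ _ _ _ _ h4).
by rewrite fluxK// /GRing.scale/= -/k; ring.
Qed.

Lemma rest_at_zero (R : realType) (p : R) (g F u v : R -> R) (t0 t : R) : 1 < p ->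
  potential g F -> subpower_at_zeros p g F -> classical_solution p g u v ->
  0 <= t0 -> v t0 = 0 -> g (u t0) = 0 -> 0 <= t -> u t = u t0.
Proof.
move=> p1 pF pz su t00 vt0 gut0 t_ge0.
have p0 : 0 < p by linarith.
have k0 : 0 < p / (p - 1) by apply: divr_gt0; linarith.
have en s := @energy R p g F u v s p1 pF su.
have [[cu cv] du dw [u0 u00] _] := su.
have [C [d [C0 d0 Cd]]] := pz _ (u0 _ t00) gut0.
set z := u t0 in gut0 Cd *.
(* Being at rest at height [z] fixes the energy level, so at all times [|v|^p] is [p / (p - 1)]
   times [F z - F u]. *)
have E : `|v 0| `^ p = p / (p - 1) * F z.
  have := en t0 t00; rewrite vt0 normr0 powR0 ?gt_eqF// -/z => ?.
  by apply/eqP; rewrite -subr_eq0; apply/eqP.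
pose K := (p / (p - 1) * C) `^ p^-1.
have vK s : 0 <= s -> `|u s - z| < d -> `|v s| <= K * `|u s - z|.
  move=> s0 usz.
  rewrite -[X in _ * X](@powR_invK _ p)// -powRM ?powR_ge0//; last first.
    by rewrite mulr_ge0// ltW.
  apply: powR_inv_le => //.
    by apply: mulr_ge0; [apply: mulr_ge0; [exact: ltW|]|exact: powR_ge0].
  rewrite en// E -mulrBr -mulrA ler_wpM2l// ?Cd ?u0//; exact: ltW.
apply/eqP; rewrite -subr_eq0; apply/eqP.
have [tt0|/ltW tt0] := leP t0 t.
  apply: (@sublinear_derivative_eq0 R (fun s => u s - z) v t0 t K d) => //.
  - exact: powR_ge0.
  - by move=> s _; apply: continuousB; [exact: cu|exact: cvg_cst].
  - move=> s st; have := du s ltac:(linarith) => dus.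
    by apply: is_derive_eq; rewrite subr0.
  - by move=> s st; apply: vK; linarith.
  - by rewrite subrr.
(* For times before [t0] the same estimate is applied to the time-reversed function. *)
have -> : u t - z = (fun s => u (t0 - s) - z) (t0 - t) by rewrite /= subKr.
apply: (@sublinear_derivative_eq0 R (fun s => u (t0 - s) - z)
  (fun s => - v (t0 - s)) 0 (t0 - t) K d) => //.
- by linarith.
- exact: powR_ge0.
- move=> s _; apply: continuousB; last exact: cvg_cst.
  apply: (@continuous_comp _ _ _ (fun s => t0 - s) u); last exact: cu.
  by apply: continuousB; [exact: cvg_cst|exact: cvg_id].
- move=> s st; have := du (t0 - s) ltac:(linarith) => dus.
  have -> : (fun s => u (t0 - s) - z) = (u \o (cst t0 - id)) - cst z by [].
  by apply: is_derive_eq; rewrite subr0 sub0r mulrN1.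
- by move=> s st; rewrite normrN; apply: vK; linarith.
- by rewrite subr0 subrr.
Qed.

(** * Sign of the velocity near a critical point *)

Lemma continuous_reaction (R : realType) (p : R) (g u v : R -> R) :
  continuous g -> classical_solution p g u v -> continuous (fun t => g (u t)).
Proof.
move=> cg [[cu _] _ _ _ _] t.
by apply: (@continuous_comp _ _ _ u g); [exact: cu|exact: cg].
Qed.

Lemma continuous_flux_comp (R : realType) (p : R) (g u v : R -> R) : 1 < p ->
  classical_solution p g u v -> continuous (fun t => flux p (v t)).
Proof.
move=> p1 [[_ cv] _ _ _ _] t.
by apply: (@continuous_comp _ _ _ v (flux p)); [exact: cv|exact: continuous_flux].
Qed.

(** The flux vanishes at [t0] and has derivative [- g u], whose sign persists near [t0]. The mean
    value theorem gives the sign of the flux, which is the sign of [v]. The next two lemmas follow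
    the same pattern. *)
Lemma velocity_after_max (R : realType) (p : R) (g u v : R -> R) (t0 : R) :
  1 < p -> continuous g -> classical_solution p g u v ->
  0 <= t0 -> v t0 = 0 -> 0 < g (u t0) ->
  exists2 e, 0 < e & forall t, t0 < t < t0 + e -> v t < 0.
Proof.
move=> p1 cg su t00 vt0 gt0.
have cgu := continuous_reaction cg su; have cw := continuous_flux_comp p1 su.
have [_ _ dw _ _] := su.
have [e e0 ge] := (continuous_atP _ _).1 (cgu t0) _ gt0.
exists e => // t t0t; rewrite -(flux_lt0 p) -(flux0 p) -vt0 -subr_lt0.
have [|||c ct ->] := @mean_value R (fun t => flux p (v t)) (fun t => - g (u t)) t0 t.
- by linarith.
- by move=> x _; exact: cw.
- by move=> x xt; apply: dw; linarith.
by rewrite mulNr oppr_lt0 mulr_gt0//; [have := ge c; linarith|linarith].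
Qed.

Lemma velocity_after_min (R : realType) (p : R) (g u v : R -> R) (t0 : R) :
  1 < p -> continuous g -> classical_solution p g u v ->
  0 <= t0 -> v t0 = 0 -> g (u t0) < 0 ->
  exists2 e, 0 < e & forall t, t0 < t < t0 + e -> 0 < v t.
Proof.
move=> p1 cg su t00 vt0 gt0.
have cgu := continuous_reaction cg su; have cw := continuous_flux_comp p1 su.
have [_ _ dw _ _] := su.
have gN0 : 0 < - g (u t0) by rewrite oppr_gt0.
have [e e0 ge] := (continuous_atP _ _).1 (cgu t0) _ gN0.
exists e => // t t0t; rewrite -(flux_gt0 p) -(flux0 p) -vt0 -subr_gt0.
have [|||c ct ->] := @mean_value R (fun t => flux p (v t)) (fun t => - g (u t)) t0 t.
- by linarith.
- by move=> x _; exact: cw.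
- by move=> x xt; apply: dw; linarith.
by rewrite mulr_gt0//; [have := ge c; linarith|linarith].
Qed.

Lemma velocity_before_min (R : realType) (p : R) (g u v : R -> R) (t0 : R) :
  1 < p -> continuous g -> classical_solution p g u v ->
  0 < t0 -> v t0 = 0 -> g (u t0) < 0 ->
  exists2 e, 0 < e & forall t, 0 <= t -> t0 - e < t < t0 -> v t < 0.
Proof.
move=> p1 cg su t00 vt0 gt0.
have cgu := continuous_reaction cg su; have cw := continuous_flux_comp p1 su.
have [_ _ dw _ _] := su.
have gN0 : 0 < - g (u t0) by rewrite oppr_gt0.
have [e e0 ge] := (continuous_atP _ _).1 (cgu t0) _ gN0.
exists e => // t t_ge0 t0t; rewrite -(flux_lt0 p) -(flux0 p) -vt0 -subr_gt0.
have [|||c ct ->] := @mean_value R (fun t => flux p (v t)) (fun t => - g (u t)) t t0.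
- by linarith.
- by move=> x _; exact: cw.
- by move=> x xt; apply: dw; linarith.
by rewrite mulr_gt0//; [have := ge c; linarith|linarith].
Qed.

(** Resting at a zero of [g] makes [u] constant, hence equal to [u 0 = 0]. *)
Lemma rest_reaction_neq0 (R : realType) (p : R) (g F u v : R -> R) (t0 : R) :
  1 < p -> potential g F -> subpower_at_zeros p g F -> classical_solution p g u v ->
  (exists2 t : R, 0 <= t & u t != 0) -> 0 <= t0 -> v t0 = 0 -> g (u t0) != 0.
Proof.
move=> p1 pF pz su [t t_ge0 ut] t00 vt0; apply/eqP => gut0.
have const s : 0 <= s -> u s = u t0.
  by move=> s0; exact: (rest_at_zero p1 pF pz su).
have [_ _ _ [_ u00] _] := su.
by move: ut; rewrite const// -(const 0)// u00 eqxx.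
Qed.

(** Either [v t0] is nonzero, or [g (u t0)] is and drives the flux away from [0]. Applied at
    [t0 = 0], this makes a first positive zero of [v] meaningful even when [v 0 = 0]. *)
Lemma velocity_neq0_after (R : realType) (p : R) (g F u v : R -> R) (t0 : R) :
  1 < p -> potential g F -> subpower_at_zeros p g F -> classical_solution p g u v ->
  (exists2 t : R, 0 <= t & u t != 0) -> 0 <= t0 ->
  exists2 e : R, 0 < e & forall t, t0 < t < t0 + e -> v t != 0.
Proof.
move=> p1 pF pz su nt t00; have [cg _ _] := pF; have [[_ cv] _ _ _ _] := su.
have [vt0|vt0] := eqVneq (v t0) 0.
  have := rest_reaction_neq0 p1 pF pz su nt t00 vt0.
  rewrite neq_lt => /orP[gt|gt].
    have [e e0 ve] := velocity_after_min p1 cg su t00 vt0 gt.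
    by exists e => // t /ve; exact: lt0r_neq0.
  have [e e0 ve] := velocity_after_max p1 cg su t00 vt0 gt.
  by exists e => // t /ve; exact: ltr0_neq0.
have vn0 : 0 < `|v t0| by rewrite normr_gt0.
have [e e0 ve] := (continuous_atP _ _).1 (cv t0) _ vn0.
exists e => // t tt0; have := ve t ltac:(linarith); apply: contraTN => /eqP ->.
have [h|h] := leP 0 (v t0); first by rewrite ger0_norm// subrr ltxx.
by rewrite ltr0_norm// subrr ltxx andbF.
Qed.

Lemma velocity_dichotomy (R : realType) (p : R) (g F u v : R -> R) :
  1 < p -> potential g F -> subpower_at_zeros p g F -> classical_solution p g u v ->
  (exists2 t : R, 0 <= t & u t != 0) ->
  (forall t : R, 0 < t -> 0 < v t) \/
  exists2 t1 : R, 0 < t1 & v t1 = 0 /\ forall t, 0 < t < t1 -> 0 < v t.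
Proof.
move=> p1 pF pz su nt; have [[cu cv] du _ [u0 u00] _] := su.
(* A function that is nonnegative and starts from [0] cannot begin by decreasing. *)
have pos b : 0 < b -> (forall t, 0 < t < b -> v t != 0) ->
    forall t, 0 < t < b -> 0 < v t.
  move=> b0 v0; have [//|vneg] := constant_sign (fun t _ => cv t) v0.
  suff : u (b / 2) < u 0 by have := u0 (b / 2); rewrite u00; linarith.
  have [|||c cb E] := @mean_value R u v 0 (b / 2).
  - by linarith.
  - by move=> x _; exact: cu.
  - by move=> x xb; apply: du; linarith.
  rewrite -subr_lt0 E subr0 pmulr_llt0; last by linarith.
  by apply: vneg; linarith.
have [[t t_gt0 vt]|H] := pselect (exists2 t : R, 0 < t & v t = 0); last first.
  left => t t0; apply: (pos (t + 1)); [by linarith| |by linarith].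
  by move=> s st; apply/eqP => vs; apply: H; exists s => //; linarith.
right; have [e e0 ve] := velocity_neq0_after p1 pF pz su nt (lexx 0).
have vs s : 0 < s < e -> v s != 0 by move=> se; apply: ve; linarith.
have et : e <= t by rewrite leNgt; apply/negP => te; have := vs t; rewrite vt eqxx t_gt0 te => /(_ isT).
(* The search starts at [e / 2] because [v] may vanish at [0]. *)
have [||||c ce [vc vNc]] := @first_zero R v (e / 2) t.
- by linarith.
- by move=> x _; exact: cv.
- by apply: vs; linarith.
- by [].
exists c; first by linarith.
split=> //; apply: pos; first by linarith.
by move=> s sc; have [es|es] := leP (e / 2) s; [apply: vNc|apply: vs]; linarith.
Qed.

Lemma speed_energy (R : realType) (p : R) (g F u v : R -> R) (t : R) : 1 < p ->
  potential g F -> classical_solution p g u v -> 0 <= t ->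
  `|v t| = (`|v 0| `^ p - p / (p - 1) * F (u t)) `^ p^-1.
Proof.
move=> p1 pF su t0; rewrite -(energy p1 pF su t0) powR_invK//; linarith.
Qed.

(** The height [y] is crossed at an inner time with positive speed, so the energy leaves strictly
    less potential there than at [t1], where the speed is [0]. *)
Lemma potential_below_max (R : realType) (p : R) (g F u v : R -> R) (t1 y : R) :
  1 < p -> potential g F -> classical_solution p g u v -> 0 < t1 -> v t1 = 0 ->
  (forall t, 0 < t < t1 -> 0 < v t) -> 0 < y < u t1 -> F y < F (u t1).
Proof.
move=> p1 pF su t10 vt1 vpos y0.
have [[cu cv] _ _ [u0 u00] _] := su.
have k0 : 0 < p / (p - 1) by apply: divr_gt0; linarith.
have [|||s st1 us] := @intermediate_value R u 0 t1 y.
- exact: ltW.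
- by move=> x _; exact: cu.
- by left; rewrite u00; linarith.
have s0 : s != 0 by apply/eqP => s0; move: us; rewrite s0 u00; linarith.
have s1 : s != t1 by apply/eqP => s1; move: us; rewrite s1; linarith.
have vs : 0 < v s by apply: vpos; rewrite !lt_neqAle eq_sym s0 s1; linarith.
have e1 := energy p1 pF su (ltW t10); have e2 := @energy R p g F u v s p1 pF su ltac:(linarith).
move: e1; rewrite vt1 normr0 powR0; last by rewrite gt_eqF//; linarith.
have : 0 < `|v s| `^ p by rewrite powR_gt0// normr_gt0 gt_eqF.
rewrite e2 us => h1 h2; rewrite -subr_gt0 -(pmulr_rgt0 _ k0); linarith.
Qed.

(** The arcs before and after [t1], parametrized by the distance to [t1], solve the same first-order
    equation. The inequality [0 < g (u t1)] holds because a negative value would make [v] negative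
    just before [t1]. It also starts the descent, which then has to be continued up to [t1 + t1]. *)
Lemma reflection (R : realType) (p : R) (g F u v : R -> R) (t1 : R) :
  1 < p -> potential g F -> subpower_at_zeros p g F -> classical_solution p g u v ->
  0 < t1 -> v t1 = 0 -> (forall t, 0 < t < t1 -> 0 < v t) ->
  [/\ 0 < g (u t1), v (t1 + t1) = 0 & forall s, 0 <= s <= t1 -> u (t1 + s) = u (t1 - s)].
Proof.
move=> p1 pF pz su t10 vt1 vpos.
have [[cu cv] du dw [u0 u00] _] := su; have [cg _ _] := pF.
have up x y : 0 <= x -> x < y -> y <= t1 -> u x < u y.
  move=> x0 xy yt; apply: (@derive_gt0_lt _ u v) => // z zxy.
  - exact: cu.
  - by apply: du; linarith.
  - by apply: vpos; linarith.
have nt : exists2 t : R, 0 <= t & u t != 0.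
  by exists t1; [exact: ltW|rewrite gt_eqF// -u00 up].
have gu : 0 < g (u t1).
  have := rest_reaction_neq0 p1 pF pz su nt (ltW t10) vt1.
  rewrite neq_lt => /orP[gt|//].
  have [e e0 ve] := velocity_before_min p1 cg su t10 vt1 gt.
  pose s := t1 - Num.min e t1 / 2.
  have m1 : Num.min e t1 <= e by rewrite ge_min lexx.
  have m2 : Num.min e t1 <= t1 by rewrite ge_min lexx orbT.
  have m0 : 0 < Num.min e t1 by rewrite lt_min e0.
  by have := ve s; have := vpos s; rewrite /s; linarith.
(* Both arcs descend from [u t1]; negating them makes the speed positive, as [autonomous_uniqueness]
   requires. *)
pose H y := (`|v 0| `^ p - p / (p - 1) * F (- y)) `^ p^-1.
have sym L : 0 <= L <= t1 -> (forall s, 0 < s < L -> v (t1 + s) < 0) ->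
    forall s, 0 <= s <= L -> u (t1 + s) = u (t1 - s).
  move=> Lt1 vneg s sL; apply: oppr_inj; apply/esym.
  pose y1 := fun s => - u (t1 - s); pose y2 := fun s => - u (t1 + s).
  have H1 r : 0 < r < L -> H (y1 r) = v (t1 - r).
    move=> rL; rewrite /H /y1 opprK -(speed_energy p1 pF su); last by linarith.
    by rewrite gtr0_norm//; apply: vpos; linarith.
  have H2 r : 0 < r < L -> H (y2 r) = - v (t1 + r).
    move=> rL; rewrite /H /y2 opprK -(speed_energy p1 pF su); last by linarith.
    by rewrite ltr0_norm//; exact: vneg.
  apply: (@autonomous_uniqueness R H y1 y2 L _ _ _ _ _ _ _ s sL).
  - move=> r _; apply: continuousN; apply: (@continuous_comp _ _ _ (fun s => t1 - s) u).
      by apply: continuousB; [exact: cvg_cst|exact: cvg_id].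
    exact: cu.
  - move=> r _; apply: continuousN; apply: (@continuous_comp _ _ _ (fun s => t1 + s) u).
      by apply: continuousD; [exact: cvg_cst|exact: cvg_id].
    exact: cu.
  - move=> r rL; rewrite H1//; have := du (t1 - r) ltac:(linarith) => dur.
    have -> : y1 = - (u \o (cst t1 - id)) by [].
    by apply: is_derive_eq; rewrite sub0r mulrN1 opprK.
  - move=> r rL; rewrite H2//; have := du (t1 + r) ltac:(linarith) => dur.
    have -> : y2 = - (u \o (cst t1 + id)) by [].
    by apply: is_derive_eq; rewrite add0r mulr1.
  - by move=> r rL; rewrite H1//; apply: vpos; linarith.
  - by move=> r rL; rewrite H2// oppr_gt0; apply: vneg.
  - by rewrite /y1 /y2 subr0 addr0.
have [e e0 ve] := velocity_after_max p1 cg su (ltW t10) vt1 gu.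
have vneg s : 0 < s < t1 -> v (t1 + s) < 0.
  have [es|se] := ltP s e; first by move=> st; apply: ve; linarith.
  move=> st; rewrite ltNge; apply/negP => vs.
  have [|||b bs vb] := @intermediate_value R v (t1 + e / 2) (t1 + s) 0.
  - by linarith.
  - by move=> x _; exact: cv.
  - by left; rewrite vs andbT ltW// ve; linarith.
  have ve2 : v (t1 + e / 2) < 0 by apply: ve; linarith.
  have [||||c ce [vc vNc]] := @first_zero R v (t1 + e / 2) b.
  - by linarith.
  - by move=> x _; exact: cv.
  - exact: ltr0_neq0.
  - by [].
  have vneg r : t1 < r < c -> v r < 0.
    have [r0 rc|h|h] := @constant_sign R v t1 c (fun t _ => cv t).
    - by have [h|h] := ltP r0 (t1 + e); [rewrite ltr0_neq0// ve|apply: vNc]; linarith.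
    - by have := h (t1 + e / 2); linarith.
    - exact: h.
  (* Up to the first later zero [c] of [v] the symmetry holds, so [c] and its mirror time have the
     same height. By the energy [v] would vanish at the mirror time too, although it lies in []0,
     t1[]. *)
  have cE : u c = u (t1 - (c - t1)).
    rewrite -(sym (c - t1)) ?lexx ?andbT; first by congr u; ring.
    - by linarith.
    - by move=> r rc; apply: vneg; linarith.
    - by linarith.
  have e1 := @energy R p g F u v c p1 pF su ltac:(linarith).
  have := @energy R p g F u v (t1 - (c - t1)) p1 pF su ltac:(linarith).
  rewrite -cE -e1 vc normr0 powR0; last by rewrite gt_eqF//; linarith.
  move=> /powR_eq0_eq0/eqP; rewrite normr_eq0 gt_eqF// vpos//; linarith.
have E2 := sym t1 _ vneg; split=> //; last by apply: E2; linarith.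
have u2 : u (t1 + t1) = 0 by rewrite E2 ?subrr//; linarith.
have v2 : v (t1 + t1) <= 0.
  rewrite leNgt; apply/negP => v2.
  have [d d0 vd] := (continuous_atP _ _).1 (cv (t1 + t1)) _ v2.
  pose s := Num.min d t1 / 2.
  have m1 : Num.min d t1 <= d by rewrite ge_min lexx.
  have m2 : Num.min d t1 <= t1 by rewrite ge_min lexx orbT.
  have m0 : 0 < Num.min d t1 by rewrite lt_min d0.
  have := vneg (t1 - s); have := vd (t1 + (t1 - s)); rewrite /s; linarith.
(* The orbit is back at height [0]; a negative velocity there would carry [u] below [0]. *)
apply/eqP; rewrite eq_le v2/= leNgt; apply/negP => {}v2.
have vN0 : 0 < - v (t1 + t1) by rewrite oppr_gt0.
have [d d0 vd] := (continuous_atP _ _).1 (cv (t1 + t1)) _ vN0.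
suff : u (t1 + t1 + d / 2) < u (t1 + t1).
  by rewrite u2; have := u0 (t1 + t1 + d / 2); linarith.
have [|||c cd E] := @mean_value R u v (t1 + t1) (t1 + t1 + d / 2).
- by linarith.
- by move=> x _; exact: cu.
- by move=> x xd; apply: du; linarith.
rewrite -subr_lt0 E pmulr_llt0; last by linarith.
by have := vd c; linarith.
Qed.

Lemma unbounded_velocity (R : realType) (p : R) (g u v : R -> R) (c T : R) :
  classical_solution p g u v -> 0 < c -> 0 <= T ->
  (forall t, T < t -> c <= v t) -> False.
Proof.
move=> [[cu _] du _ [u0 _] [M uM]] c0 T0 cv.
pose t := T + (M + 1) / c.
have M0 : 0 <= M by apply: le_trans (u0 _ T0) (uM _ T0).
have Mc : 0 < (M + 1) / c by apply: divr_gt0; linarith.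
have [|||x xt E] := @mean_value R u v T t.
- by rewrite /t; linarith.
- by move=> x _; exact: cu.
- by move=> x xT; apply: du; linarith.
have : M + 1 <= u t - u T.
  rewrite E /t addrAC subrr add0r -ler_pdivrMr//.
  by rewrite invf_div mulrCA mulfV ?gt_eqF ?mulr1 ?cv//; linarith.
have := u0 T T0; have := uM t; rewrite /t; linarith.
Qed.

(** [rho] is the supremum of the increasing bounded [u]. By the energy [|v|^p] tends to some [L],
    and [L > 0] would make [u] unbounded. If [g rho < 0], the flux eventually increases and again
    [u] is unbounded; if [g rho > 0], the flux decreases at a definite rate and becomes negative in
    finite time. *)
Lemma increasing_profile (R : realType) (p : R) (g F u v : R -> R) : 1 < p ->
  potential g F -> classical_solution p g u v -> (forall t, 0 < t -> 0 < v t) ->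
  exists rho : R, [/\ 0 < rho, u t @[t --> +oo] --> rho, g rho = 0,
    `|v 0| `^ p = p / (p - 1) * F rho & forall y, 0 < y < rho -> F y < F rho].
Proof.
move=> p1 pF su vpos.
have [[cu cv] du dw [u0 u00] [M uM]] := su; have [cg dF F0] := pF.
have k0 : 0 < p / (p - 1) by apply: divr_gt0; linarith.
have up x y : 0 <= x -> x < y -> u x < u y.
  move=> x0 xy; apply: (@derive_gt0_lt _ u v) => // z zxy.
  - exact: cu.
  - by apply: du; linarith.
  - by apply: vpos; linarith.
pose A := [set u t | t in `[0, +oo[ : set R].
have A0 t : 0 <= t -> A (u t) by move=> t0; exists t => //=; rewrite in_itv/= t0.
have hA : has_sup A.
  split; first by exists (u 0); exact: A0.
  by exists M => _ [t + <-]; rewrite /= in_itv/= andbT; exact: uM.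
pose rho := sup A.
have ule t : 0 <= t -> u t <= rho.
  by move=> t0; apply: ub_le_sup; [case: hA|exact: A0].
have ult t : 0 <= t -> u t < rho.
  by move=> t0; apply: lt_le_trans (ule (t + 1) _); [apply: up|]; linarith.
have rho0 : 0 < rho by rewrite -u00 ult.
have near_rho e : 0 < e -> exists2 T : R, 0 <= T & forall t, T <= t -> rho - e < u t < rho + e.
  move=> e0; have [_ [T + <-] uT] := sup_adherent e0 hA.
  rewrite /= in_itv/= andbT => T0; exists T => // t Tt.
  have : u T <= u t.
    by move: Tt; rewrite le_eqVlt => /predU1P[->//|Tt]; exact/ltW/up.
  have := ult t (le_trans T0 Tt); rewrite -/rho in uT; linarith.
have E t : 0 <= t -> `|v t| `^ p = `|v 0| `^ p - p / (p - 1) * F (u t).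
  by move=> t0; exact: (energy p1 pF su t0).
have cF : {for rho, continuous F}.
  by apply: is_derive_continuous; apply: dF; exact: ltW.
pose L := `|v 0| `^ p - p / (p - 1) * F rho.
have nearL e : 0 < e -> exists2 T : R, 0 <= T & forall t, T <= t -> L - e < `|v t| `^ p < L + e.
  move=> e0; have ek : 0 < e / (p / (p - 1)) by exact: divr_gt0.
  have [d d0 Fd] := (continuous_atP _ _).1 cF _ ek.
  have [T T0 uT] := near_rho d d0.
  exists T => // t Tt; rewrite E; last exact: le_trans Tt.
  have := Fd _ (uT _ Tt).
  rewrite -(ltr_pM2l k0) -[X in _ && X](ltr_pM2l k0) mulrBr mulrDr.
  by rewrite [_ * (e / _)]mulrC divfK ?gt_eqF// /L; linarith.
have L0 : L = 0.
  have [L0|L0|//] := ltgtP L 0.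
    have [T T0 vT] := nearL (- L) ltac:(linarith).
    by have := powR_ge0 `|v T| p; have := vT T (lexx _); linarith.
  have [T T0 vT] := nearL (L / 2) ltac:(linarith).
  have c0 : 0 < (L / 2) `^ p^-1 by rewrite powR_gt0; linarith.
  exfalso; apply: (unbounded_velocity su c0 T0) => t Tt.
  have vt : 0 < v t by apply: vpos; linarith.
  rewrite leNgt; apply/negP => vc.
  have : v t `^ p < ((L / 2) `^ p^-1) `^ p.
    by rewrite gt0_ltr_powR ?nnegrE ?powR_ge0 ?ltW//; linarith.
  rewrite powR_Kinv; [|by linarith|by linarith].
  by have := vT t (ltW Tt); rewrite gtr0_norm//; linarith.
have EF : `|v 0| `^ p = p / (p - 1) * F rho by rewrite /L in L0; linarith.
exists rho; split=> //.
- apply/cvgrPdist_lt => e /near_rho[T T0 uT]; near=> t.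
  have Tt : T <= t by near: t; apply: nbhs_pinfty_ge; rewrite num_real.
  by have := uT t Tt; rewrite ltr_norml; linarith.
- have cw := continuous_flux_comp p1 su.
  have slope T t : 0 <= T -> T < t -> exists2 c, T < c < t &
      flux p (v t) - flux p (v T) = - g (u c) * (t - T).
    move=> T0 Tt; apply: (@mean_value R (fun t => flux p (v t)) (fun t => - g (u t))) => //.
      by move=> x _; exact: cw.
    by move=> x xT; apply: dw; linarith.
  have [gneg|gpos|//] := ltgtP (g rho) 0.
    have g0 : 0 < - g rho by linarith.
    have [d d0 gd] := (continuous_atP _ _).1 (cg rho) _ g0.
    have [T T0 uT] := near_rho d d0.
    have T1 : 0 < v (T + 1) by apply: vpos; linarith.
    exfalso; apply: (@unbounded_velocity R p g u v _ (T + 1) su T1); first by linarith.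
    move=> t Tt; have [c cT ec] := slope (T + 1) t ltac:(linarith) Tt.
    have gc : 0 < - g (u c) * (t - (T + 1)).
      by rewrite mulr_gt0//; [have := gd _ (uT c ltac:(linarith)); linarith|linarith].
    rewrite leNgt; apply/negP => vt.
    have vt0 : 0 < v t by apply: vpos; linarith.
    have : v t `^ (p - 1) < v (T + 1) `^ (p - 1).
      by rewrite gt0_ltr_powR ?nnegrE ?ltW//; linarith.
    rewrite -!flux_ge0E ?ltW//; linarith.
  have g0 : 0 < g rho / 2 by linarith.
  have [d d0 gd] := (continuous_atP _ _).1 (cg rho) _ g0.
  have [T T0 uT] := near_rho d d0.
  have wT : 0 < flux p (v (T + 1)) by rewrite flux_gt0; apply: vpos; linarith.
  (* The time needed to exhaust the flux at rate [g rho / 2]. *)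
  pose h := flux p (v (T + 1)) / (g rho / 2).
  have h0 : 0 < h by exact: divr_gt0.
  have [c cT ec] := slope (T + 1) (T + 1 + h) ltac:(linarith) ltac:(linarith).
  have wt : 0 < flux p (v (T + 1 + h)) by rewrite flux_gt0; apply: vpos; linarith.
  have gc : g rho / 2 < g (u c) by have := gd _ (uT c ltac:(linarith)); linarith.
  have : g rho / 2 * h < g (u c) * h by rewrite ltr_pM2r.
  rewrite {1}/h mulrC divfK ?gt_eqF//.
  have hE : T + 1 + h - (T + 1) = h by ring.
  by move: ec; rewrite hE mulNr; linarith.
- move=> y yrho.
  have [T T0 uT] := near_rho (rho - y) ltac:(linarith).
  have [|||s sT us] := @intermediate_value R u 0 T y.
  + by [].
  + by move=> x _; exact: cu.
  + by left; have := uT T (lexx _); rewrite u00; linarith.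
  have s0 : 0 < s.
    by rewrite lt_neqAle; apply/andP; split; [apply/eqP => s0; move: us; rewrite -s0 u00|]; linarith.
  have : 0 < `|v s| `^ p by rewrite powR_gt0// normr_gt0 gt_eqF// vpos.
  rewrite E ?ltW// us EF => h; rewrite -subr_gt0 -(pmulr_rgt0 _ k0); linarith.
Unshelve. all: by end_near. Qed.

(** * Orbits starting from rest and periodicity *)

Lemma shift_solution (R : realType) (p : R) (g u v : R -> R) (T : R) :
  classical_solution p g u v -> 0 <= T -> u T = 0 ->
  classical_solution p g (fun t => u (t + T)) (fun t => v (t + T)).
Proof.
move=> [[cu cv] du dw [u0 u00] [M uM]] T0 uT.
have cT (h : R -> R) : continuous h -> continuous (fun t => h (t + T)).
  move=> ch t; apply: (@continuous_comp _ _ _ (fun t => t + T) h); last exact: ch.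
  by apply: continuousD; [exact: cvg_id|exact: cvg_cst].
have dT (h : R -> R) t l : is_derive (t + T) 1 h l -> is_derive t 1 (fun s => h (s + T)) l.
  move=> dh; have -> : (fun s => h (s + T)) = h \o (id + cst T) by [].
  by apply: is_derive_eq; rewrite addr0 mulr1.
split.
- by split; exact: cT.
- by move=> t t0; apply: dT; apply: du; linarith.
- by move=> t t0; apply: (dT (fun s => flux p (v s))); apply: dw; linarith.
- by split=> [t t0|]; [apply: u0; linarith|rewrite add0r].
- by exists M => t t0; apply: uM; linarith.
Qed.

(** A start from rest at a zero of [g] would be trivial, and [g 0 > 0] would make the velocity
    negative at once. *)
Lemma start_reaction_lt0 (R : realType) (p : R) (g F u v : R -> R) (t1 : R) :
  1 < p -> potential g F -> subpower_at_zeros p g F -> classical_solution p g u v ->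
  (exists2 t : R, 0 <= t & u t != 0) -> v 0 = 0 -> 0 < t1 ->
  (forall t, 0 < t < t1 -> 0 < v t) -> g 0 < 0.
Proof.
move=> p1 pF pz su nt v0 t10 vpos.
have [cg _ _] := pF; have [_ _ _ [_ u00] _] := su.
have := rest_reaction_neq0 p1 pF pz su nt (lexx 0) v0.
rewrite -[X in g X < _]u00 neq_lt => /orP[//|gt].
have [e e0 ve] := velocity_after_max p1 cg su (lexx 0) v0 gt.
pose s := Num.min e t1 / 2.
have m1 : Num.min e t1 <= e by rewrite ge_min lexx.
have m2 : Num.min e t1 <= t1 by rewrite ge_min lexx orbT.
have m0 : 0 < Num.min e t1 by rewrite lt_min e0.
by have := ve s; have := vpos s; rewrite /s; linarith.
Qed.

(** Here [u'] is a second solution, later a translate of [u] by whole periods, not a derivative.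
    Both solutions have energy [0], so their turning heights are the same number, namely the first
    positive zero of [F]; equal heights and the first-order equation then give equal turning
    times. *)
Lemma periodic_step (R : realType) (p : R) (g F u v u' v' : R -> R) (t1 : R) : 1 < p ->
  potential g F -> subpower_at_zeros p g F ->
  classical_solution p g u v -> classical_solution p g u' v' ->
  v 0 = 0 -> v' 0 = 0 -> 0 < t1 -> v t1 = 0 -> (forall t, 0 < t < t1 -> 0 < v t) ->
  [/\ v' t1 = 0, forall t, 0 < t < t1 -> 0 < v' t & forall t, 0 <= t <= t1 -> u' t = u t].
Proof.
move=> p1 pF pz su su' v0 v'0 t10 vt1 vpos.
have [cg dF F0] := pF.
have k0 : 0 < p / (p - 1) by apply: divr_gt0; linarith.
have p_neq0 : p != 0 by rewrite gt_eqF//; linarith.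
have E0 : `|v 0| `^ p = 0 by rewrite v0 normr0 powR0.
have E'0 : `|v' 0| `^ p = 0 by rewrite v'0 normr0 powR0.
have [[cu cv] du dw [u0 u00] _] := su.
have [[cu' cv'] du' dw' [u'0 u'00] _] := su'.
have up (w z : R -> R) (b : R) : continuous w -> (forall t : R, 0 < t -> is_derive t 1 w (z t)) ->
    (forall t, 0 < t < b -> 0 < z t) -> forall x y, 0 <= x -> x < y -> y <= b -> w x < w y.
  move=> cw dwz zpos x y x0 xy yb; apply: (@derive_gt0_lt _ w z) => // s sxy.
  - exact: cw.
  - by apply: dwz; linarith.
  - by apply: zpos; linarith.
have upu := up u v t1 cu du vpos.
have nt : exists2 t : R, 0 <= t & u t != 0.
  by exists t1; [exact: ltW|rewrite gt_eqF// -u00 upu].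
have g0 := start_reaction_lt0 p1 pF pz su nt v0 t10 vpos.
have nt' : exists2 t : R, 0 <= t & u' t != 0.
  have gu'0 : g (u' 0) < 0 by rewrite u'00.
  have [e e0 ve] := velocity_after_min p1 cg su' (lexx 0) v'0 gu'0.
  exists (e / 2); first by linarith.
  rewrite gt_eqF// -u'00; apply: (up u' v' (e / 2)) => //; last by linarith.
  by move=> t te; apply: ve; linarith.
have [gu _ _] := reflection p1 pF pz su t10 vt1 vpos.
have Fu := @potential_below_max _ _ _ _ _ _ t1 _ p1 pF su t10 vt1 vpos.
have ut1 : 0 < u t1 by rewrite -u00 upu.
have Fmax (w z : R -> R) s : classical_solution p g w z -> `|z 0| `^ p = 0 -> 0 <= s ->
    z s = 0 -> F (w s) = 0.
  move=> sw z0 s0 zs; have := energy p1 pF sw s0.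
  rewrite z0 zs normr0 powR0// sub0r => /esym/eqP.
  by rewrite oppr_eq0 mulf_eq0 gt_eqF//= => /eqP.
have Fut1 : F (u t1) = 0 by apply: (Fmax u v); rewrite // ltW.
have first_root r : 0 < r -> F r = 0 -> (forall y, 0 < y < r -> F y < F r) -> r = u t1.
  move=> r0 Fr Fy; have [h|h|//] := ltgtP r (u t1).
    by have := Fu r; rewrite Fr Fut1 ltxx r0 h => /(_ isT).
  by have := Fy (u t1); rewrite Fr Fut1 ltxx ut1 h => /(_ isT).
(* If [u'] increased forever, its limit would be the same root [u t1] of [F], but with [g = 0]
   there, against [0 < g (u t1)]. *)
have [vpos'|[t2 t20 [vt2 vpos']]] := velocity_dichotomy p1 pF pz su' nt'.
  have [rho [rho0 _ grho Erho Frho]] := increasing_profile p1 pF su' vpos'.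
  have Fr0 : F rho = 0.
    by apply/eqP; move: Erho; rewrite E'0 => /esym/eqP; rewrite mulf_eq0 gt_eqF.
  by move: gu; rewrite -(first_root rho)// grho ltxx.
have upu' := up u' v' t2 cu' du' vpos'.
have ut2 : u' t2 = u t1.
  apply: first_root.
  - by rewrite -u'00 upu'.
  - by apply: (Fmax u' v'); rewrite // ltW.
  - by move=> y; exact: (potential_below_max p1 pF su' t20 vt2 vpos').
pose H y := (0 - p / (p - 1) * F y) `^ p^-1.
have same L : 0 <= L -> L <= t1 -> L <= t2 -> forall t, 0 <= t <= L -> u' t = u t.
  move=> L0 L1 L2.
  have Hu r : 0 < r < L -> H (u r) = v r.
    move=> rL; rewrite /H -E0 -(speed_energy p1 pF su); last by linarith.
    by rewrite gtr0_norm// vpos//; linarith.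
  have Hu' r : 0 < r < L -> H (u' r) = v' r.
    move=> rL; rewrite /H -E'0 -(speed_energy p1 pF su'); last by linarith.
    by rewrite gtr0_norm// vpos'//; linarith.
  apply: (@autonomous_uniqueness R H u' u L).
  - by move=> r _; exact: cu'.
  - by move=> r _; exact: cu.
  - by move=> r rL; rewrite Hu'//; apply: du'; linarith.
  - by move=> r rL; rewrite Hu//; apply: du; linarith.
  - by move=> r rL; rewrite Hu'//; apply: vpos'; linarith.
  - by move=> r rL; rewrite Hu//; apply: vpos; linarith.
  - by rewrite u00 u'00.
(* Were one turning time smaller, both solutions would agree up to it, and the other one would reach
   the common height strictly before its own turning time. *)
have t12 : t1 = t2.
  have [h|h|//] := ltgtP t1 t2.
    have := same t1 (ltW t10) (lexx _) (ltW h) t1; rewrite lexx ltW// -ut2 => /(_ isT) E.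
    by have := upu' t1 t2 (ltW t10) h (lexx _); rewrite E ltxx.
  have := same t2 (ltW t20) (ltW h) (lexx _) t2; rewrite lexx ltW// ut2 => /(_ isT) E.
  by have := upu t2 t1 (ltW t20) h (lexx _); rewrite E ltxx.
rewrite t12; split=> //; rewrite -t12; apply: same; linarith.
Qed.

(** At [t1 + t1] both [u] and [v] vanish, so the energy there is [0]; hence [v 0 = 0] and
    [F (u t1) = 0]. *)
Lemma periodic_profile (R : realType) (p : R) (g F u v : R -> R) (t1 : R) : 1 < p ->
  potential g F -> subpower_at_zeros p g F -> classical_solution p g u v ->
  0 < t1 -> v t1 = 0 -> (forall t, 0 < t < t1 -> 0 < v t) ->
  [/\ v 0 = 0, g 0 < 0, F (u t1) = 0 & 0 < g (u t1)] /\
  forall (t : R) (k : nat), 0 <= t <= t1 ->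
    u (t + (2 * k)%:R * t1) = u t /\ u (t + (2 * k + 1)%:R * t1) = u (t1 - t).
Proof.
move=> p1 pF pz su t10 vt1 vpos.
have [cg dF F0] := pF.
have k0 : 0 < p / (p - 1) by apply: divr_gt0; linarith.
have p_neq0 : p != 0 by rewrite gt_eqF//; linarith.
have [[cu cv] du dw [u0 u00] _] := su.
have [gu v2 sym] := reflection p1 pF pz su t10 vt1 vpos.
have u2 : u (t1 + t1) = 0 by rewrite sym ?subrr// lexx ltW.
have v0 : v 0 = 0.
  have := @energy _ _ _ _ _ _ (t1 + t1) p1 pF su ltac:(linarith).
  rewrite v2 u2 F0 mulr0 subr0 normr0 powR0// => /esym/powR_eq0_eq0/eqP.
  by rewrite normr_eq0 => /eqP.
have up x y : 0 <= x -> x < y -> y <= t1 -> u x < u y.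
  move=> x0 xy yt; apply: (@derive_gt0_lt _ u v) => // z zxy.
  - exact: cu.
  - by apply: du; linarith.
  - by apply: vpos; linarith.
have nt : exists2 t : R, 0 <= t & u t != 0.
  by exists t1; [exact: ltW|rewrite gt_eqF// -u00 up].
have g0 := start_reaction_lt0 p1 pF pz su nt v0 t10 vpos.
have Fut1 : F (u t1) = 0.
  have := energy p1 pF su (ltW t10).
  rewrite vt1 v0 normr0 powR0// sub0r => /esym/eqP.
  by rewrite oppr_eq0 mulf_eq0 gt_eqF//= => /eqP.
split=> // t k tt1.
have T0 (n : nat) : 0 <= n%:R * t1 by rewrite mulr_ge0// ltW.
(* By induction each translate by [2 * k] half periods starts from height [0] at rest, hence repeats
   the first arc and its reflection. *)
have uvk : u ((2 * k)%:R * t1) = 0 /\ v ((2 * k)%:R * t1) = 0.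
  elim: k => [|k [IHu IHv]]; first by rewrite muln0 mul0r.
  have sk := shift_solution su (T0 (2 * k)%N) IHu.
  have [|vk vposk _] := periodic_step p1 pF pz su sk v0 _ t10 vt1 vpos.
    by rewrite add0r.
  have [_ vk2 symk] := reflection p1 pF pz sk t10 vk vposk.
  have -> : (2 * k.+1)%:R * t1 = t1 + t1 + (2 * k)%:R * t1.
    by rewrite mulnS natrD mulrDl; congr (_ + _); rewrite mulr_natl mulr2n.
  by rewrite vk2 (symk t1) ?lexx ?ltW// subrr add0r.
have [uk vk] := uvk.
have sk := shift_solution su (T0 (2 * k)%N) uk.
have [|vk1 vposk uE] := periodic_step p1 pF pz su sk v0 _ t10 vt1 vpos.
  by rewrite add0r.
split; first exact: uE.
have [_ _ symk] := reflection p1 pF pz sk t10 vk1 vposk.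
have -> : t + (2 * k + 1)%:R * t1 = t1 + t + (2 * k)%:R * t1.
  by rewrite natrD mulrDl mul1r; ring.
by rewrite symk// uE//; linarith.
Qed.

(** * The du Bois-Reymond lemma *)

(** A finite order of smoothness allows induction on [k]: in the product rule each term has one
    factor differentiated, and both factors are then used at order [k]. *)
Definition derivable_upto (R : realType) (k : nat) (f : R -> R) : Prop :=
  forall j, (j < k)%N -> forall x, derivable (derive1n j f) x 1.

Lemma derivable_uptoS (R : realType) (k : nat) (f df : R -> R) :
  (forall x : R, is_derive x 1 f (df x)) -> derivable_upto k df -> derivable_upto k.+1 f.
Proof.
move=> dfE Ddf [_ x|j jk x]; first by rewrite derive1n0; have ? := dfE x; exact: ex_derive.
have -> : derive1n j.+1 f = derive1n j df.
  rewrite /derive1n iterSr; congr iter; apply/funext => y.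
  by rewrite derive1E; have ? := dfE y; rewrite derive_val.
exact: Ddf.
Qed.

Lemma derivable_upto0 (R : realType) (f : R -> R) : derivable_upto 0 f.
Proof. by move=> j; rewrite ltn0. Qed.

Lemma derivable_uptoW (R : realType) (k : nat) (f : R -> R) :
  derivable_upto k.+1 f -> derivable_upto k f.
Proof. by move=> Df j jk; apply: Df; exact: ltnW. Qed.

Lemma derivable_uptoSE (R : realType) (k : nat) (f : R -> R) :
  derivable_upto k.+1 f ->
  (forall x : R, is_derive x 1 f (derive1 f x)) /\ derivable_upto k (derive1 f).
Proof.
move=> Df; split=> [x|j jk x].
  by rewrite derive1E; apply/derivableP; exact: (Df 0%N isT x).
by have := Df j.+1 jk x; rewrite /derive1n iterSr.
Qed.

Lemma derivable_uptoD (R : realType) (k : nat) (f g : R -> R) :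
  derivable_upto k f -> derivable_upto k g -> derivable_upto k (f \+ g).
Proof.
elim: k f g => [|k IH] f g; first by move=> _ _; exact: derivable_upto0.
move=> /derivable_uptoSE[df Df] /derivable_uptoSE[dg Dg].
apply: (derivable_uptoS (df := derive1 f \+ derive1 g)); last exact: IH.
Qed.

Lemma derivable_uptoZ (R : realType) (k : nat) (c : R) (f : R -> R) :
  derivable_upto k f -> derivable_upto k (fun x => c * f x).
Proof.
elim: k f => [|k IH] f; first by move=> _; exact: derivable_upto0.
move=> /derivable_uptoSE[df Df].
apply: (derivable_uptoS (df := fun x => c * derive1 f x)); last exact: IH.
Qed.

Lemma derivable_uptoM (R : realType) (k : nat) (f g : R -> R) :
  derivable_upto k f -> derivable_upto k g -> derivable_upto k (f \* g).
Proof.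
elim: k f g => [|k IH] f g Df Dg; first exact: derivable_upto0.
have [df D'f] := derivable_uptoSE Df; have [dg D'g] := derivable_uptoSE Dg.
apply: (derivable_uptoS (df := (f \* derive1 g) \+ (g \* derive1 f))).
apply: derivable_uptoD.
  exact: IH (derivable_uptoW Df) D'g.
exact: IH (derivable_uptoW Dg) D'f.
Qed.

Lemma derivable_upto_affine (R : realType) (k : nat) (a b : R) (f : R -> R) :
  derivable_upto k f -> derivable_upto k (fun x => f (a * x + b)).
Proof.
elim: k f => [|k IH] f; first by move=> _; exact: derivable_upto0.
move=> /derivable_uptoSE[df Df].
apply: (derivable_uptoS (df := fun x => a * derive1 f (a * x + b))).
  move=> x; have ? := df (a * x + b).
  have -> : (fun x => f (a * x + b)) = f \o ((a \*: id) + cst b) by [].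
  by apply: is_derive_eq; rewrite addr0 /GRing.scale/= mulr1 mulrC.
by apply: derivable_uptoZ; exact: IH.
Qed.

(** The powers of [1 / x] make the family, up to linear combinations, stable under differentiation;
    smoothness of [exp (- 1 / x)] alone would not go by induction. *)
Definition flat_exp (R : realType) (n : nat) (x : R) : R :=
  if 0 < x then x^-1 ^+ n * expR (- x^-1) else 0.

Lemma flat_exp_ge0 (R : realType) (n : nat) (x : R) : 0 <= flat_exp n x.
Proof.
rewrite /flat_exp; case: ifPn => // x0.
by rewrite mulr_ge0 ?expR_ge0// exprn_ge0// invr_ge0 ltW.
Qed.

Lemma flat_exp_gt0 (R : realType) (n : nat) (x : R) : 0 < x -> 0 < flat_exp n x.
Proof. by move=> x0; rewrite /flat_exp x0 mulr_gt0 ?expR_gt0// exprn_gt0// invr_gt0. Qed.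

Lemma flat_exp_le0 (R : realType) (n : nat) (x : R) : x <= 0 -> flat_exp n x = 0.
Proof. by move=> x0; rewrite /flat_exp ltNge x0. Qed.

(** From [exp y >= y^(n + 1) / (n + 1)!] at [y = 1 / x]. A linear bound suffices, since the
    difference quotient at [0] of one member of the family is the next member. *)
Lemma flat_exp_bound (R : realType) (n : nat) (x : R) : 0 < x ->
  flat_exp n x <= n.+1`!%:R * x.
Proof.
move=> x0; rewrite /flat_exp x0 expRN.
have y0 : 0 < x^-1 by rewrite invr_gt0.
have := expR_ge1Dxn n (ltW y0) => h.
rewrite ler_pdivrMr ?expR_gt0//.
have fact0 : 0 < (n.+1)`!%:R :> R by rewrite ltr0n fact_gt0.
have {h} : x^-1 ^+ n.+1 <= n.+1`!%:R * expR x^-1.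
  rewrite -ler_pdivrMl// mulrC; apply: le_trans h; linarith.
rewrite exprSr -ler_pdivlMr// => h; apply: (le_trans h).
by rewrite invrK mulrAC.
Qed.

Lemma is_derive_flat_exp (R : realType) (n : nat) (x : R) :
  is_derive x 1 (@flat_exp R n) (flat_exp n.+2 x - n%:R * flat_exp n.+1 x).
Proof.
have [x0|x0|->] := ltgtP x 0.
- apply: (@near_eq_is_derive _ _ _ (cst 0)).
    near=> z; rewrite flat_exp_le0// ltW//; near: z; exact: lt_nbhsl.
  by rewrite !flat_exp_le0 ?ltW// mulr0 subr0; exact: is_derive_cst.
- apply: (@near_eq_is_derive _ _ _ (fun z : R => z^-1 ^+ n * expR (- z^-1))).
    near=> z; rewrite /flat_exp ifT//; near: z; exact: lt_nbhsr.
  have xn0 : x != 0 by rewrite gt_eqF.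
  have dV : is_derive x 1 (fun z : R => z^-1) (- x ^- 2).
    have := @is_deriveV R id x 1 1 xn0 (is_derive_id x 1).
    by rewrite /GRing.scale/= mulr1.
  have -> : (fun z : R => z^-1 ^+ n * expR (- z^-1)) =
      (fun z : R => z^-1) ^+ n * (expR \o (- (fun z : R => z^-1))).
    apply/funext => z; rewrite /= /GRing.mul/=; congr (_ * _).
    by elim: n => [|n IH]; rewrite ?expr0// !exprS IH.
  apply: is_derive_eq.
  rewrite /flat_exp x0 /GRing.scale/=.
  have -> : ((fun z : R => z^-1) ^+ n) x = x^-1 ^+ n.
    by elim: n => [|n IH]; rewrite ?expr0// !exprS -IH.
  rewrite -exprVn; set y := x^-1; set E := expR _.
  by case: n => [|n]; rewrite ?expr0 ?exprS /=; ring.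
(* The slope at [0] is [flat_exp n x / x = flat_exp n.+1 x], and the previous bound makes it
   continuous. *)
- apply/is_derive1_caratheodory; exists (@flat_exp R n.+1); split.
  + move=> z; rewrite (flat_exp_le0 n (lexx 0)) !subr0.
    have [z0|z0] := leP z 0; first by rewrite !flat_exp_le0// mul0r.
    by rewrite /flat_exp z0 exprS -!mulrA [RHS]mulrC -!mulrA mulfV ?gt_eqF// mulr1.
  + apply/continuous_atP => e e0; rewrite flat_exp_le0//.
    have c0 : 0 < n.+2`!%:R :> R by rewrite ltr0n fact_gt0.
    exists (e / n.+2`!%:R); first exact: divr_gt0.
    move=> y yd; have := flat_exp_ge0 n.+1 y.
    have [y0|y0] := leP y 0; first by rewrite flat_exp_le0//; linarith.
    have := flat_exp_bound n.+1 y0.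
    have : n.+2`!%:R * y < e by rewrite mulrC -ltr_pdivlMr//; linarith.
    linarith.
  + by rewrite !flat_exp_le0// mulr0 subr0.
Unshelve. all: by end_near. Qed.

Lemma flat_exp_smooth (R : realType) (k n : nat) : derivable_upto k (@flat_exp R n).
Proof.
elim: k n => [|k IH] n; first exact: derivable_upto0.
  apply: (derivable_uptoS (is_derive_flat_exp n)).
have -> : (fun x : R => flat_exp n.+2 x - n%:R * flat_exp n.+1 x) =
    (@flat_exp R n.+2 \+ (fun x : R => - n%:R * flat_exp n.+1 x)).
  by apply/funext => x /=; rewrite mulNr.
by apply: derivable_uptoD => //; exact: derivable_uptoZ.
Qed.

Definition bump (R : realType) (e x : R) : R := flat_exp 0 (e - x) * flat_exp 0 (e + x).

Lemma bump_smooth (R : realType) (e a : R) (k : nat) :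
  derivable_upto k (fun x => bump e (x - a)).
Proof.
have -> : (fun x => bump e (x - a)) =
    (fun x => @flat_exp R 0 (-1 * x + (e + a))) \* (fun x => @flat_exp R 0 (1 * x + (e - a))).
  by apply/funext => x; rewrite /bump/=; congr (flat_exp _ _ * flat_exp _ _); ring.
by apply: derivable_uptoM; apply: derivable_upto_affine; exact: flat_exp_smooth.
Qed.

Lemma bump_eq0 (R : realType) (e x : R) : ~~ (- e < x < e) -> bump e x = 0.
Proof.
rewrite negb_and -!leNgt => /orP[h|h]; rewrite /bump.
  by rewrite (@flat_exp_le0 _ _ (e + x)) ?mulr0//; linarith.
by rewrite (@flat_exp_le0 _ _ (e - x)) ?mul0r//; linarith.
Qed.

Lemma bump_gt0 (R : realType) (e x : R) : - e < x < e -> 0 < bump e x.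
Proof. by move=> ex; rewrite mulr_gt0 ?flat_exp_gt0//; linarith. Qed.

Lemma bump_ge0 (R : realType) (e x : R) : 0 <= bump e x.
Proof. by rewrite mulr_ge0 ?flat_exp_ge0. Qed.

Lemma bump_primitive (R : realType) (e : R) : 0 < e -> exists K : R -> R,
  [/\ forall x : R, is_derive x 1 K (bump e x), forall x, x <= - e -> K x = K (- e) &
      forall x, e <= x -> K x = K e].
Proof.
move=> e0.
have cb : continuous (@bump R e).
  move=> x; have /derivable_uptoSE[db _] := @bump_smooth R e 0 1.
  have -> : @bump R e = (fun y => bump e (y - 0)) by apply/funext => y; rewrite subr0.
  exact: is_derive_continuous (db x).
have [G dG] := @primitive_exists R (bump e) (- e - 2) (fun x _ => cb x).
have cst_left x : - e - 1 <= x -> x <= - e -> G x = G (- e).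
  move=> x1 x2; apply: (@derive_eq0_cst R) => // z zx.
    by apply: is_derive_continuous; apply: dG; linarith.
  rewrite -(@bump_eq0 _ e z); last by apply/negP; linarith.
  by apply: dG; linarith.
have cst_right x : e <= x -> G x = G e.
  move=> x1; apply/esym; apply: (@derive_eq0_cst R) => // z zx.
    by apply: is_derive_continuous; apply: dG; linarith.
  rewrite -(@bump_eq0 _ e z); last by apply/negP; linarith.
  by apply: dG; linarith.
(* [G] is a primitive only to the right of [- e - 2]. It is already constant on [[- e - 1, - e]], so
   freezing it to the left creates no kink. *)
pose K x := if - e - 1 <= x then G x else G (- e).
have Kl x : x <= - e -> K x = G (- e).
  by move=> xe; rewrite /K; case: ifPn => // h; exact: cst_left.
exists K; split.
- move=> x; have [xe|xe] := ltP x (- e).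
    rewrite bump_eq0; last by apply/negP; linarith.
    apply: (@near_eq_is_derive _ _ _ (cst (G (- e)))) => //.
    near=> z; rewrite Kl// ltW//; near: z; exact: lt_nbhsl.
  apply: (@near_eq_is_derive _ _ _ G).
    near=> z; rewrite /K ifT// ltW//; near: z; apply: lt_nbhsr; linarith.
  by apply: dG; linarith.
- by move=> x xe; rewrite !Kl.
- by move=> x xe; rewrite /K !ifT ?cst_right//; linarith.
Unshelve. all: by end_near. Qed.

(** Two translates of the same bump have equal mass, so the primitive of their difference returns to
    [0] and has compact support. *)
Lemma bump_difference (R : realType) (e a b : R) :
  0 < e -> e < a -> e < b -> exists2 phi : R -> R, test_function phi &
    (forall x : R, is_derive x 1 phi (bump e (x - a) - bump e (x - b))) /\
    exists l r : R, [/\ 0 < l, l <= a - e, l <= b - e, a + e <= r & b + e <= r] /\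
      forall x, ~~ (l < x < r) -> phi x = 0.
Proof.
move=> e0 ea eb; have [K [dK Kl Kr]] := bump_primitive e0.
pose phi x := K (x - a) - K (x - b).
pose l := Num.min a b - e; pose r := Num.max a b + e.
have la : l <= a - e by rewrite lerD2r ge_min lexx.
have lb : l <= b - e by rewrite lerD2r ge_min lexx orbT.
have ra : a + e <= r by rewrite lerD2r le_max lexx.
have rb : b + e <= r by rewrite lerD2r le_max lexx orbT.
have l0 : 0 < l by rewrite subr_gt0 lt_min ea.
have dphi (x : R) : is_derive x 1 phi (bump e (x - a) - bump e (x - b)).
  have h (c : R) : is_derive x 1 (fun y => K (y - c)) (bump e (x - c)).
    have ? := dK (x - c); have -> : (fun y => K (y - c)) = K \o (id - cst c) by [].
    by apply: is_derive_eq; rewrite subr0 mulr1.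
  by have ? := h a; have ? := h b; exact: is_deriveB.
have phi0 x : ~~ (l < x < r) -> phi x = 0.
  rewrite negb_and -!leNgt => /orP[h|h]; rewrite /phi.
    by rewrite Kl ?(Kl (x - b)) ?subrr//; linarith.
  by rewrite Kr ?(Kr (x - b)) ?subrr//; linarith.
have supp : closure [set x | phi x != 0] `<=` `[l, r].
  have sub : [set x | phi x != 0] `<=` `[l, r].
    move=> x /= /eqP x0; rewrite in_itv/=.
    apply/negPn/negP => h; apply: x0; apply: phi0; apply/negP => h2.
    by move/negP: h; apply; linarith.
  by move=> x /(closureS sub) clx; apply: itv_closed.
exists phi.
  split.
  - move=> n x; have D : derivable_upto n.+1 phi.
      apply: (derivable_uptoS dphi).
      have -> : (fun x => bump e (x - a) - bump e (x - b)) =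
        ((fun x => bump e (x - a)) \+ (fun x => -1 * bump e (x - b))).
        by apply/funext => y /=; rewrite mulN1r.
      apply: derivable_uptoD; first exact: bump_smooth.
      by apply: derivable_uptoZ; exact: bump_smooth.
    exact: (D n (ltnSn n) x).
  - apply: (@subclosed_compact _ _ `[l, r]) => //; first exact: closed_closure.
    exact: segment_compact.
  - by move=> x /supp; rewrite /= !in_itv/=; linarith.
by split=> //; exists l, r.
Qed.

(** The derivative of [T] is nowhere positive: [h - m] is negative on the bump at [a], and positive
    on the bump at [b], which is subtracted. It is strictly negative across the first bump. *)
Lemma bump_difference_drop (R : realType) (T h : R -> R) (m a b e l q : R) :
  0 < e -> 0 < l -> l <= a - e -> a + e <= q ->
  (forall x : R, 0 < x -> is_derive x 1 T ((h x - m) * (bump e (x - a) - bump e (x - b)))) ->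
  (forall x, a - e < x < a + e -> ~~ (- e < x - b < e)) ->
  (forall x, a - e < x < a + e -> h x < m) ->
  (forall x, - e < x - b < e -> m < h x) -> T q < T l.
Proof.
move=> e0 l0 la qa dT disj ha hb.
pose dN x := - ((h x - m) * (bump e (x - a) - bump e (x - b))).
have cN (x : R) : 0 < x -> {for x, continuous (fun z => - T z)}.
  by move=> x0; apply: continuousN; exact: is_derive_continuous (dT x x0).
have dNE (x : R) : 0 < x -> is_derive x 1 (fun z => - T z) (dN x).
  by move=> x0; exact: is_deriveN (dT x x0).
have dN0 x : 0 <= dN x.
  rewrite oppr_ge0; have [xa|xa] := boolP (a - e < x < a + e).
    rewrite (@bump_eq0 _ _ (x - b)) ?disj// subr0 mulr_le0_ge0 ?bump_ge0//.
    by rewrite subr_le0 ltW// ha.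
  rewrite (@bump_eq0 _ _ (x - a)); last by apply: contra xa; linarith.
  have [xb|xb] := boolP (- e < x - b < e); last by rewrite bump_eq0// subrr mulr0.
  by rewrite sub0r mulr_ge0_le0 ?oppr_le0 ?bump_ge0// subr_ge0 ltW// hb.
have Tle x y : 0 < x -> x <= y -> T y <= T x.
  move=> x0 xy; rewrite -lerN2; apply: (@derive_ge0_le R (fun z => - T z) dN x y xy).
  - by move=> z zxy; apply: cN; linarith.
  - by move=> z zxy; apply: dNE; linarith.
  - by move=> z _; exact: dN0.
have Tlt : T (a + e) < T (a - e).
  have ae : a - e < a + e by linarith.
  rewrite -ltrN2; apply: (@derive_gt0_lt R (fun z => - T z) dN _ _ ae).
  - by move=> z zxy; apply: cN; linarith.
  - by move=> z zxy; apply: dNE; linarith.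
  - move=> z zae; rewrite oppr_gt0 (@bump_eq0 _ _ (z - b)) ?disj// subr0.
    by rewrite nmulr_rlt0 ?subr_lt0 ?ha// bump_gt0//; linarith.
apply: (le_lt_trans (Tle (a + e) q _ qa)); first by linarith.
apply: (lt_le_trans Tlt); exact: Tle.
Qed.

(** With [G] a primitive of [r], the claim is that [h = W + G] is constant. If [h a < h b], take [m]
    halfway between. A test function whose derivative is a bump at [a] minus a bump at [b] makes the
    integral of [(h - m) * phi'] negative, whereas the weak equation makes it [0]. *)
Lemma du_bois_reymond (R : realType) (W r : R -> R) : continuous W -> continuous r ->
  (forall phi : R -> R, test_function phi ->
    \int[lebesgue_measure]_(t in `]0, +oo[) (W t * derive1 phi t) =
    \int[lebesgue_measure]_(t in `]0, +oo[) (r t * phi t)) ->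
  forall t : R, 0 < t -> is_derive t 1 W (- r t).
Proof.
move=> cW cr weak; have [G dG] := @primitive_exists R r 0 (fun x _ => cr x).
pose h x := W x + G x.
have ch x : 0 < x -> {for x, continuous h}.
  move=> x0; apply: continuousD; first exact: cW.
  by apply: is_derive_continuous; exact: dG.
have nlt a b : 0 < a -> 0 < b -> ~~ (h a < h b).
  move=> a0 b0; apply/negP => hab.
  have ab : 0 < `|a - b|.
    by rewrite normr_gt0 subr_eq0; apply: contraTN hab => /eqP ->; rewrite ltxx.
  pose m := (h a + h b) / 2.
  have [d1 d10 hd1] := (continuous_atP _ _).1 (ch a a0) (m - h a) ltac:(rewrite /m; linarith).
  have [d2 d20 hd2] := (continuous_atP _ _).1 (ch b b0) (h b - m) ltac:(rewrite /m; linarith).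
  have [e [e0 [ed1 ed2] [ea eb] eab]] : exists e : R,
      [/\ 0 < e, e <= d1 /\ e <= d2, e < a /\ e < b & e + e <= `|a - b|].
    pose M : R := Num.min (Num.min d1 d2) (Num.min (Num.min a b) `|a - b|).
    exists (M / 2).
    have M0 : 0 < M by rewrite !lt_min d10 d20 a0 b0 ab.
    have M1 : M <= d1 by rewrite !ge_min lexx.
    have M2 : M <= d2 by rewrite !ge_min lexx !orbT.
    have M3 : M <= a by rewrite !ge_min lexx !orbT.
    have M4 : M <= b by rewrite !ge_min lexx !orbT.
    have M5 : M <= `|a - b| by rewrite !ge_min lexx !orbT.
    clearbody M; split; [linarith|split; linarith|split; linarith|linarith].
  have disj x : a - e < x < a + e -> ~~ (- e < x - b < e).
    by move=> xa; apply/negP => xb; move: eab; rewrite ler_normr => /orP[]; linarith.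
  have [phi tphi [dphi [l [q [[l0 la lb qa qb] phi0]]]]] := bump_difference e0 ea eb.
  pose D x := bump e (x - a) - bump e (x - b).
  have derE : derive1 phi = D.
    by apply/funext => x; rewrite derive1E; have ? := dphi x; rewrite derive_val.
  have cphi x : {for x, continuous phi} by exact: is_derive_continuous (dphi x).
  have cD x : {for x, continuous D}.
    have cb c : {for x, continuous (fun x => bump e (x - c))}.
      have /derivable_uptoSE[db _] := @bump_smooth R e c 1.
      exact: is_derive_continuous (db x).
    by apply: continuousB; exact: cb.
  have D0 x : ~~ (l < x < q) -> D x = 0.
    by move=> xlq; rewrite /D !bump_eq0 ?subrr//; apply/negP => h2; move/negP: xlq; apply; linarith.
  have cWD x : {for x, continuous (fun x => W x * D x)}.
    by apply: continuousM; [exact: cW|exact: cD].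
  have crphi x : {for x, continuous (fun x => r x * phi x)}.
    by apply: continuousM; [exact: cr|exact: cphi].
  have [A dA] := @primitive_exists R (fun x => W x * D x) 0 (fun x _ => cWD x).
  have [B dB] := @primitive_exists R (fun x => r x * phi x) 0 (fun x _ => crphi x).
  have lq : l <= q by linarith.
  have outside x : ~~ (l <= x <= q) -> ~~ (l < x < q).
    by move=> xlq; apply/negP => h2; move/negP: xlq; apply; linarith.
  have := weak phi tphi; rewrite derE.
  rewrite (@Rintegral_halfline_support R _ l q)//; last first.
    by move=> x /outside xlq; rewrite D0// mulr0.
  rewrite (@Rintegral_halfline_support R _ l q)//; last first.
    by move=> x /outside xlq; rewrite phi0// mulr0.
  have -> : \int[lebesgue_measure]_(x in `[l, q]) (W x * D x) = A q - A l.
    apply: Rfundamental_theorem => // x xlq; last by apply: dA; linarith.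
    by apply: is_derive_continuous; apply: dA; linarith.
  have -> : \int[lebesgue_measure]_(x in `[l, q]) (r x * phi x) = B q - B l.
    apply: Rfundamental_theorem => // x xlq; last by apply: dB; linarith.
    by apply: is_derive_continuous; apply: dB; linarith.
  (* [T] performs the integration by parts: its derivative is [(h - m) * D], and the weak equation
     [A q - A l = B q - B l] gives [T l = T q], as [phi] vanishes at both ends. *)
  pose T x := A x - B x + (G x - m) * phi x.
  move=> AB.
  have Tlq : T l = T q by rewrite /T !phi0; [rewrite !mulr0; linarith|apply/negP; linarith|apply/negP; linarith].
  have dT (x : R) : 0 < x -> is_derive x 1 T ((h x - m) * D x).
    move=> x0.
    have dAB := is_deriveB (dA _ x0) (dB _ x0).
    have dGphi := is_deriveM (is_deriveB (dG _ x0) (is_derive_cst m x (1 : R))) (dphi x).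
    apply: (@is_derive_eq _ _ _ _ _ _ _ _ (is_deriveD dAB dGphi)).
    by rewrite /GRing.scale/= /h /D !fctE subr0; ring.
  suff : T q < T l by rewrite Tlq ltxx.
  apply: (@bump_difference_drop R T h m a b e l q) => //.
  - by move=> x xa; have := hd1 x ltac:(linarith); linarith.
  - by move=> x xb; have := hd2 x ltac:(linarith); linarith.
have hcst a b : 0 < a -> 0 < b -> h a = h b.
  by move=> a0 b0; apply/eqP; rewrite eq_le !leNgt !nlt.
move=> t t0; apply: (@near_eq_is_derive _ _ _ (fun x => h t - G x)).
  near=> x; have x0 : 0 < x by near: x; exact: lt_nbhsr.
  by rewrite -(hcst x t)// /h addrK.
have ? := dG _ t0; have -> : (fun x => h t - G x) = cst (h t) - G by [].
by apply: is_derive_eq; rewrite sub0r.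
Unshelve. all: by end_near. Qed.

(** * Weak and classical solutions *)

Lemma cvg_at_right0P (R : realType) (q : R -> R) (l : R) :
  q h @[h --> (0 : R)^'+] --> l <->
  forall e, 0 < e -> exists2 d, 0 < d & forall h : R, 0 < h < d -> l - e < q h < l + e.
Proof.
split=> [ql e e0|H].
  move/cvgrPdist_lt : ql => /(_ _ e0) /nbhs_ballP[d /= d0 qd].
  exists d => // h /andP[h0 hd]; have : `|l - q h| < e.
    by apply: qd => //; rewrite /ball/= sub0r normrN gtr0_norm.
  by rewrite ltr_norml; linarith.
apply/cvgrPdist_lt => e /H [d d0 qd].
apply/nbhs_ballP; exists d => //= h; rewrite /ball/= sub0r normrN => hd h0.
by have := qd h; rewrite h0 ltr_norml -(gtr0_norm h0) hd => /(_ isT); linarith.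
Qed.

Lemma C1_halfline_continuous (R : realType) (u : R -> R) : C1_halfline u ->
  {within `[0, +oo[, continuous u}.
Proof.
move=> [du /cvg_ex[l ql] _]; apply/continuous_within_itvcyP; split.
  by move=> t t0; apply/differentiable_continuous/derivable1_diffP; exact: du.
have : h * (h^-1 * (u h - u 0)) + u 0 @[h --> (0 : R)^'+] --> 0 * l + u 0.
  apply: cvgD; last exact: cvg_cst.
  apply: cvgM => //; apply: cvg_at_right_filter; exact: cvg_id.
rewrite mul0r add0r; apply: cvg_trans; apply: near_eq_cvg.
near=> h; rewrite mulrA mulfV ?mul1r ?subrK// gt_eqF//.
Unshelve. all: by end_near. Qed.

(** If [u] exceeded an essential bound at some [t > 0], by continuity it would do so on an interval
    of positive length, inside a null set. *)
Lemma essentially_bounded (R : realType) (u : R -> R) :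
  {within `[0, +oo[, continuous u} -> 0 <= u 0 ->
  ('N[lebesgue_measure]_(+oo) [EFin \o (u \_ `]0, +oo[)%R] < +oo)%E ->
  exists M : R, forall t, 0 <= t -> u t <= M.
Proof.
move=> cu u00; rewrite Lnorm.unlock.
(* The norm of exponent [+oo] is an essential supremum only if the whole space has positive
   measure. *)
have muT : (0%:E < @lebesgue_measure R [set: R])%E.
  rewrite (@lt_le_trans _ _ (lebesgue_measure (`[0, 1] : set R)))//.
    by rewrite lebesgue_measure_itv/= lte_fin ltr01 sube0 lte_fin.
  by apply: le_measure; rewrite ?inE//; exact: measurable_itv.
rewrite muT => hS.
have [M hM] : exists M : R,
    (ess_sup lebesgue_measure (abse \o (EFin \o (u \_ `]0, +oo[)%R)) <= M%:E)%E.
  move: hS; case: (ess_sup _ _) => [r _|//|_]; last by exists 0; rewrite leNye.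
  by exists r.
move/ess_supP : hM => [N [mN N0 uN]].
have cc := continuous_clamp cu.
have pos t : 0 < t -> u t <= M.
  move=> t0; rewrite leNgt; apply/negP => ut.
  have utc : 0 < u (Num.max t 0) - M by rewrite max_l ?ltW//; linarith.
  have [d d0 ud] := (continuous_atP _ _).1 (cc t) _ utc.
  pose d' := Num.min d t.
  have d1 : d' <= d by rewrite ge_min lexx.
  have d2 : d' <= t by rewrite ge_min lexx orbT.
  have d'0 : 0 < d' by rewrite lt_min d0.
  have sub : `]t, t + d'[ `<=` N.
    move=> x /=; rewrite in_itv/= => xt; apply: uN => /=.
    have x0 : 0 < x by linarith.
    rewrite patchE mem_set/= ?in_itv/= ?x0// lee_fin => uM.
    have := ud x ltac:(linarith); rewrite !max_l; [|by linarith|by linarith].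
    have := ler_norm (u x); linarith.
  have : (lebesgue_measure (`]t, (t + d')%R[ : set R) <= lebesgue_measure N)%E.
    by apply: le_measure => //; rewrite inE//; exact: measurable_itv.
  rewrite N0 lebesgue_measure_itv/= lte_fin ltrDl d'0 -EFinD lee_fin.
  by apply/negP; rewrite -ltNge; linarith.
exists (Num.max M (u 0)) => t; rewrite le_eqVlt => /predU1P[<-|t0].
  by rewrite le_max lexx orbT.
by rewrite le_max pos.
Qed.

Lemma solution_classical (R : realType) (p : R) (f u : R -> R) : 1 < p ->
  {within `[0, +oo[, continuous f} -> solution p f u ->
  classical_solution p (fun x => f (Num.max x 0)) (fun t => u (Num.max t 0))
    (fun t => hderive u (Num.max t 0)).
Proof.
move=> p1 cf [C1u wu u_ge0 u0 bu].
have cu := C1_halfline_continuous C1u.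
have [du _ cv] := C1u.
have cuc := continuous_clamp cu; have cvc := continuous_clamp cv.
have cg := continuous_clamp cf.
have u_ge0' t : 0 <= t -> 0 <= u t.
  by rewrite le_eqVlt => /predU1P[<-|/u_ge0//]; rewrite u0.
have max_gt0 (t : R) : 0 < t -> Num.max t 0 = t by move=> t0; rewrite max_l// ltW.
split.
- by [].
- move=> t t0; apply: (@near_eq_is_derive _ _ _ u).
    by near=> s; rewrite max_gt0//; near: s; exact: lt_nbhsr.
  rewrite max_gt0// /hderive t0 derive1E; apply/derivableP.
  by apply: du; rewrite in_itv/= t0.
- have cr : continuous (fun t : R => f (Num.max (u (Num.max t 0)) 0)).
    move=> t; apply: (@continuous_comp _ _ _ (fun t : R => u (Num.max t 0)) (fun x : R => f (Num.max x 0))).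
      exact: cuc.
    exact: cg.
  apply: (@du_bois_reymond R (fun t : R => flux p (hderive u (Num.max t 0)))
    (fun t : R => f (Num.max (u (Num.max t 0)) 0))) => //.
    move=> t; apply: (@continuous_comp _ _ _ (fun t : R => hderive u (Num.max t 0)) (flux p)).
      exact: cvc.
    exact: continuous_flux.
  move=> phi /wu wphi.
  transitivity (\int[lebesgue_measure]_(t in `]0, +oo[)
      (`|hderive u t| `^ (p - 2) * hderive u t * derive1 phi t)).
    apply: eq_Rintegral => t; rewrite inE/= in_itv/= andbT => t0.
    by rewrite max_gt0.
  rewrite wphi; apply: eq_Rintegral => t; rewrite inE/= in_itv/= andbT => t0.
  by rewrite (max_gt0 t)// max_l// u_ge0.
- split; last by rewrite maxxx.
  by move=> t t0; rewrite max_l// u_ge0'.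
- have [M uM] := essentially_bounded cu (u_ge0' 0 (lexx 0)) bu.
  by exists M => t t0; rewrite max_l// uM.
Unshelve. all: by end_near. Qed.

Lemma test_function_support (R : realType) (phi : R -> R) : test_function phi ->
  exists l q : R, [/\ 0 < l, l < q & forall x, ~~ (l < x < q) -> phi x = 0].
Proof.
move=> [_ cK K0]; set K := closure _ in cK K0.
have phiK x : phi x != 0 -> K x by move=> x0; exact: subset_closure.
have [K_eq0|/set0P Kn0] := eqVneq K set0.
  exists 1, 2; split=> [||x _]; [by linarith|by linarith|].
  by apply/eqP/negPn/negP => /phiK; rewrite K_eq0.
have cid : {within K, continuous (@id R)} by apply: continuous_subspaceT => x; exact: cvg_id.
have [c + cmin] := compact_EVT_min Kn0 cK cid.
have [d + dmax] := compact_EVT_max Kn0 cK cid.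
rewrite !inE => /K0 /= d0 /K0 /= c0; rewrite !in_itv/= !andbT in c0 d0.
exists (c / 2), (c + d + 1); split; [by linarith|by linarith|].
move=> x xcd; apply/eqP/negPn/negP => /phiK Kx; move/negP: xcd; apply.
by have := cmin x; have := dmax x; rewrite inE => /(_ Kx) + /(_ Kx); linarith.
Qed.

Lemma test_function_derive (R : realType) (phi : R -> R) (l q : R) : test_function phi ->
  (forall x, ~~ (l < x < q) -> phi x = 0) ->
  [/\ forall x : R, is_derive x 1 phi (derive1 phi x), continuous (derive1 phi) &
      forall x, ~~ (l <= x <= q) -> derive1 phi x = 0].
Proof.
move=> [dphi _ _] phi0; split.
- by move=> x; rewrite derive1E; apply/derivableP; exact: (dphi 0%N x).
- by move=> x; apply/differentiable_continuous/derivable1_diffP; exact: (dphi 1%N x).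
- move=> x xlq; rewrite derive1E.
  have h : is_derive x 1 phi 0.
    apply: (@near_eq_is_derive R R R (cst 0)).
    move: xlq; rewrite negb_and -!ltNge => /orP[xl|xq].
      near=> z; rewrite phi0//; apply/negP; have : z < l by near: z; exact: lt_nbhsl.
      by linarith.
    near=> z; rewrite phi0//; apply/negP; have : q < z by near: z; exact: lt_nbhsr.
    by linarith.
  by rewrite derive_val.
Unshelve. all: by end_near. Qed.

(** Integration by parts by means of primitives: the product of the flux and [phi] vanishes at both
    ends of an interval containing the support. [g] need only agree with [f] on nonnegative numbers
    because [u] is nonnegative. *)
Lemma classical_solution_weak (R : realType) (p : R) (f g u v : R -> R) : 1 < p ->
  (forall x, 0 <= x -> g x = f x) -> continuous g ->
  classical_solution p g u v -> solution p f u /\ forall t, 0 <= t -> hderive u t = v t.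
Proof.
move=> p1 gf cg su; have [[cu cv] du dw [u_ge0 u0] [M uM]] := su.
have cw := continuous_flux_comp p1 su; have cr := continuous_reaction cg su.
have q0 : h^-1 * (u h - u 0) @[h --> (0 : R)^'+] --> v 0.
  apply/cvg_at_right0P => e e0.
  have [d d0 vd] := (continuous_atP _ _).1 (cv 0) _ e0.
  exists d => // h /andP[h0 hd].
  have [|x xh E] := @mean_value R u v 0 h h0 (fun x _ => cu x).
    by move=> x xh; apply: du; linarith.
  by rewrite E subr0 mulrC mulfK ?gt_eqF//; apply: vd; linarith.
have hv t : 0 <= t -> hderive u t = v t.
  rewrite /hderive le_eqVlt => /predU1P[<-|t0].
    by rewrite ltxx; exact: cvg_lim q0.
  by rewrite t0 derive1E; have ? := du t t0; rewrite derive_val.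
split=> //; split.
- split.
  + move=> t; rewrite in_itv/= andbT => t0; have ? := du t t0; exact: ex_derive.
  + by apply/cvg_ex; exists (v 0).
  + apply: (@subspace_eq_continuous _ _ _ v); last exact: continuous_subspaceT.
    by move=> t; rewrite inE/= in_itv/= andbT /from_subspace => /hv.
- move=> phi tphi.
  have [l [q [l0 lq phi0]]] := test_function_support tphi.
  have [dphi cdphi dphi0] := test_function_derive tphi phi0.
  have cphi x : {for x, continuous phi} by exact: is_derive_continuous (dphi x).
  transitivity (\int[lebesgue_measure]_(t in `]0, +oo[) (flux p (v t) * derive1 phi t)).
    apply: eq_Rintegral => t; rewrite inE/= in_itv/= andbT => t0.
    by rewrite hv// ltW.
  transitivity (\int[lebesgue_measure]_(t in `]0, +oo[) (g (u t) * phi t)); last first.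
    apply: eq_Rintegral => t; rewrite inE/= in_itv/= andbT => t0.
    by rewrite gf// u_ge0// ltW.
  rewrite (@Rintegral_halfline_support R _ l q)//; last first.
    by move=> x xlq; rewrite dphi0// mulr0.
  rewrite (@Rintegral_halfline_support R _ l q)//; last first.
    move=> x xlq; rewrite phi0 ?mulr0//; apply/negP => h.
    by move/negP: xlq; apply; linarith.
  have cA x : {for x, continuous (fun x => flux p (v x) * derive1 phi x)}.
    by apply: continuousM; [exact: cw|exact: cdphi].
  have cB x : {for x, continuous (fun x => g (u x) * phi x)}.
    by apply: continuousM; [exact: cr|exact: cphi].
  have [A dA] := @primitive_exists R _ 0 (fun x _ => cA x).
  have [B dB] := @primitive_exists R _ 0 (fun x _ => cB x).
  have -> : \int[lebesgue_measure]_(x in `[l, q]) (flux p (v x) * derive1 phi x) = A q - A l.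
    apply: Rfundamental_theorem => // [|x xlq|x xlq]; first exact: ltW.
      by apply: is_derive_continuous; apply: dA; linarith.
    by apply: dA; linarith.
  have -> : \int[lebesgue_measure]_(x in `[l, q]) (g (u x) * phi x) = B q - B l.
    apply: Rfundamental_theorem => // [|x xlq|x xlq]; first exact: ltW.
      by apply: is_derive_continuous; apply: dB; linarith.
    by apply: dB; linarith.
  pose T x := A x - B x - flux p (v x) * phi x.
  have dT (x : R) : 0 < x -> is_derive x 1 T 0.
    move=> x0; have := dA _ x0; have := dB _ x0; have := dw _ x0; have := dphi x.
    move=> h1 h2 h3 h4.
    have -> : T = A - B - (fun s => flux p (v s)) * phi by [].
    by apply: is_derive_eq; rewrite /GRing.scale/=; ring.
  have : T l = T q.
    apply: derive_eq0_cst => [|x xlq|x xlq]; first exact: ltW.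
      by apply: is_derive_continuous; apply: dT; linarith.
    by apply: dT; linarith.
  by rewrite /T !phi0 ?ltxx ?andbF// !mulr0; linarith.
- by move=> t t0; apply: u_ge0; exact: ltW.
- by [].
- rewrite Lnorm.unlock; case: ifPn => // _.
  apply: (@le_lt_trans _ _ M%:E); last exact: ltry.
  apply/ess_supP; apply: nearW => x /=.
  rewrite patchE; case: ifPn => [|_]; last first.
    by rewrite normr0 lee_fin (le_trans (u_ge0 0 (lexx _)))// uM.
  rewrite inE/= in_itv/= andbT => x0.
  by rewrite lee_fin ger0_norm ?uM ?u_ge0// ltW.
Qed.

(** * Autonomous first-order equations *)

Lemma primitive_halfopen (R : realType) (k : R -> R) (c b : R) :
  (forall x, c <= x < b -> {for x, continuous k}) ->
  exists G : R -> R, forall x, c < x < b -> is_derive x 1 G (k x).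
Proof.
move=> ck; exists (fun x => \int[lebesgue_measure]_(t in `[c, x]) k t) => x /andP[cx xb].
have [||||dG GE] := @continuous_FTC1_closed R k c x ((x + b) / 2).
- by linarith.
- by apply: continuous_segment_integrable => z zx; apply: ck; linarith.
- exact: cx.
- by apply: ck; linarith.
by apply: DeriveDef; [exact: dG|rewrite -derive1E; exact: GE].
Qed.

(** [k] may be non-integrable at both ends, so no endpoint can serve as base point. A primitive
    running to the right from [l] and a reflected one running to the left from [r] are glued at [m],
    on whose neighbourhood []l, r[] they differ by a constant. *)
Lemma primitive_open (R : realType) (k : R -> R) (a b : R) : a < b ->
  (forall x, a < x < b -> {for x, continuous k}) ->
  exists G : R -> R, forall x, a < x < b -> is_derive x 1 G (k x).
Proof.
move=> ab ck; pose l := (a + a + b) / 3; pose m := (a + b) / 2; pose r := (a + b + b) / 3.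
have [G dG] := @primitive_halfopen R k l b (fun x xl => ck x ltac:(rewrite /l in xl; linarith)).
have [|G' dG'] := @primitive_halfopen R (fun x => k (- x)) (- r) (- a).
  move=> x xr; apply: (@continuous_comp _ _ _ -%R k); first exact: continuousN.
  by apply: ck; rewrite /r in xr; linarith.
pose L x := - G' (- x).
have dL x : a < x < r -> is_derive x 1 L (k x).
  move=> xar; have := dG' (- x) ltac:(linarith); rewrite opprK => h.
  have -> : L = - (G' \o -%R) by [].
  by apply: is_derive_eq; rewrite mulrN1 opprK.
have lm : l < m by rewrite /l /m; linarith.
have mr : m < r by rewrite /m /r; linarith.
have al : a < l by rewrite /l; linarith.
have rb : r < b by rewrite /r; linarith.
have glue x : l < x < r -> L x - L m + G m = G x.
  move=> xlr; suff : L x - G x = L m - G m by linarith.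
  have dD y : l < y < r -> is_derive y 1 (L - G) 0.
    move=> ylr; have ? := dL y ltac:(linarith); have ? := dG y ltac:(linarith).
    by apply: is_derive_eq; rewrite subrr.
  have [xm|/ltW mx] := leP x m.
    apply: (@derive_eq0_cst R (L - G) x m xm) => y yx.
      by apply: (is_derive_continuous (dD y _)); linarith.
    by apply: dD; linarith.
  apply/esym; apply: (@derive_eq0_cst R (L - G) m x mx) => y yx.
    by apply: (is_derive_continuous (dD y _)); linarith.
  by apply: dD; linarith.
exists (fun x => if x < m then L x - L m + G m else G x) => x xab.
have [xm|mx] := ltP x m.
  apply: (@near_eq_is_derive R R R (fun x => L x - L m + G m)).
    by near=> y; rewrite ifT//; near: y; exact: lt_nbhsl.
  have ? := dL x ltac:(linarith).
  have -> : (fun x => L x - L m + G m) = L - cst (L m) + cst (G m) by [].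
  by apply: is_derive_eq; rewrite subr0 addr0.
apply: (@near_eq_is_derive R R R G); last by apply: dG; linarith.
near=> y; case: ifPn => // ym; rewrite glue//; apply/andP; split.
  by near: y; apply: lt_nbhsr; linarith.
linarith.
Unshelve. all: by end_near. Qed.

(** By the mean value theorem the difference quotient at [c] is a value of [k] at a point between.
    This recovers the equations at turning times. *)
Lemma derive_at_isolated (R : realType) (f k : R -> R) (c e : R) : 0 < e ->
  {for c, continuous f} -> {for c, continuous k} ->
  (forall x, x != c -> c - e < x < c + e -> is_derive x 1 f (k x)) ->
  is_derive c 1 f (k c).
Proof.
move=> e0 cf ck df; have cfx x : c - e < x < c + e -> {for x, continuous f}.
  have [->//|xc xe] := eqVneq x c.
  by apply: is_derive_continuous; exact: df.
apply/is_derive1_caratheodory.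
exists (fun z => if z == c then k c else (f z - f c) / (z - c)); split.
- move=> z; case: eqVneq => [->|zc]; first by rewrite !subrr mulr0.
  by rewrite divfK// subr_eq0.
- apply/continuous_atP => d d0; rewrite eqxx.
  have [r r0 kr] := (continuous_atP _ _).1 ck d d0.
  exists (Num.min r e); first by rewrite lt_min r0.
  move=> y; have m1 : Num.min r e <= r by rewrite ge_min lexx.
  have m2 : Num.min r e <= e by rewrite ge_min lexx orbT.
  move=> yc; case: eqVneq => [_|y_neq]; first by linarith.
  have [ylt|ylt] := ltP y c.
    have [|x xe|x xyc E] := @mean_value R f k y c ylt.
    - by move=> x xe; apply: cfx; linarith.
    - by apply: df; [apply/eqP; linarith|linarith].
    rewrite -(opprB (f c)) E -(opprB c) mulrC invrN mulNr mulrN opprK.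
    by rewrite mulrC mulfK; [apply: kr; linarith|apply/eqP; linarith].
  have cy : c < y by rewrite lt_neqAle eq_sym y_neq.
  have [|x xe|x xyc E] := @mean_value R f k c y cy.
  - by move=> x xe; apply: cfx; linarith.
  - by apply: df; [apply/eqP; linarith|linarith].
  by rewrite E mulfK; [apply: kr; linarith|apply/eqP; linarith].
- by rewrite eqxx.
Qed.

(** [Phi] is the time map up to a constant. It comes before the bound so that the bound can be
    proved for this very [Phi]; boundedness below means that height [0] is left at a finite time
    [A], which is shifted to time [0]. The clause with [A] is what later decides whether [rho] is
    reached. *)
Lemma autonomous_existence (R : realType) (H : R -> R) (rho : R) : 0 < rho ->
  (forall y, 0 < y < rho -> {for y, continuous H}) ->
  (forall y, 0 < y < rho -> 0 < H y) ->
  exists Phi : R -> R, (forall y, 0 < y < rho -> is_derive y 1 Phi (H y)^-1) /\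
  ((exists B, forall y, 0 < y < rho -> B <= Phi y) ->
   exists U : R -> R, [/\ continuous U /\ U 0 = 0, forall t, 0 <= U t <= rho,
    forall t, 0 < t -> U t < rho -> 0 < U t /\ is_derive t 1 U (H (U t)) &
    exists A, forall t y, 0 < y < rho -> (y < U t -> Phi y - A < t) /\ (U t < y -> t < Phi y - A)]).
Proof.
move=> rho0 cH H0.
have H'0 y : 0 < y < rho -> 0 < (H y)^-1 by move=> /H0; rewrite invr_gt0.
have [|Phi dPhi] := @primitive_open R (fun y => (H y)^-1) 0 rho rho0.
  move=> x xr; apply: cvgV; first by rewrite gt_eqF// H0.
  exact: cH.
exists Phi; split=> // -[B PhiB].
have [g [cg gr gK dg gP]] := generalized_inverse rho0 dPhi H'0.
pose S := [set Phi y | y in `]0, rho[].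
have S0 y : 0 < y < rho -> S (Phi y) by move=> yr; exists y => //=; rewrite in_itv.
have mid : 0 < rho / 2 < rho by linarith.
have hS : has_inf S.
  split; first by exists (Phi (rho / 2)); exact: S0.
  by exists B => _ [y + <-]; rewrite /= in_itv/=; exact: PhiB.
pose A := inf S.
have AP y : 0 < y < rho -> A <= Phi y.
  by move=> yr; apply: ge_inf; [case: hS|exact: S0].
have AP' c : (forall y, 0 < y < rho -> c <= Phi y) -> c <= A.
  move=> cP; apply: lb_le_inf; first by case: hS.
  by move=> _ [y + <-]; rewrite /= in_itv/=; exact: cP.
pose U t := g (t + A).
have UP t y : 0 < y < rho -> (y < U t -> Phi y - A < t) /\ (U t < y -> t < Phi y - A).
  by move=> yr; have [h1 h2] := gP (t + A) y yr; split=> [/h1|/h2]; linarith.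
exists U; split.
- split.
    move=> t; apply: (@continuous_comp _ _ _ (fun t => t + A) g); last exact: cg.
    by apply: continuousD; [exact: cvg_id|exact: cvg_cst].
  have := gr (0 + A); rewrite -/(U 0); have [U0 U0r|U0] := ltP 0 (U 0); last by linarith.
  have := (UP 0 (U 0 / 2) ltac:(linarith)).1 ltac:(linarith).
  by have := AP (U 0 / 2); linarith.
- by move=> t; exact: gr.
- move=> t t0 Ur.
  have U0 : 0 < U t.
    have := gr (t + A); rewrite -/(U t) => Ut; rewrite lt_neqAle; apply/andP; split; last by linarith.
    apply/eqP => U0.
    (* If [U t = 0], no height has been passed at time [t], so [A + t] would be a lower bound of
       [Phi] beyond its infimum. *)
    suff : A + t <= A by linarith.
    apply: AP' => y yr; have := (UP t y yr).2; rewrite -U0; linarith.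
  split=> //.
  have Ur' : 0 < U t < rho by rewrite U0.
  (* Otherwise continuity of [Phi] would give a height just above or just below [U t] on the wrong
     side of time [t]. *)
  have PU : Phi (U t) = t + A.
    have cP := is_derive_continuous (dPhi _ Ur').
    have [h|h|//] := ltgtP (Phi (U t)) (t + A).
      have e0 : 0 < t + A - Phi (U t) by linarith.
      have [d d0 Pd] := (continuous_atP _ _).1 cP _ e0.
      pose y := U t + Num.min d (rho - U t) / 2.
      have m1 : Num.min d (rho - U t) <= d by rewrite ge_min lexx.
      have m2 : Num.min d (rho - U t) <= rho - U t by rewrite ge_min lexx orbT.
      have m3 : 0 < Num.min d (rho - U t) by rewrite lt_min d0 subr_gt0.
      have := Pd y; have := (UP t y); rewrite /y; linarith.
    have e0 : 0 < Phi (U t) - (t + A) by linarith.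
    have [d d0 Pd] := (continuous_atP _ _).1 cP _ e0.
    pose y := U t - Num.min d (U t) / 2.
    have m1 : Num.min d (U t) <= d by rewrite ge_min lexx.
    have m2 : Num.min d (U t) <= U t by rewrite ge_min lexx orbT.
    have m3 : 0 < Num.min d (U t) by rewrite lt_min d0.
    have := Pd y; have := (UP t y); rewrite /y; linarith.
  have := dg _ Ur'; rewrite PU invrK => dgU.
  have h : is_derive t 1 (g \o (id + cst A)) (H (U t)).
    have dA : is_derive t 1 (id + cst A : R -> R) 1.
      by have := is_deriveD (is_derive_id t (1 : R)) (is_derive_cst A t (1 : R)); rewrite addr0.
    by have := @is_derive1_comp R g (id + cst A) t _ _ dgU dA; rewrite mulr1.
  exact: h.
- by exists A.
Qed.

(** * Time maps *)

(** The speed that the energy dictates at height [y] when it vanishes at height [rho]. The absolute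
    value makes it continuous at every [y >= 0], even where the potential defect is negative. *)
Definition speed (R : realType) (p : R) (F : R -> R) (rho y : R) : R :=
  `|p / (p - 1) * (F rho - F y)| `^ p^-1.

Definition speed_flux (R : realType) (p : R) (F : R -> R) (rho y : R) : R :=
  `|p / (p - 1) * (F rho - F y)| `^ ((p - 1) / p).

Lemma flux_speed (R : realType) (p : R) (F : R -> R) (rho y : R) : 1 < p ->
  flux p (speed p F rho y) = speed_flux p F rho y.
Proof.
move=> p1; rewrite flux_ge0E ?powR_ge0// -powRrM; congr (_ `^ _).
by rewrite mulrC.
Qed.

Lemma continuous_defect (R : realType) (p : R) (g F : R -> R) (rho y : R) :
  potential g F -> 0 <= y -> {for y, continuous (fun y => p / (p - 1) * (F rho - F y))}.
Proof.
move=> [_ dF _] y0; apply: continuousM; first exact: cvg_cst.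
apply: continuousB; first exact: cvg_cst.
by apply: is_derive_continuous; exact: dF.
Qed.

Lemma continuous_speed (R : realType) (p : R) (g F : R -> R) (rho y : R) : 1 < p ->
  potential g F -> 0 <= y -> {for y, continuous (speed p F rho)}.
Proof.
move=> p1 pF y0.
apply: (@continuous_comp _ _ _ (fun y => p / (p - 1) * (F rho - F y)) (fun x => `|x| `^ p^-1)).
  exact: continuous_defect pF y0.
by apply: continuous_norm_powR; rewrite invr_gt0; linarith.
Qed.

Lemma defect_gt0 (R : realType) (p : R) (F : R -> R) (rho y : R) : 1 < p ->
  F y < F rho -> 0 < p / (p - 1) * (F rho - F y).
Proof. by move=> p1 Fy; rewrite mulr_gt0 ?subr_gt0//; apply: divr_gt0; linarith. Qed.

Lemma speed_gt0 (R : realType) (p : R) (F : R -> R) (rho y : R) : 1 < p ->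
  F y < F rho -> 0 < speed p F rho y.
Proof. by move=> p1 /(defect_gt0 p1) d0; rewrite powR_gt0// normr_gt0 gt_eqF. Qed.

Lemma speed_eq0 (R : realType) (p : R) (F : R -> R) (rho y : R) : 1 < p ->
  F y = F rho -> speed p F rho y = 0.
Proof.
move=> p1 Fy; rewrite /speed Fy subrr mulr0 normr0 powR0// invr_eq0 gt_eqF//; linarith.
Qed.

(** Where [g] is bounded away from [0], this derivative is comparable to [1 / speed]; this makes the
    flux a barrier for the time map. *)
Lemma is_derive_speed_flux (R : realType) (p : R) (g F : R -> R) (rho y : R) : 1 < p ->
  potential g F -> 0 <= y -> F y < F rho ->
  is_derive y 1 (speed_flux p F rho) (- g y / speed p F rho y).
Proof.
move=> p1 pF y0 Fy; have [_ dF _] := pF.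
have d0 := defect_gt0 p1 Fy; have dFy := dF y y0.
apply: (@near_eq_is_derive R R R
    (fun y => (p / (p - 1) * (F rho - F y)) `^ ((p - 1) / p))).
  have cd := continuous_defect (p := p) (rho := rho) pF y0.
  have [d dpos dd] := (continuous_atP _ _).1 cd _ d0.
  near=> z; rewrite /speed_flux ger0_norm//.
  have z1 : y - d < z by near: z; apply: lt_nbhsr; linarith.
  have z2 : z < y + d by near: z; apply: lt_nbhsl; linarith.
  by have := dd z ltac:(linarith); linarith.
have h1 : is_derive y 1 (fun y => p / (p - 1) * (F rho - F y)) (p / (p - 1) * - g y).
  have -> : (fun y => p / (p - 1) * (F rho - F y)) = (p / (p - 1)) \*: (cst (F rho) - F) by [].
  by apply: is_derive_eq; rewrite sub0r.
have h2 := @is_derive1_powR R ((p - 1) / p) _ d0.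
have := @is_derive1_comp R (fun x => x `^ ((p - 1) / p)) _ y _ _ h2 h1.
have -> // : (p - 1) / p * (p / (p - 1) * (F rho - F y)) `^ ((p - 1) / p - 1) *
  (p / (p - 1) * - g y) = - g y / speed p F rho y.
have -> : (p - 1) / p - 1 = - p^-1 by field; rewrite gt_eqF//; linarith.
rewrite powRN /speed gtr0_norm//; set Y := (_ `^ p^-1)^-1.
by field; apply/andP; split; rewrite gt_eqF//; linarith.
Unshelve. all: by end_near. Qed.

Lemma time_map_comparison (R : realType) (Phi phi th dth : R -> R) (a b x y : R) :
  (forall y, a < y < b -> is_derive y 1 Phi (phi y)) ->
  (forall y, a < y < b -> is_derive y 1 th (dth y)) ->
  (forall y, a < y < b -> phi y <= dth y) ->
  a < x -> x <= y -> y < b -> Phi y - Phi x <= th y - th x.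
Proof.
move=> dPhi dth_ le ax xy yb; suff : th x - Phi x <= th y - Phi y by linarith.
apply: (@derive_ge0_le R (th - Phi) (fun z => dth z - phi z) x y xy) => z zxy.
- apply: (@is_derive_continuous _ _ _ (dth z - phi z)).
  have ? := dPhi z ltac:(linarith); have ? := dth_ z ltac:(linarith); exact: is_deriveB.
- have ? := dPhi z ltac:(linarith); have ? := dth_ z ltac:(linarith); exact: is_deriveB.
- by rewrite subr_ge0 le//; linarith.
Qed.

Lemma time_map_mono (R : realType) (p : R) (F Phi : R -> R) (rho : R) : 1 < p ->
  (forall y, 0 < y < rho -> F y < F rho) ->
  (forall y, 0 < y < rho -> is_derive y 1 Phi (speed p F rho y)^-1) ->
  forall x y, 0 < x -> x <= y -> y < rho -> Phi x <= Phi y.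
Proof.
move=> p1 Fy dPhi x y x0 xy yr.
apply: (@derive_ge0_le R Phi (fun z => (speed p F rho z)^-1)) => // z zxy.
- by apply: is_derive_continuous; apply: dPhi; linarith.
- by apply: dPhi; linarith.
- by rewrite invr_ge0 ltW// speed_gt0// Fy//; linarith.
Qed.

(** It suffices to find, near [0], a nonnegative [th] whose derivative dominates [1 / speed]: the
    time spent near [0] is then at most [th (eta / 2)]. *)
Lemma time_map_lower (R : realType) (p : R) (g F Phi : R -> R) (rho : R) : 1 < p ->
  potential g F -> 0 < rho -> (forall y, 0 < y < rho -> F y < F rho) ->
  0 < F rho \/ g 0 < 0 ->
  (forall y, 0 < y < rho -> is_derive y 1 Phi (speed p F rho y)^-1) ->
  exists B, forall y, 0 < y < rho -> B <= Phi y.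
Proof.
move=> p1 pF rho0 Fy start dPhi; have [cg dF F0] := pF.
have mono := time_map_mono p1 Fy dPhi.
suff [eta [th [dth [e0 er [dth_ le th0]]]]] : exists eta (th dth : R -> R),
    [/\ 0 < eta, eta < rho & [/\ forall y, 0 < y < eta -> is_derive y 1 th (dth y),
      forall y, 0 < y < eta -> (speed p F rho y)^-1 <= dth y & forall y, 0 < y < eta -> 0 <= th y]].
  have h x : 0 < x < eta / 2 -> Phi (eta / 2) - th (eta / 2) <= Phi x.
    move=> xe; have := th0 x ltac:(linarith).
    have := @time_map_comparison R Phi (fun z => (speed p F rho z)^-1) th dth 0 eta x (eta / 2).
    move=> /(_ _ dth_ le) h; have := h (fun y ye => dPhi y ltac:(linarith)).
    linarith.
  exists (Phi (eta / 2) - th (eta / 2)) => y yr; have [ye|ye] := ltP y (eta / 2).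
    by apply: h; linarith.
  by have := mono (eta / 2) y ltac:(linarith) ye ltac:(linarith); have := th0 (eta / 2) ltac:(linarith); linarith.
(* With [0 < F rho] the speed is positive at [0], and a linear [th] works. *)
case: start => [Fr|g0].
  have s0 : 0 < speed p F rho 0 by apply: speed_gt0; rewrite // F0.
  have s2 : 0 < speed p F rho 0 / 2 by linarith.
  have [d d0 sd] := (continuous_atP _ _).1 (@continuous_speed R p g F rho 0 p1 pF (lexx 0)) _ s2.
  exists (Num.min d rho / 2), (fun y => (speed p F rho 0 / 2)^-1 * y), (fun=> (speed p F rho 0 / 2)^-1).
  have m1 : Num.min d rho <= d by rewrite ge_min lexx.
  have m2 : Num.min d rho <= rho by rewrite ge_min lexx orbT.
  have m3 : 0 < Num.min d rho by rewrite lt_min d0.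
  split; [by linarith|by linarith|split=> y ym].
  - have -> : (fun y => (speed p F rho 0 / 2)^-1 * y) = (speed p F rho 0 / 2)^-1 \*: id by [].
    by apply: is_derive_eq; rewrite /GRing.scale/= mulr1.
  - by rewrite lef_pV2 ?posrE ?speed_gt0//; [have := sd y; linarith|apply: Fy; linarith].
  - by rewrite mulr_ge0// ?invr_ge0 ?ltW//; linarith.
(* Here the speed may vanish at [0]; but [- g] stays above [- g 0 / 2] nearby, and a multiple of the
   flux works. *)
have g2 : 0 < - g 0 / 2 by linarith.
have [d d0 gd] := (continuous_atP _ _).1 (cg 0) _ g2.
exists (Num.min d rho / 2), (fun y => (- g 0 / 2)^-1 * speed_flux p F rho y),
  (fun y => (- g 0 / 2)^-1 * (- g y / speed p F rho y)).
have m1 : Num.min d rho <= d by rewrite ge_min lexx.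
have m2 : Num.min d rho <= rho by rewrite ge_min lexx orbT.
have m3 : 0 < Num.min d rho by rewrite lt_min d0.
split; [by linarith|by linarith|split=> y ym].
- have ? := is_derive_speed_flux p1 pF (ltac:(linarith) : 0 <= y) (Fy y ltac:(linarith)).
  exact: is_deriveZ.
- have sy : 0 < speed p F rho y by apply: speed_gt0 => //; apply: Fy; linarith.
  rewrite mulrA ler_peMl ?invr_ge0 ?(ltW sy)// -ler_pdivrMl ?invr_gt0// invrK mulr1.
  by have := gd y; linarith.
- by rewrite mulr_ge0 ?powR_ge0// invr_ge0 ltW.
Qed.

(** Near [rho] one has [g >= g rho / 2], so a negative multiple of the flux grows at least as fast
    as [Phi]; being nonpositive, it bounds [Phi] from above. *)
Lemma time_map_upper (R : realType) (p : R) (g F Phi : R -> R) (rho : R) : 1 < p ->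
  potential g F -> 0 < rho -> (forall y, 0 < y < rho -> F y < F rho) -> 0 < g rho ->
  (forall y, 0 < y < rho -> is_derive y 1 Phi (speed p F rho y)^-1) ->
  exists B, forall y, 0 < y < rho -> Phi y <= B.
Proof.
move=> p1 pF rho0 Fy g0 dPhi; have [cg dF F0] := pF.
have mono := time_map_mono p1 Fy dPhi.
have g2 : 0 < g rho / 2 by linarith.
have [d d0 gd] := (continuous_atP _ _).1 (cg rho) _ g2.
have m1 : Num.min d rho <= d by rewrite ge_min lexx.
have m2 : Num.min d rho <= rho by rewrite ge_min lexx orbT.
have m3 : 0 < Num.min d rho by rewrite lt_min d0.
pose a := rho - Num.min d rho / 2; pose m := (a + rho) / 2.
pose th y := - (g rho / 2)^-1 * speed_flux p F rho y.
have cmp y : m <= y -> y < rho -> Phi y - Phi m <= th y - th m.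
  move=> my yr; apply: (@time_map_comparison R Phi (fun z => (speed p F rho z)^-1) th
    (fun y => - (g rho / 2)^-1 * (- g y / speed p F rho y)) a rho m y _ _ _ _ my yr).
  - by move=> z zr; apply: dPhi; rewrite /a in zr; linarith.
  - move=> z zr; rewrite /a in zr.
    have ? := is_derive_speed_flux p1 pF (ltac:(linarith) : 0 <= z) (Fy z ltac:(linarith)).
    exact: is_deriveZ.
  - move=> z zr; rewrite /a in zr.
    have sz : 0 < speed p F rho z by apply: speed_gt0 => //; apply: Fy; linarith.
    rewrite mulNr mulNr mulrN opprK mulrA ler_peMl ?invr_ge0 ?(ltW sz)//.
    rewrite -ler_pdivrMl ?invr_gt0// invrK mulr1.
    by have := gd z; linarith.
  - by rewrite /m /a; linarith.
have thle0 y : th y <= 0.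
  by rewrite /th mulNr oppr_le0 mulr_ge0 ?powR_ge0// invr_ge0 ltW.
exists (Phi m - th m) => y yr; have [ym|my] := ltP y m.
  have := mono y m ltac:(linarith) (ltW ym) ltac:(rewrite /m /a; linarith).
  by have := thle0 m; linarith.
by have := cmp y my ltac:(linarith); have := thle0 y; linarith.
Qed.

(** At a zero of [g] the speed is at most [K * (rho - y)], so [Phi] grows at least like
    [- ln (rho - y) / K]. *)
Lemma time_map_unbounded (R : realType) (p : R) (g F Phi : R -> R) (rho : R) : 1 < p ->
  potential g F -> subpower_at_zeros p g F -> 0 < rho ->
  (forall y, 0 < y < rho -> F y < F rho) -> g rho = 0 ->
  (forall y, 0 < y < rho -> is_derive y 1 Phi (speed p F rho y)^-1) ->
  forall B, exists2 y, 0 < y < rho & B < Phi y.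
Proof.
move=> p1 pF pz rho0 Fy g0 dPhi B.
have mono := time_map_mono p1 Fy dPhi.
have p0 : 0 < p by linarith.
have k0 : 0 < p / (p - 1) by apply: divr_gt0; linarith.
have [C [d [C0 d0 FC]]] := pz rho (ltW rho0) g0.
(* The added [1] keeps [K] positive when [C = 0]. *)
pose K := (p / (p - 1) * C) `^ p^-1 + 1.
have K0 : 0 < K by rewrite ltr_wpDl// powR_ge0.
have speedK y : 0 < y -> rho - d < y < rho -> speed p F rho y <= K * (rho - y).
  move=> y0 yr; have Gy := defect_gt0 p1 (Fy y ltac:(linarith)).
  have ryn : `|y - rho| = rho - y by rewrite distrC gtr0_norm; linarith.
  apply: (@le_trans _ _ ((p / (p - 1) * C) `^ p^-1 * (rho - y))); last first.
    by rewrite ler_wpM2r ?lerDl//; linarith.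
  rewrite -[X in _ * X](@powR_invK _ p)//; last by linarith.
  rewrite -powRM ?powR_ge0//; last by rewrite mulr_ge0// ltW.
  rewrite /speed gtr0_norm// ge0_ler_powR// ?nnegrE.
  - by rewrite invr_ge0 ltW.
  - exact: ltW.
  - by apply: mulr_ge0; [apply: mulr_ge0; [exact: ltW|]|exact: powR_ge0].
  - by rewrite -[X in _ <= X]mulrA ler_pM2l// -ryn; apply: FC; [linarith|rewrite ryn; linarith].
pose a := rho - Num.min d rho / 2; pose m := (a + rho) / 2.
have m1 : Num.min d rho <= d by rewrite ge_min lexx.
have m2 : Num.min d rho <= rho by rewrite ge_min lexx orbT.
have m3 : 0 < Num.min d rho by rewrite lt_min d0.
have am : a < m < rho by rewrite /m /a; linarith.
have a0 : 0 < a by rewrite /a; linarith.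
pose th y := - K^-1 * ln (rho - y).
have cmp y : m <= y -> y < rho -> th y - th m <= Phi y - Phi m.
  move=> my yr; apply: (@time_map_comparison R th (fun z => (K * (rho - z))^-1) Phi
    (fun y => (speed p F rho y)^-1) a rho m y _ _ _ _ my yr); last by linarith.
  - move=> z zr; have rz : 0 < rho - z by linarith.
    have ? := is_derive1_ln rz.
    have -> : th = (- K^-1) \*: (@ln R \o (cst rho - id)) by [].
    apply: is_derive_eq.
    by rewrite /GRing.scale/= sub0r mulrN1 mulrNN invfM.
  - by move=> z zr; apply: dPhi; linarith.
  - move=> z zr; rewrite lef_pV2 ?posrE.
    + by apply: speedK; rewrite /a in zr; linarith.
    + by rewrite mulr_gt0//; linarith.
    + by apply: speed_gt0 => //; apply: Fy; linarith.
(* Within distance [exp (- M)] of [rho] the barrier [th] exceeds [B - Phi m + th m]. *)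
pose M := K * (`|B - Phi m + th m| + 1).
pose y := Num.max m (rho - expR (- M)).
have ey := expR_gt0 (- M).
have ym : m <= y by rewrite le_max lexx.
have yr : y < rho by rewrite gt_max; apply/andP; split; linarith.
exists y; first by linarith.
have lny : ln (rho - y) <= - M.
  rewrite -[X in _ <= X]expRK ler_ln ?posrE//; last by linarith.
  by have : rho - expR (- M) <= y; [rewrite le_max lexx orbT|linarith].
have thy : `|B - Phi m + th m| + 1 <= th y.
  have -> : th y = K^-1 * - ln (rho - y) by rewrite /th mulNr mulrN.
  by rewrite ler_pdivlMl// -/M; linarith.
have := cmp y ym yr; have := ler_norm (B - Phi m + th m); linarith.
Qed.

(** * Existence *)

Lemma near_eq_continuous_at (R : realType) (f g : R -> R) (x : R) :
  (\forall y \near x, f y = g y) -> {for x, continuous f} -> {for x, continuous g}.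
Proof.
move=> fg cf; rewrite /prop_for /continuous_at -(nbhs_singleton fg).
by apply: cvg_trans cf; exact: near_eq_cvg.
Qed.

Lemma continuous_mull (R : realType) (c : R) (f : R -> R) (x : R) :
  {for x, continuous f} -> {for x, continuous (fun y => c * f y)}.
Proof. by move=> cf; apply: continuousM => //; exact: cvg_cst. Qed.

Lemma increasing_existence (R : realType) (p : R) (g F : R -> R) (rho : R) : 1 < p ->
  potential g F -> subpower_at_zeros p g F -> 0 < rho -> g rho = 0 ->
  (forall y, 0 < y < rho -> F y < F rho) -> 0 <= F rho -> 0 < F rho \/ g 0 < 0 ->
  exists u v : R -> R, [/\ classical_solution p g u v, forall t, 0 < t -> 0 < v t,
    u t @[t --> +oo] --> rho & v 0 = (p / (p - 1) * F rho) `^ p^-1].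
Proof.
move=> p1 pF pz rho0 grho Fy Frho0 start; have [cg dF F0] := pF.
have cs y : 0 <= y -> {for y, continuous (speed p F rho)}.
  by move=> y0; exact: continuous_speed pF y0.
have s0 y : 0 < y < rho -> 0 < speed p F rho y by move=> yr; apply: speed_gt0; rewrite ?Fy.
have [|Phi [dPhi exU]] := @autonomous_existence R (speed p F rho) rho rho0 _ s0.
  by move=> y yr; apply: cs; linarith.
have [U [[cU U0] Ur dU [A UA]]] := exU (time_map_lower p1 pF rho0 Fy start dPhi).
(* If [rho] were reached at time [t], all values of [Phi] would lie below [t + A]. *)
have Ult t : U t < rho.
  have [|h] := ltP (U t) rho; first by [].
  have [y yr ty] := time_map_unbounded p1 pF pz rho0 Fy grho dPhi (t + A).
  have := (UA t y yr).1; linarith.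
have Upos t : 0 < t -> 0 < U t by move=> t0; case: (dU t t0 (Ult t)).
have dUt (t : R) : 0 < t -> is_derive t 1 U (speed p F rho (U t)).
  by move=> t0; case: (dU t t0 (Ult t)).
exists U, (fun t => speed p F rho (U t)); split.
- split.
  + split=> // t; apply: (@continuous_comp _ _ _ U (speed p F rho)); first exact: cU.
    by apply: cs; case/andP: (Ur t).
  + exact: dUt.
  + move=> t t0; have h1 := dUt t t0; have Ut := Upos t t0.
    have FU : F (U t) < F rho by apply: Fy; rewrite Ut Ult.
    have h2 := is_derive_speed_flux p1 pF (ltW Ut) FU.
    have -> : (fun s => flux p (speed p F rho (U s))) = speed_flux p F rho \o U.
      by apply/funext => s /=; rewrite flux_speed.
    apply: is_derive_eq; rewrite divfK// gt_eqF// speed_gt0//.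
  + by split=> // t _; case/andP: (Ur t).
  + by exists rho => t _; case/andP: (Ur t).
- by move=> t t0; apply: s0; rewrite Upos// Ult.
- apply/cvgrPdist_lt => e e0.
  pose y := rho - Num.min e rho / 2.
  have m1 : Num.min e rho <= e by rewrite ge_min lexx.
  have m2 : Num.min e rho <= rho by rewrite ge_min lexx orbT.
  have m3 : 0 < Num.min e rho by rewrite lt_min e0.
  have yr : 0 < y < rho by rewrite /y; linarith.
  near=> t; have tT : Phi y - A <= t by near: t; apply: nbhs_pinfty_ge; rewrite num_real.
  have yU : y <= U t by rewrite leNgt; apply/negP => /(UA t y yr).2; linarith.
  by rewrite gtr0_norm ?subr_gt0 ?Ult//; rewrite /y in yU; linarith.
- rewrite U0 /speed F0 subr0 ger0_norm// mulr_ge0//; apply: divr_ge0; linarith.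
Unshelve. all: by end_near. Qed.

(** [tau] is the triangle wave of period [2 * T], written as [T / pi] times the arccosine of
    [cos (pi * t / T)]. Its symmetries are those of the cosine, and its slope is the sign of the
    sine. *)
Lemma folding (R : realType) (T : R) : 0 < T -> exists tau : R -> R,
  [/\ continuous tau, forall t, 0 <= t <= T -> tau t = t,
    forall (t : R) (k : nat), tau (t + (2 * k)%:R * T) = tau t /\
      tau (t + (2 * k + 1)%:R * T) = tau (T - t),
    forall t, sin (pi / T * t) != 0 -> 0 < tau t < T /\ is_derive t 1 tau (Num.sg (sin (pi / T * t))) &
    forall t, sin (pi / T * t) = 0 -> tau t = 0 \/ tau t = T].
Proof.
move=> T0; have pi0 := @pi_gt0 R; set w := pi / T.
have w0 : 0 < w by exact: divr_gt0.
have wT : w * T = pi by rewrite divfK// gt_eqF.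
have dcos (y : R) : is_derive y 1 (fun y => - cos y) (sin y).
  have -> : (fun y : R => - cos y) = - cos by [].
  by apply: is_derive_eq; rewrite opprK.
(* [- cos] is used because it increases on [[0, pi]], as the inverse lemma requires. *)
have [||ac [cac acr acK dac]] := @generalized_inverse_closed R (fun y => - cos y) sin 0 pi pi0.
- by move=> y _; exact: is_derive_continuous (dcos y).
- by move=> y yp; exact: sin_gt0_pi.
pose tau t := w^-1 * ac (- cos (w * t)).
have cwt (t : R) : {for t, continuous (fun t => - cos (w * t))}.
  apply: continuousN; apply: (@continuous_comp _ _ _ (fun t => w * t) cos).
    by apply: continuousM; [exact: cvg_cst|exact: cvg_id].
  exact: continuous_cos.
exists tau; split.
- move=> t; apply: (@continuous_mull R w^-1 (fun t => ac (- cos (w * t)))).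
  by apply: (@continuous_comp _ _ _ (fun t => - cos (w * t)) ac); [exact: cwt|exact: cac].
- move=> t tT; rewrite /tau acK ?mulKf ?gt_eqF//.
  by rewrite mulr_ge0 ?(ltW w0)//= -?wT ?ler_pM2l//; linarith.
- move=> t k.
  have E1 s : w * (s + (2 * k)%:R * T) = w * s + (pi *+ 2) *+ k.
    by rewrite mulrDr; congr (_ + _); rewrite mulrCA wT mulr_natl mulrnA.
  split; rewrite /tau.
    by rewrite E1 (periodicn (@cosD2pi R)).
  have -> : t + (2 * k + 1)%:R * T = t + T + (2 * k)%:R * T.
    by rewrite natrD mulrDl mul1r; ring.
  rewrite E1 (periodicn (@cosD2pi R)) mulrDr wT cosDpi.
  by rewrite mulrBr wT addrC cosDpi cosN.
- move=> t st; set th := w * t in st *.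
  have c1 : -1 <= cos th <= 1 by rewrite cos_geN1 cos_le1.
  pose y := acos (cos th).
  have cy : cos y = cos th by rewrite acosK// in_itv.
  have yr : 0 <= y <= pi by rewrite acos_ge0// acos_lepi.
  have sy2 : `|sin y| = `|sin th|.
    by rewrite -sqrtr_sqr sin2cos2 cy -sin2cos2 sqrtr_sqr.
  have y0 : 0 < y < pi.
    rewrite !lt_neqAle; apply/andP; split; apply/andP; split; [|by linarith| |by linarith].
      apply: contra st => /eqP y0; rewrite -normr_eq0 -sy2 -y0 sin0 normr0//.
    by apply: contra st => /eqP y0; rewrite -normr_eq0 -sy2 y0 sinpi normr0.
  have sy : sin y = `|sin th| by rewrite -sy2 gtr0_norm// sin_gt0_pi.
  have aE : ac (- cos th) = y by rewrite -cy acK.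
  split.
    rewrite /tau -/th aE; have -> : T = w^-1 * pi by rewrite -wT mulKf// gt_eqF.
    by rewrite mulr_gt0 ?invr_gt0//=; [rewrite ltr_pM2l ?invr_gt0//|]; linarith.
  have dy := dac y y0; rewrite cy in dy.
  have d1 : is_derive t 1 (fun t => - cos (w * t)) (sin th * w).
    have d0 : is_derive t 1 (fun t : R => w * t) w.
      have -> : (fun t : R => w * t) = w \*: id by [].
      by apply: is_derive_eq; rewrite /GRing.scale/= mulr1.
    exact: (@is_derive1_comp R (fun y => - cos y) (fun t => w * t) t _ _ (dcos _) d0).
  have d2 := @is_derive1_comp R ac (fun t => - cos (w * t)) t _ _ dy d1.
  have -> : tau = w^-1 \*: (ac \o (fun t => - cos (w * t))) by [].
  apply: is_derive_eq; rewrite /GRing.scale/= sy.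
  have -> : Num.sg (sin th) = sin th / `|sin th|.
    by rewrite -[X in X / _]mulr_sg_norm mulfK// normr_eq0.
  by field; rewrite normr_eq0 st gt_eqF.
- move=> t st; rewrite /tau.
  have : `|cos (w * t)| = 1 by exact: sin0cos1.
  have [c0|c0] := leP 0 (cos (w * t)).
    rewrite ger0_norm// => ->; left; rewrite -[X in - X](@cos0 R) acK ?mulr0//.
    by rewrite lexx ltW.
  rewrite ltr0_norm// => ->; right; rewrite -[X in ac X]opprK -(@cospi R) acK.
    by rewrite -wT mulKf// gt_eqF.
  by rewrite lexx ltW.
Qed.

(** The arc [U] climbs to [rho] in a finite time [T] and is composed with the triangle wave; the
    velocity is the speed with the sign of the sine. At turning times the speed vanishes, so the
    jump of the sign does no harm. *)
Lemma periodic_existence (R : realType) (p : R) (g F : R -> R) (rho : R) : 1 < p ->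
  potential g F -> 0 < rho -> (forall y, 0 < y < rho -> F y < F rho) -> F rho = 0 ->
  g 0 < 0 -> 0 < g rho ->
  exists (T : R) (u v : R -> R), [/\ 0 < T, classical_solution p g u v,
    [/\ forall t, 0 < t < T -> 0 < v t, v 0 = 0, v T = 0 & u T = rho] &
    forall (t : R) (k : nat), 0 <= t <= T ->
      u (t + (2 * k)%:R * T) = u t /\ u (t + (2 * k + 1)%:R * T) = u (T - t)].
Proof.
move=> p1 pF rho0 Fy Frho0 g0 grho; have [cg dF F0] := pF.
have cs y : 0 <= y -> {for y, continuous (speed p F rho)}.
  by move=> y0; exact: continuous_speed pF y0.
have s_gt0 y : 0 < y < rho -> 0 < speed p F rho y by move=> yr; apply: speed_gt0; rewrite ?Fy.
have s_ge0 y : 0 <= speed p F rho y by exact: powR_ge0.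
have s0 : speed p F rho 0 = 0 by rewrite speed_eq0// F0.
have srho : speed p F rho rho = 0 by rewrite speed_eq0.
have [|Phi [dPhi exU]] := @autonomous_existence R (speed p F rho) rho rho0 _ s_gt0.
  by move=> y yr; apply: cs; linarith.
have [U [[cU U0] Ur dU [A UA]]] := exU (time_map_lower p1 pF rho0 Fy (or_intror g0) dPhi).
have [B PhiB] := time_map_upper p1 pF rho0 Fy grho dPhi.
(* A nonnegative time by which [rho] has certainly been reached, since [Phi] never exceeds [B]. *)
pose b := `|B - A|.
have bA : B - A <= b by exact: ler_norm.
have Ub : U b = rho.
  apply/eqP; rewrite eq_le; case/andP: (Ur b) => Ub0 ->/=; rewrite leNgt; apply/negP => Ub.
  have yr : 0 < (U b + rho) / 2 < rho by linarith.
  by have := (UA b _ yr).2; have := PhiB _ yr; linarith.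
have [|||T T0 [/eqP UT UTN]] := @first_zero R (fun t => rho - U t) 0 b (normr_ge0 _).
- by move=> x _; apply: continuousB; [exact: cvg_cst|exact: cU].
- by rewrite U0 subr0 gt_eqF.
- by rewrite Ub subrr.
have {}UT : U T = rho by move: UT; rewrite subr_eq0 => /eqP.
have {}T0 : 0 < T by linarith.
have Ult t : 0 < t < T -> 0 < U t < rho /\ is_derive t 1 U (speed p F rho (U t)).
  move=> tT; have Ut : U t < rho.
    rewrite lt_neqAle -subr_eq0; case/andP: (Ur t) => _ ->; rewrite andbT.
    by have := UTN t ltac:(linarith); rewrite -oppr_eq0 opprB.
  by have [|h1 h2] := dU t _ Ut; [linarith|rewrite h1].
have [tau [ctau tauE tauP dtau tau0]] := folding T0.
pose th t := pi / T * t.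
pose u t := U (tau t); pose v t := Num.sg (sin (th t)) * speed p F rho (u t).
have u_ge0 t : 0 <= u t by case/andP: (Ur (tau t)).
have cu : continuous u.
  by move=> t; apply: (@continuous_comp _ _ _ tau U); [exact: ctau|exact: cU].
have csu : continuous (fun t => speed p F rho (u t)).
  by move=> t; apply: (@continuous_comp _ _ _ u (speed p F rho)); [exact: cu|exact: cs].
have sin_th (t : R) : {for t, continuous (fun t => sin (th t))}.
  apply: (@continuous_comp _ _ _ th sin); last exact: continuous_sin.
  by apply: continuousM; [exact: cvg_cst|exact: cvg_id].
have near_sg t : sin (th t) != 0 -> \forall s \near t, Num.sg (sin (th t)) = Num.sg (sin (th s)).
  rewrite neq_lt => /orP[st|st].
    have st' : 0 < - sin (th t) by rewrite oppr_gt0.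
    have [d d0 sd] := (continuous_atP _ _).1 (sin_th t) _ st'.
    near=> s; have z1 : t - d < s by near: s; apply: lt_nbhsr; linarith.
    have z2 : s < t + d by near: s; apply: lt_nbhsl; linarith.
    by rewrite !ltr0_sg//; have := sd s; linarith.
  have [d d0 sd] := (continuous_atP _ _).1 (sin_th t) _ st.
  near=> s; have z1 : t - d < s by near: s; apply: lt_nbhsr; linarith.
  have z2 : s < t + d by near: s; apply: lt_nbhsl; linarith.
  by rewrite !gtr0_sg//; have := sd s; linarith.
have v_eq0 t : sin (th t) = 0 -> v t = 0 by move=> st; rewrite /v st sgr0 mul0r.
have su0 t : sin (th t) = 0 -> speed p F rho (u t) = 0.
  by move=> /tau0[]; rewrite /u => ->; rewrite ?U0 ?UT.
have norm_v t : `|v t| <= speed p F rho (u t).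
  rewrite /v normrM (ger0_norm (s_ge0 _)) normr_sg.
  by case: (_ != 0); rewrite ?mul1r ?mul0r.
have cv : continuous v.
  move=> t; have [st|st] := eqVneq (sin (th t)) 0.
    apply/continuous_atP => e e0.
    have [d d0 sd] := (continuous_atP _ _).1 (csu t) _ e0.
    exists d => // y /sd; rewrite su0// v_eq0// !add0r => sy.
    by have := norm_v y; rewrite ler_norml; linarith.
  apply: (@near_eq_continuous_at R (fun s => Num.sg (sin (th t)) * speed p F rho (u s))).
    by apply: filterS (near_sg t st) => s; rewrite /v => ->.
  by apply: continuousM; [exact: cvg_cst|exact: csu].
have flux_v t : flux p (v t) = Num.sg (sin (th t)) * speed_flux p F rho (u t).
  rewrite /v; case: (sgrP (sin (th t))) => _.
  - by rewrite !mul0r flux0.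
  - by rewrite !mul1r flux_speed.
  - by rewrite !mulN1r fluxN flux_speed.
have regular t : sin (th t) != 0 -> is_derive t 1 u (v t) /\
    is_derive t 1 (fun s => flux p (v s)) (- g (u t)).
  move=> st; have [tauT dtaut] := dtau t st.
  have [uT dUt] := Ult _ tauT; rewrite -/(u t) in uT dUt.
  have du : is_derive t 1 u (v t).
    have := @is_derive1_comp R U tau t _ _ dUt dtaut.
    by rewrite mulrC.
  split=> //.
  have ds := @is_derive1_comp R _ u t _ _ (is_derive_speed_flux p1 pF (u_ge0 t) (Fy _ uT)) du.
  apply: (@near_eq_is_derive R R R (fun s => Num.sg (sin (th t)) * speed_flux p F rho (u s))).
    by apply: filterS (near_sg t st) => s; rewrite flux_v => ->.
  have -> : (fun s => Num.sg (sin (th t)) * speed_flux p F rho (u s)) =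
    Num.sg (sin (th t)) \*: (speed_flux p F rho \o u) by [].
  apply: is_derive_eq; rewrite /GRing.scale/= /v.
  have sg2 : Num.sg (sin (th t)) * Num.sg (sin (th t)) = 1 by rewrite -expr2 sqr_sg st.
  rewrite [_ * speed _ _ _ _]mulrC [_ / _ * _]mulrA divfK ?gt_eqF ?s_gt0//.
  by rewrite mulrCA sg2 mulr1.
(* Consecutive zeros of the sine are [T] apart, which lets [derive_at_isolated] handle the turning
   times. *)
have isolated t x : sin (th t) = 0 -> x != t -> t - T < x < t + T -> sin (th x) != 0.
  move=> st xt xT; have -> : th x = th t + th (x - t) by rewrite /th; ring.
  rewrite sinD st mul0r add0r mulf_neq0//.
    by rewrite -normr_eq0 sin0cos1// oner_neq0.
  have thT : pi / T * T = pi :> R by rewrite divfK// gt_eqF.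
  have w0 : 0 < pi / T :> R by rewrite divr_gt0// pi_gt0.
  have [h|h] := ltP t x.
    rewrite gt_eqF// sin_gt0_pi// /th mulr_gt0 ?subr_gt0//=.
    by rewrite -[X in _ < X]thT ltr_pM2l//; linarith.
  have {}h : x < t by rewrite lt_neqAle xt.
  rewrite -oppr_eq0 -sinN gt_eqF// sin_gt0_pi// /th -mulrN mulr_gt0 ?opprB ?subr_gt0//=.
  by rewrite -[X in _ < X]thT ltr_pM2l//; linarith.
have du (t : R) : is_derive t 1 u (v t).
  have [st|/regular[]//] := eqVneq (sin (th t)) 0.
  apply: (derive_at_isolated T0 (cu t) (cv t)) => x xt xT.
  by case: (regular x (isolated t x st xt xT)).
have cfv : continuous (fun s => flux p (v s)).
  by move=> t; apply: (@continuous_comp _ _ _ v (flux p)); [exact: cv|exact: continuous_flux].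
have cgu : continuous (fun s => - g (u s)).
  move=> t; apply: continuousN.
  by apply: (@continuous_comp _ _ _ u g); [exact: cu|exact: cg].
have dw (t : R) : is_derive t 1 (fun s => flux p (v s)) (- g (u t)).
  have [st|/regular[]//] := eqVneq (sin (th t)) 0.
  apply: (derive_at_isolated T0 (cfv t) (cgu t)) => x xt xT.
  by case: (regular x (isolated t x st xt xT)).
have tau_0 : tau 0 = 0 by rewrite tauE// lexx ltW.
have tau_T : tau T = T by rewrite tauE// lexx ltW.
exists T, u, v; split=> //.
- split=> // [|]; first by split=> [t _|]; [exact: u_ge0|rewrite /u tau_0].
  by exists rho => t _; case/andP: (Ur (tau t)).
- split.
  + move=> t tT; have st : 0 < sin (th t).
      apply: sin_gt0_pi; rewrite /th; apply/andP; split.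
        by rewrite mulr_gt0 ?divr_gt0 ?pi_gt0//; linarith.
      by rewrite mulrAC -mulrA gtr_pMr ?pi_gt0// ltr_pdivrMr// mul1r; linarith.
    rewrite /v gtr0_sg// mul1r s_gt0// /u tauE; last by linarith.
    by case: (Ult t tT).
  + by rewrite v_eq0// /th mulr0 sin0.
  + by rewrite v_eq0// /th divfK ?gt_eqF// sinpi.
  + by rewrite /u tau_T.
- by move=> t k _; have [e1 e2] := tauP t k; rewrite /u e1 e2.
Unshelve. all: by end_near. Qed.

(** The inverse of [u] goes from [0] to [T] and has derivative [1 / v]. The energy makes this the
    integrand of [half_period], up to a power of [p / (p - 1)] that the prefactor cancels. *)
Lemma half_period_time (R : realType) (p : R) (f F u v : R -> R) (T : R) : 1 < p ->
  (forall y, 0 <= y -> primitive f y = F y) ->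
  (forall y : R, 0 < y -> {for y, continuous F}) -> 0 < T ->
  continuous u -> u 0 = 0 -> (forall t, 0 < t < T -> is_derive t 1 u (v t)) ->
  (forall t, 0 < t < T -> 0 < v t) ->
  (forall t, 0 < t < T -> v t = (p / (p - 1) * (F (u T) - F (u t))) `^ p^-1) ->
  (forall y, 0 < y < u T -> F y < F (u T)) ->
  half_period p f (u T) = T.
Proof.
move=> p1 fF cF T0 cu u0 du v0 vE Fy.
have [g [cg gr gK dg]] := @generalized_inverse_closed R u v 0 T T0 (fun t _ => cu t) du v0.
have uT : 0 < u T.
  by rewrite -u0; apply: (derive_gt0_lt T0 _ du v0) => x _; exact: cu.
pose c : R := ((p - 1) / p) `^ p^-1.
have c0 : 0 < c by rewrite powR_gt0//; apply: divr_gt0; linarith.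
have ck : c * (p / (p - 1)) `^ p^-1 = 1.
  rewrite -powRM; [|by apply: divr_ge0; linarith|by apply: divr_ge0; linarith].
  have -> : (p - 1) / p * (p / (p - 1)) = 1.
    by field; apply/andP; split; rewrite gt_eqF//; linarith.
  by rewrite powR1.
pose k s := ((primitive f (u T) - primitive f s) `^ p^-1)^-1.
have kE y : 0 < y < u T -> k y = (`|F (u T) - F y| `^ p^-1)^-1.
  move=> yu; rewrite /k !fF ?(ltW uT)//; last by linarith.
  by rewrite gtr0_norm// subr_gt0 Fy.
have -> : half_period p f (u T) = c * \int[lebesgue_measure]_(s in `[0, u T]) k s by [].
suff -> : \int[lebesgue_measure]_(s in `[0, u T]) k s = c^-1 * g (u T) - c^-1 * g 0.
  by rewrite gK ?lexx ?ltW// -[X in g X]u0 gK ?lexx ?ltW// mulr0 subr0 mulVKf// gt_eqF.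
apply: (@improper_fundamental_theorem R (fun y => c^-1 * g y) k 0 (u T)) => //.
- by move=> x; apply: continuous_mull; exact: cg.
- move=> x xu; apply: (@near_eq_continuous_at R (fun y => (`|F (u T) - F y| `^ p^-1)^-1)).
    near=> y; rewrite kE//; apply/andP; split; near: y; [apply: lt_nbhsr|apply: lt_nbhsl]; linarith.
  apply: cvgV; first by rewrite gt_eqF// powR_gt0// normr_gt0 subr_eq0 gt_eqF// Fy.
  apply: (@continuous_comp _ _ _ (fun y => F (u T) - F y) (fun x => `|x| `^ p^-1)).
    by apply: continuousB; [exact: cvg_cst|apply: cF; linarith].
  by apply: continuous_norm_powR; rewrite invr_gt0; linarith.
- move=> x xu.
  have [||t tT ut] := @intermediate_value R u 0 T x (ltW T0).
  + by move=> z _; exact: cu.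
  + by left; rewrite u0; linarith.
  have t0 : t != 0 by apply/eqP => t0; move: ut; rewrite t0 u0; linarith.
  have t1 : t != T by apply/eqP => t1; move: ut; rewrite t1; linarith.
  have {}tT : 0 < t < T by rewrite !lt_neqAle eq_sym t0 t1; linarith.
  have dgx := dg t tT; rewrite ut in dgx.
  have -> : (fun y => c^-1 * g y) = c^-1 \*: g by [].
  apply: is_derive_eq; rewrite /GRing.scale/= kE// vE// ut.
  have d0 : 0 < F (u T) - F x by rewrite subr_gt0 Fy.
  rewrite powRM; [|by apply: divr_ge0; linarith|exact: ltW].
  by rewrite gtr0_norm// -invfM mulrA ck mul1r.
- by move=> x xu; rewrite kE// invr_ge0 powR_ge0.
Unshelve. all: by end_near. Qed.

(** * The hypotheses on the nonlinearity and the classification *)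

Lemma limf_einf_gtNy (R : realType) (f : R -> R) (a z : R) :
  (-oo < limf_einf (fun t => (f t / (t - z) `^ a)%:E) z^'+)%E ->
  exists C d : R, [/\ 0 <= C, 0 < d & forall t, z < t < z + d -> - C * (t - z) `^ a <= f t].
Proof.
rewrite limf_einfE => /ereal_sup_gt[_ [V zV <-]] hV.
have [c hc] : exists c : R, forall t, V t -> c <= f t / (t - z) `^ a.
  have lb t : V t -> (ereal_inf [set (f t / (t - z) `^ a)%:E | t in V] <= (f t / (t - z) `^ a)%:E)%E.
    by move=> Vt; apply: ereal_inf_lbound; exists t.
  move: hV lb; case: (ereal_inf _) => [c _ lb|_ lb|//].
    by exists c => t /lb; rewrite lee_fin.
  by exists 0 => t /lb.
clear hV; move: zV => /nbhs_ballP[d /= d0 dV].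
exists `|c|, d; split=> // t tz.
have Vt : V t by apply: dV; rewrite /ball/= ?ltr_norml; linarith.
have tz0 : 0 < (t - z) `^ a by rewrite powR_gt0; linarith.
rewrite -ler_pdivlMr//; apply: le_trans (hc t Vt).
by have := ler_norm (- c); rewrite normrN; linarith.
Qed.

Lemma limf_esup_lty (R : realType) (f : R -> R) (a z : R) :
  (limf_esup (fun t => (f t / (z - t) `^ a)%:E) z^'- < +oo)%E ->
  exists C d : R, [/\ 0 <= C, 0 < d & forall t, z - d < t < z -> f t <= C * (z - t) `^ a].
Proof.
rewrite limf_esupE => /ereal_inf_lt[_ [V zV <-]] hV.
have [c hc] : exists c : R, forall t, V t -> f t / (z - t) `^ a <= c.
  have ub t : V t -> ((f t / (z - t) `^ a)%:E <= ereal_sup [set (f t / (z - t) `^ a)%:E | t in V])%E.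
    by move=> Vt; apply: ereal_sup_ubound; exists t.
  move: hV ub; case: (ereal_sup _) => [c _ ub|//|_ ub].
    by exists c => t /ub; rewrite lee_fin.
  by exists 0 => t /ub.
clear hV; move: zV => /nbhs_ballP[d /= d0 dV].
exists `|c|, d; split=> // t tz.
have Vt : V t by apply: dV; rewrite /ball/= ?ltr_norml; linarith.
have tz0 : 0 < (z - t) `^ a by rewrite powR_gt0; linarith.
rewrite -ler_pdivrMr//; apply: le_trans (hc t Vt) _; exact: ler_norm.
Qed.

Lemma potential_primitive (R : realType) (f : R -> R) :
  {within `[0, +oo[, continuous f} -> exists F : R -> R,
  potential (fun x => f (Num.max x 0)) F /\ forall y, 0 <= y -> primitive f y = F y.
Proof.
move=> cf; have cg := continuous_clamp cf.
(* The base point [-1] makes the derivative at [0] two-sided. *)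
have [G dG] := @primitive_exists R (fun x => f (Num.max x 0)) (-1) (fun x _ => cg x).
have dF (x : R) : 0 <= x -> is_derive x 1 (G - cst (G 0)) (f (Num.max x 0)).
  by move=> x0; have ? := dG x ltac:(linarith); apply: is_derive_eq; rewrite subr0.
exists (G - cst (G 0)); split.
  by split=> //; rewrite !fctE subrr.
move=> y y0; transitivity (\int[lebesgue_measure]_(s in `[0, y]) f (Num.max s 0)).
  by apply: eq_Rintegral => s; rewrite inE/= in_itv/= => /andP[s0 _]; rewrite max_l.
apply: Rfundamental_theorem => // [x x0|x _|x x0]; last by apply: dG; linarith.
  by apply: is_derive_continuous; apply: dG; linarith.
exact: cg.
Qed.

(** [F s - F z] is [f c * (s - z)] for some [c] between, and the bound on [f c] by a power of
    [|c - z|] passes to [|s - z|] by monotonicity. *)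
Lemma subpower_of_limits (R : realType) (p : R) (f F : R -> R) : 1 < p ->
  potential (fun x => f (Num.max x 0)) F ->
  (forall z, zeros f z ->
    (-oo < limf_einf (fun t => (f t / (t - z) `^ (p - 1))%:E) z^'+)%E) ->
  (forall z, zeros f z -> 0 < z ->
    (limf_esup (fun t => (f t / (z - t) `^ (p - 1))%:E) z^'- < +oo)%E) ->
  subpower_at_zeros p (fun x => f (Num.max x 0)) F.
Proof.
move=> p1 pF finf fsup z z0 gz; have [cg dF _] := pF.
have fz : zeros f z by split=> //; rewrite max_l in gz.
have powE (x : R) : 0 <= x -> x `^ (p - 1) * x = x `^ p.
  by move=> x0; rewrite mulrC mulr_powRB1//; linarith.
have [C1 [d1 [C10 d10 f1]]] := limf_einf_gtNy (finf z fz).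
have right s : z < s < z + d1 -> F z - F s <= C1 * (s - z) `^ p.
  move=> /andP[zs sd].
  have [||c cs E] := @mean_value R F (fun x => f (Num.max x 0)) z s zs.
  - by move=> x xs; apply: is_derive_continuous; apply: dF; linarith.
  - by move=> x xs; apply: dF; linarith.
  rewrite max_l in E; last by linarith.
  have fc := f1 c ltac:(linarith).
  have pc : (c - z) `^ (p - 1) <= (s - z) `^ (p - 1).
    by rewrite ge0_ler_powR ?nnegrE; linarith.
  have : - C1 * (s - z) `^ (p - 1) <= f c.
    by apply: le_trans fc; rewrite !mulNr lerN2 ler_wpM2l.
  rewrite -(ler_pM2r (_ : 0 < s - z)); last by linarith.
  by rewrite -mulrA powE; linarith.
have right' s : z <= s < z + d1 -> F z - F s <= C1 * (s - z) `^ p.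
  move=> /andP[]; rewrite le_eqVlt => /predU1P[<- _|zs sd].
    by rewrite subrr mulr_ge0// powR_ge0.
  by apply: right; rewrite zs.
(* At [z = 0] every admissible [s] lies on the right. *)
have [z_eq0|z_neq0] := eqVneq z 0.
  exists C1, d1; split=> // s s0; rewrite z_eq0 subr0 ger0_norm// => sd.
  by have := right' s; rewrite z_eq0 subr0; apply; linarith.
have {z_neq0} z_gt0 : 0 < z by rewrite lt_neqAle eq_sym z_neq0.
have [C2 [d2 [C20 d20 f2]]] := limf_esup_lty (fsup z fz z_gt0).
have left s : 0 <= s -> z - d2 < s < z -> F z - F s <= C2 * (z - s) `^ p.
  move=> s0 /andP[sd sz].
  have [||c cs E] := @mean_value R F (fun x => f (Num.max x 0)) s z sz.
  - by move=> x xs; apply: is_derive_continuous; apply: dF; linarith.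
  - by move=> x xs; apply: dF; linarith.
  rewrite max_l in E; last by linarith.
  have fc := f2 c ltac:(linarith).
  have pc : (z - c) `^ (p - 1) <= (z - s) `^ (p - 1).
    by rewrite ge0_ler_powR ?nnegrE; linarith.
  have : f c <= C2 * (z - s) `^ (p - 1) by apply: (le_trans fc); rewrite ler_wpM2l.
  rewrite -(ler_pM2r (_ : 0 < z - s)); last by linarith.
  by rewrite -mulrA powE; linarith.
exists (C1 + C2), (Num.min d1 d2); split; [by linarith|by rewrite lt_min d10|].
move=> s s0; rewrite lt_min => /andP[sd1 sd2].
have pw := powR_ge0 `|s - z| p.
have w1 : C1 * `|s - z| `^ p <= (C1 + C2) * `|s - z| `^ p by rewrite ler_wpM2r//; linarith.
have w2 : C2 * `|s - z| `^ p <= (C1 + C2) * `|s - z| `^ p by rewrite ler_wpM2r//; linarith.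
have [zs|sz] := leP z s.
  apply: le_trans w1; move: sd1; rewrite ger0_norm ?subr_ge0// => sd1.
  by apply: right'; linarith.
apply: le_trans w2; move: sd2; rewrite distrC gtr0_norm ?subr_gt0// => sd2.
by apply: left; linarith.
Qed.

Lemma same_energy_unique (R : realType) (p : R) (g F u1 v1 u2 v2 : R -> R) (L : R) :
  1 < p -> potential g F -> classical_solution p g u1 v1 -> classical_solution p g u2 v2 ->
  `|v1 0| `^ p = `|v2 0| `^ p ->
  (forall t, 0 < t < L -> 0 < v1 t) -> (forall t, 0 < t < L -> 0 < v2 t) ->
  forall t, 0 <= t <= L -> u1 t = u2 t.
Proof.
move=> p1 pF s1 s2 E pos1 pos2.
pose H y := (`|v1 0| `^ p - p / (p - 1) * F y) `^ p^-1.
have H1 t : 0 < t < L -> H (u1 t) = v1 t.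
  move=> tL; rewrite /H -(speed_energy p1 pF s1); last by linarith.
  by rewrite gtr0_norm// pos1.
have H2 t : 0 < t < L -> H (u2 t) = v2 t.
  move=> tL; rewrite /H E -(speed_energy p1 pF s2); last by linarith.
  by rewrite gtr0_norm// pos2.
have [[cu1 _] du1 _ [_ u10] _] := s1; have [[cu2 _] du2 _ [_ u20] _] := s2.
apply: (@autonomous_uniqueness R H).
- by move=> t _; exact: cu1.
- by move=> t _; exact: cu2.
- by move=> t tL; rewrite H1//; apply: du1; linarith.
- by move=> t tL; rewrite H2//; apply: du2; linarith.
- by move=> t tL; rewrite H1// pos1.
- by move=> t tL; rewrite H2// pos2.
- by rewrite u10 u20.
Qed.

(** Merges the two branches: in the first, the condition at [t = 0] says [0 < F rho]; in the second,
    [F rho = 0] is paid for by [f 0 < 0]. *)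
Lemma zeros_starP (R : realType) (f F : R -> R) (rho : R) :
  potential (fun x => f (Num.max x 0)) F -> (forall y, 0 <= y -> primitive f y = F y) ->
  zeros_star f rho <-> [/\ 0 < rho, f rho = 0, forall y, 0 < y < rho -> F y < F rho,
    0 <= F rho & 0 < F rho \/ f 0 < 0].
Proof.
move=> [_ _ F0] fF; split.
  case=> [[[_ frho] rho0 prho]|].
    have Frho : 0 < F rho by rewrite -F0 -!fF ?(ltW rho0)//; apply: prho; rewrite lexx.
    split=> //; [|exact: ltW|by left].
    by move=> y yr; rewrite -!fF; [apply: prho| |]; linarith.
  rewrite /zeros0; case: ifPn => // f0 [[rho0 frho] pneg prho].
  (* [zeros0] does not itself exclude [0], but [f 0 < 0] does, as [f rho = 0]. *)
  have {}rho0 : 0 < rho.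
    by rewrite lt_neqAle rho0 andbT; apply/eqP => r0; move: f0; rewrite [X in f X]r0 frho ltxx.
  split=> //; [|by rewrite -fF ?prho// ltW|by right].
  by move=> y yr; rewrite -!fF; [rewrite prho; exact: pneg|linarith|linarith].
move=> [rho0 frho Fy Frho start].
have zr : zeros f rho by split=> //; exact: ltW.
have [Fpos|Fneg] := ltP 0 (F rho).
  left; split=> // t /andP[]; rewrite le_eqVlt => /predU1P[<- _|t0 tr].
    by rewrite !fF ?(ltW rho0)// F0.
  by rewrite !fF ?(ltW rho0) ?(ltW t0)// Fy// t0.
have F_eq0 : F rho = 0 by apply/eqP; rewrite eq_le Fneg.
have f0 : f 0 < 0 by case: start => //; rewrite F_eq0 ltxx.
right; rewrite /zeros0 f0; split=> //.
  by move=> t tr; rewrite fF; [rewrite -F_eq0; exact: Fy|linarith].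
by rewrite fF// ltW.
Qed.

Lemma solution_of_classical (R : realType) (p : R) (f u v : R -> R) : 1 < p ->
  {within `[0, +oo[, continuous f} ->
  classical_solution p (fun x => f (Num.max x 0)) u v ->
  solution p f u /\ forall t, 0 <= t -> hderive u t = v t.
Proof.
move=> p1 cf; apply: classical_solution_weak => //; last exact: continuous_clamp.
by move=> x x0; rewrite max_l.
Qed.

(** * Uniqueness on the half-line and the classification *)

Lemma increasing_solution_unique (R : realType) (p : R) (f F : R -> R) (rho : R)
    (u1 u2 : R -> R) : 1 < p -> {within `[0, +oo[, continuous f} ->
  potential (fun x => f (Num.max x 0)) F ->
  increasing_solution p f rho u1 -> increasing_solution p f rho u2 ->
  {in `[0, +oo[, u1 =1 u2}.
Proof.
move=> p1 cf pF [s1 pos1 _ e1] [s2 pos2 _ e2] t; rewrite in_itv/= andbT => t0.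
have c1 := solution_classical p1 cf s1; have c2 := solution_classical p1 cf s2.
have := @same_energy_unique R p _ F _ _ _ _ t p1 pF c1 c2.
rewrite !maxxx e1 e2 => /(_ erefl _ _ t).
rewrite t0 lexx max_l//; apply => // s st; rewrite max_l; try linarith.
  by apply: pos1; linarith.
by apply: pos2; linarith.
Qed.

Lemma periodic_determined (R : realType) (T : R) (u1 u2 : R -> R) : 0 < T ->
  (forall t, 0 <= t <= T -> u1 t = u2 t) ->
  (forall (t : R) (k : nat), 0 <= t <= T ->
      u1 (t + (2 * k)%:R * T) = u1 t /\ u1 (t + (2 * k + 1)%:R * T) = u1 (T - t)) ->
  (forall (t : R) (k : nat), 0 <= t <= T ->
      u2 (t + (2 * k)%:R * T) = u2 t /\ u2 (t + (2 * k + 1)%:R * T) = u2 (T - t)) ->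
  {in `[0, +oo[, u1 =1 u2}.
Proof.
move=> T0 uT per1 per2 t; rewrite in_itv/= andbT => t0.
(* [n] counts the elapsed half periods; its parity selects the rising or the reflected arc. *)
pose n := Num.truncn (t / T); pose s := t - n%:R * T.
have /andP[n1 n2] : n%:R <= t / T < n.+1%:R by apply: truncn_itv; rewrite divr_ge0// ltW.
have sT : 0 <= s <= T.
  move: n1 n2; rewrite ler_pdivlMr// ltr_pdivrMr// -natr1 mulrDl mul1r /s; linarith.
have -> : t = s + n%:R * T by rewrite /s subrK.
have := odd_double_half n; rewrite -mul2n; case: (odd n) => <-.
  rewrite addnC; have [_ ->] := per1 s n./2 sT; have [_ ->] := per2 s n./2 sT.
  by apply: uT; linarith.
rewrite add0n; have [-> _] := per1 s n./2 sT; have [-> _] := per2 s n./2 sT.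
exact: uT.
Qed.

Lemma periodic_solution_unique (R : realType) (p : R) (f F : R -> R) (rho : R)
    (u1 u2 : R -> R) : 1 < p -> {within `[0, +oo[, continuous f} ->
  potential (fun x => f (Num.max x 0)) F -> 0 < half_period p f rho ->
  periodic_solution p f rho u1 -> periodic_solution p f rho u2 ->
  {in `[0, +oo[, u1 =1 u2}.
Proof.
move=> p1 cf pF T0 [s1 pos1 [e1 _] _ per1] [s2 pos2 [e2 _] _ per2].
apply: (periodic_determined T0) => // t tT.
have c1 := solution_classical p1 cf s1; have c2 := solution_classical p1 cf s2.
have := @same_energy_unique R p _ F _ _ _ _ _ p1 pF c1 c2.
rewrite !maxxx e1 e2 => /(_ (half_period p f rho) erefl _ _ t tT).
rewrite max_l; last by case/andP: tT.
apply => // s st; rewrite max_l; try linarith.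
  exact: pos1.
exact: pos2.
Qed.

Lemma half_period_classical (R : realType) (p : R) (f F u v : R -> R) (T : R) : 1 < p ->
  potential (fun x => f (Num.max x 0)) F -> (forall y, 0 <= y -> primitive f y = F y) ->
  classical_solution p (fun x => f (Num.max x 0)) u v -> 0 < T -> v T = 0 ->
  (forall t, 0 < t < T -> 0 < v t) -> half_period p f (u T) = T.
Proof.
move=> p1 pF fF su T0 vT vpos; have [cg dF F0] := pF; have [[cu cv] du _ [_ u0] _] := su.
have ET := energy p1 pF su (ltW T0).
apply: (@half_period_time R p f F u v T) => //.
- by move=> y y0; apply: is_derive_continuous; apply: dF; exact: ltW.
- by move=> t tT; apply: du; linarith.
- move=> t tT; rewrite -[LHS]gtr0_norm ?vpos// (speed_energy p1 pF su); last by linarith.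
  congr (_ `^ _); move: ET; rewrite vT normr0 powR0; last by rewrite gt_eqF//; linarith.
  by rewrite mulrBr; linarith.
- by move=> y yu; exact: (potential_below_max p1 pF su T0 vT vpos yu).
Qed.

Theorem theorem2 (R : realType) (p : R) (f : R -> R)
  (p_gt1 : 1 < p)
  (f_continuous : {within `[0, +oo[, continuous f})
  (f_lipschitz : [locally [lipschitz f x | x in `[0, +oo[ `\` zeros f]])
  (f_liminf : forall z, zeros f z ->
    (-oo < limf_einf (fun t => (f t / (t - z) `^ (p - 1))%:E) z^'+)%E)
  (f_limsup : forall z, zeros f z -> 0 < z ->
    (limf_esup (fun t => (f t / (z - t) `^ (p - 1))%:E) z^'- < +oo)%E) :
  exists u_ utilde_ : R -> R -> R,
    [/\ forall rho, zeros_star f rho ->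
          unique_on_halfline (increasing_solution p f rho) (u_ rho),
        f 0 < 0 -> forall rho, periodic_heights f rho ->
          unique_on_halfline (periodic_solution p f rho) (utilde_ rho) &
        forall u, solution p f u -> (exists2 t : R, 0 <= t & u t != 0) ->
          (exists2 rho, zeros_star f rho & {in `[0, +oo[, u =1 u_ rho}) \/
          (f 0 < 0 /\
           exists2 rho, periodic_heights f rho &
             {in `[0, +oo[, u =1 utilde_ rho})].
Proof.
have [F [pF fF]] := potential_primitive f_continuous.
have pz := subpower_of_limits p_gt1 pF f_liminf f_limsup.
have [cg dF F0] := pF.
have g_ge0 x : 0 <= x -> f (Num.max x 0) = f x by move=> x0; rewrite max_l.
have k0 : 0 < p / (p - 1) by apply: divr_gt0; linarith.
(* The membership condition sits under the existential so that [choice] yields a family indexed by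
   all reals, with the zero function as a dummy outside the set. *)
have ex_inc rho : exists u, zeros_star f rho ->
    unique_on_halfline (increasing_solution p f rho) u.
  have [|h] := pselect (zeros_star f rho); last by exists (fun=> 0) => /h.
  move=> /(zeros_starP rho pF fF)[rho0 frho Fy Frho start].
  have grho : f (Num.max rho 0) = 0 by rewrite g_ge0// ltW.
  have start' : 0 < F rho \/ f (Num.max 0 0) < 0 by rewrite g_ge0.
  have [u [v [su vpos ulim v0]]] :=
    increasing_existence p_gt1 pF pz rho0 grho Fy Frho start'.
  have [sol hv] := solution_of_classical p_gt1 f_continuous su.
  have inc : increasing_solution p f rho u.
    split=> //; first by move=> t t0; rewrite hv ?ltW// vpos.
    by rewrite hv// v0 fF// ltW.
  exists u => _; split=> // w incw.
  by move=> t t0; apply/esym; exact: (increasing_solution_unique p_gt1 f_continuous pF inc incw).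
have ex_per rho : exists u, f 0 < 0 -> periodic_heights f rho ->
    unique_on_halfline (periodic_solution p f rho) u.
  have [f0|h] := pselect (f 0 < 0); last by exists (fun=> 0) => /h.
  have [|h] := pselect (periodic_heights f rho); last by exists (fun=> 0) => _ /h.
  move=> [rho0 pneg prho frho].
  have Frho : F rho = 0 by rewrite -fF// ltW.
  have Fy y : 0 < y < rho -> F y < F rho.
    by move=> yr; rewrite Frho -fF; [exact: pneg|linarith].
  have g0 : f (Num.max 0 0) < 0 by rewrite g_ge0.
  have grho : 0 < f (Num.max rho 0) by rewrite g_ge0// ltW.
  have [T [u [v [T0 su [vpos v0 vT uT] per]]]] :=
    periodic_existence p_gt1 pF rho0 Fy Frho g0 grho.
  have [sol hv] := solution_of_classical p_gt1 f_continuous su.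
  have hT : half_period p f rho = T.
    by rewrite -uT; exact: (half_period_classical p_gt1 pF fF su T0 vT vpos).
  have peru : periodic_solution p f rho u.
    rewrite /periodic_solution hT; split=> //.
      by move=> t tT; rewrite hv ?vpos//; linarith.
    by rewrite !hv// ltW.
  exists u => _ _; split=> // w perw t t0; apply/esym.
  by apply: (periodic_solution_unique p_gt1 f_continuous pF _ peru perw t0); rewrite hT.
have [u_ u_P] := choice ex_inc; have [ut_ ut_P] := choice ex_per.
exists u_, ut_; split.
- exact: u_P.
- by move=> f0 rho; exact: ut_P.
move=> u sol [t0 t0_ge0 ut0].
have su := solution_classical p_gt1 f_continuous sol.
have nt : exists2 t : R, 0 <= t & u (Num.max t 0) != 0 by exists t0; rewrite ?max_l.
have [vpos|[t1 t10 [vt1 vpos]]] := velocity_dichotomy p_gt1 pF pz su nt.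
  left; have [rho [rho0 ulim grho E Fy]] := increasing_profile p_gt1 pF su vpos.
  have frho : f rho = 0 by rewrite -g_ge0// ltW.
  have Frho : 0 <= F rho by rewrite -(pmulr_rge0 _ k0) -E powR_ge0.
  (* If [F rho = 0], the energy says that [u] starts from rest, and then [f 0 < 0]. *)
  have start : 0 < F rho \/ f 0 < 0.
    have [|Fr] := ltP 0 (F rho); first by left.
    right; rewrite -(g_ge0 0)//.
    apply: (start_reaction_lt0 p_gt1 pF pz su nt _ ltr01) => [|t tt]; last by apply: vpos; linarith.
    have Fr0 : F rho = 0 by apply/eqP; rewrite eq_le Fr.
    by apply/eqP; move: E; rewrite Fr0 mulr0 => /powR_eq0_eq0/eqP; rewrite normr_eq0.
  have zs : zeros_star f rho by apply/(zeros_starP rho pF fF).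
  exists rho => //.
  (* The energy only determines the absolute value of the initial velocity; its sign comes by
     continuity from positive times. *)
  have v0 : 0 <= hderive u 0.
    rewrite leNgt; apply/negP => v0; have [[_ cv] _ _ _ _] := su.
    have v0' : 0 < - hderive u (Num.max 0 0) by rewrite maxxx; linarith.
    have [d d0 vd] := (continuous_atP _ _).1 (cv 0) _ v0'.
    by have := vd (d / 2) ltac:(linarith); have := vpos (d / 2) ltac:(linarith); linarith.
  have inc : increasing_solution p f rho u.
    split=> //.
    - by move=> t tpos; have := vpos t tpos; rewrite max_l// ltW.
    - apply: cvg_trans ulim; apply: near_eq_cvg; near=> t; rewrite max_l//.
    - rewrite fF ?(ltW rho0)// -E maxxx powR_invK//; [by rewrite ger0_norm|by linarith].
  have [inc' _] := u_P rho zs.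
  exact: (increasing_solution_unique p_gt1 f_continuous pF inc inc').
right.
have [[v0 g0 Ft1 gt1] per] := periodic_profile p_gt1 pF pz su t10 vt1 vpos.
have f0 : f 0 < 0 by rewrite -(g_ge0 0).
split=> //.
have hT := half_period_classical p_gt1 pF fF su t10 vt1 vpos.
have t1E : Num.max t1 0 = t1 by rewrite max_l// ltW.
rewrite t1E in vt1 Ft1 gt1 hT *.
have ut1 : 0 <= u t1 by have [_ _ u_ge0 _ _] := sol; exact: u_ge0.
have ut1_gt0 : 0 < u t1.
  rewrite lt_neqAle ut1 andbT; apply/eqP => ut1_eq0.
  by move: gt1 g0; rewrite -ut1_eq0; linarith.
have ph : periodic_heights f (u t1).
  split=> //.
  - move=> t tt; rewrite fF -?Ft1; last by linarith.
    have := potential_below_max p_gt1 pF su t10 _ vpos.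
    by rewrite t1E => /(_ t vt1 tt).
  - by rewrite fF.
  - by rewrite -g_ge0.
exists (u t1) => //.
have peru : periodic_solution p f (u t1) u.
  rewrite /periodic_solution hT; split=> //.
  - by move=> t tt; have := vpos t tt; rewrite max_l//; linarith.
  - by split=> //; move: v0; rewrite maxxx.
  - move=> t k tt; have [] := per t k tt.
    have nk (n : nat) : 0 <= n%:R * t1 by rewrite mulr_ge0// ltW.
    have n1 := nk (2 * k)%N; have n2 := nk (2 * k + 1)%N.
    by rewrite !max_l//; linarith.
have [peru' _] := ut_P (u t1) f0 ph.
by apply: (periodic_solution_unique p_gt1 f_continuous pF _ peru peru'); rewrite hT.
Unshelve. all: by end_near. Qed.
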